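(* For any $0<a<\frac4e$, there exists a constant $M_a$ such that for any $c\geq1$ we have $$\lambda_n(c)\leq e^{-2n\log\left(\frac{an}{c}\right)}\qquad\text{for all integers } n\geq cM_a.$$ Moreover, for any $b>\frac4e$, there exists a constant $M_b$ such that for any $c\geq1$ we have $$\lambda_n(c)>e^{-2n\log\left(\frac{bn}{c}\right)}\qquad\text{for all integers } n\geq cM_b.$$
   Context: For $c>0$, let $\mathcal Q_c$ be the compact integral operator on $L^2([-1,1])$ given by $\mathcal Q_c(f)(x)=\int_{-1}^1\frac{\sin c(x-y)}{\pi(x-y)}f(y)\,dy$. Its eigenvalues are arranged in decreasing order $1>\lambda_0(c)>\lambda_1(c)>\cdots>\lambda_n(c)>\cdots>0$. Here $\log$ is the natural logarithm and $e$ its base. *)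

(* Defs.v *)
From HB Require Import structures.
From mathcomp Require Import all_boot all_order all_algebra.
From mathcomp Require Import all_classical all_reals all_analysis.

Set Implicit Arguments.
Unset Strict Implicit.
Unset Printing Implicit Defensive.

Import Order.TTheory GRing.Theory Num.Theory.
Import numFieldNormedType.Exports.

Local Open Scope classical_set_scope.
Local Open Scope ring_scope.

Definition leb11 (R : realType) : {measure set (measurableTypeR R) -> \bar R} :=
  mrestr (@lebesgue_measure R) (measurable_itv `[-1, 1]).

(* Representatives of elements of L^2([-1, 1]): they are defined on all of R, but
   [leb11 R] only sees [-1, 1]. Two of them are the same element of L^2([-1, 1])
   when they are equal [leb11 R]-almost everywhere. *)
Notation L2 R := (LfunType (leb11 R) (lee1n 2)).

(* The value c / pi on the diagonal is the continuous extension. *)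
Definition sinc_kernel (R : realType) (c x y : R) : R :=
  if x == y then c / pi else sin (c * (x - y)) / (pi * (x - y)).

Definition sinc_operator (R : realType) (c : R) (f : R -> R) (x : R) : R :=
  \int[@lebesgue_measure R]_(y in `[-1, 1]) (sinc_kernel c x y * f y).

Definition sinc_eigenspace (R : realType) (c mu : R) : set (L2 R) :=
  [set f : L2 R | sinc_operator c f = (mu *: f : L2 R) %[ae leb11 R]].

(* [E] has dimension [d] modulo almost everywhere equality. *)
Definition has_ae_dim (R : realType) (E : set (L2 R)) (d : nat) : Prop :=
  exists v : 'I_d -> L2 R,
    [/\ forall i, E (v i),
        forall a : 'I_d -> R,
          (\sum_(i < d) a i *: v i : L2 R) = (0 : L2 R) %[ae leb11 R] ->
          forall i, a i = 0
      & forall f, E f -> exists a : 'I_d -> R,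
          f = (\sum_(i < d) a i *: v i : L2 R) %[ae leb11 R]].

(* [lam] lists the eigenvalues of the operator in decreasing order, each one as
   often as its multiplicity; a real number that is not an eigenvalue has
   multiplicity 0. *)
Definition eigenvalues_in_decreasing_order (R : realType) (c : R)
    (lam : nat -> R) : Prop :=
  (forall m n, (m <= n)%N -> lam n <= lam m) /\
  (forall mu : R, exists2 d : nat,
     has_ae_dim (sinc_eigenspace c mu) d & ([set n | lam n = mu] #= `I_d)%card).

(* Main.v *)
Require Import Defs.
From HB Require Import structures.
From mathcomp Require Import all_boot all_order all_algebra.
From mathcomp Require Import all_classical all_reals all_analysis.
From mathcomp Require Import measurable_realfun ring lra.

(** The kernel sin (c (x - y)) / (pi (x - y)) is 1/pi times the integral of
    cos (t (x - y)) over t in [0, c]. Writing <f, g> for the inner product, the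
    quadratic form of the operator Q is therefore
<<
    <Q g, g> = (1/pi) int_0^c (<cos (t .), g>^2 + <sin (t .), g>^2) dt,
>>
    an integral over frequencies, which is handled through Riemann sums with an
    explicit error ([window_approx]). So Q is symmetric and nonnegative, and it is
    compact because its values are equi-Lipschitz functions. The spectral theory
    used consists of two principles. A nonzero g in the span of
    n + 1 eigenfunctions of index at most n has <Q g, g> >= lam n <g, g>
    ([span_form_ge]). If g is orthogonal to the eigenfunctions of index below n
    and <Q g, g> >= d <g, g>, then d <= lam n ([lam_ge_of_orthogonal]).

    Upper bound. Let L p = <p, g> for polynomials p, and let 2K be n or n - 1. For
    a number a the Neumann series L' of L solves L' p + a L' (W p) = L p, where
    W = [prim2] takes the double primitive. If L' vanishes on 1 and y, then
    t^2 L (cos (t .)) = (t^2 - a) L' (cos (t .)), because W acts on cos (t .) like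
    - 1 / t^2. Iterating over the K Chebyshev nodes a_j of [0, c^2] gives a
    functional L~ with
<<
    t^(2K) <cos (t .), g> = prod_j (t^2 - a_j) L~ (cos (t .)),
>>
    and the product is at most 2 (c / 2)^(2K) on [0, c] ([prod_alphas]). A
    combination g of n + 1 eigenfunctions can be chosen so that L~ vanishes on all
    polynomials of degree below 2K. Then only the Taylor terms of order at least
    2K count, and in each of them the monomial may be replaced by its remainder
    after a Chebyshev expansion cut at degree 2K, which is nearly 2^(-2K)
    ([monomial_truncation]). Hence the Fourier coefficients of g are at most about
    (c / 4)^n / n! times the norm of g, and by Stirling lam n is at most about
    (e c / (4 n))^(2 n). All losses are powers of n, exponentials in c, and
    exponentials in n of arbitrarily small rate; since a < 4 / e, they are absorbed
    when n / c is large ([eigenvalue_decay_upper]).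

    Lower bound. Take for g a nonzero polynomial of degree at most N = n + K which
    is orthogonal to the n first eigenfunctions and to the monomials of degree
    n + 1, ..., N; counting dimensions it exists. Integrating the Fourier
    coefficients over [0, t] gives, by Cauchy-Schwarz, functions of t bounded by
    sqrt (c pi <Q g, g>) on [0, c] ([kc0_sqr_le]). They are power series in t whose
    coefficients are the moments of g over factorials; by the choice of g they are
    polynomials of degree n + 1 up to a tail starting at degree N + 2. The bound
    [coef_le_sup] for the coefficients of a polynomial then bounds the moments of
    g, and applied to a primitive of g it bounds the coefficients of g by the norm
    of g. As |g|^2 is the sum of the products of coefficients and moments of equal
    degree,
<<
    |g| <= Gamma (sqrt (c pi <Q g, g>) + tail |g|)
>>
    ([nrm_le_lower]), where Gamma is about 4^n n! / c^n, the factor 4^n being the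
    square of the growth of the Chebyshev coefficients. With K = n / q for a large
    fixed q, the tail is negligible for n / c large while K hardly affects Gamma.
    So lam n is at least about (e c / (4 n))^(2 n), with losses that b > 4 / e
    absorbs ([eigenvalue_decay_lower]). *)

Set Implicit Arguments.
Unset Strict Implicit.
Unset Printing Implicit Defensive.
Import Order.TTheory GRing.Theory Num.Theory.
Import numFieldNormedType.Exports.
Local Open Scope classical_set_scope.
Local Open Scope ring_scope.

(** * Positive symmetric forms *)

Section PreHilbert.
Variables (R : realType) (V : lmodType R) (B : V -> V -> R).
Hypothesis BC : forall x y, B x y = B y x.
Hypothesis BDl : forall x y z, B (x + y) z = B x z + B y z.
Hypothesis BZl : forall a x z, B (a *: x) z = a * B x z.
Hypothesis B_ge0 : forall x, 0 <= B x x.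

Lemma formDr x y z : B z (x + y) = B z x + B z y.
Proof. by rewrite BC BDl !(BC z). Qed.
Lemma formZr a x z : B z (a *: x) = a * B z x.
Proof. by rewrite BC BZl (BC z). Qed.
Lemma form0l z : B 0 z = 0.
Proof. by rewrite -(scale0r z) BZl mul0r. Qed.
Lemma formNl x z : B (- x) z = - B x z.
Proof. by rewrite -scaleN1r BZl mulN1r. Qed.
Lemma formBl x y z : B (x - y) z = B x z - B y z.
Proof. by rewrite BDl formNl. Qed.
Lemma formBr x y z : B z (x - y) = B z x - B z y.
Proof. by rewrite BC formBl !(BC z). Qed.
Lemma form_suml I (r : seq I) (P : pred I) (F : I -> V) z :
  B (\sum_(i <- r | P i) F i) z = \sum_(i <- r | P i) B (F i) z.
Proof. by elim/big_rec2: _ => [|i y1 y2 _ <-]; rewrite ?form0l ?BDl. Qed.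
Lemma form_sumr I (r : seq I) (P : pred I) (F : I -> V) z :
  B z (\sum_(i <- r | P i) F i) = \sum_(i <- r | P i) B z (F i).
Proof. by rewrite BC form_suml; apply: eq_bigr => i _; rewrite BC. Qed.

(** Nonnegativity of [B (x - t *: y) (x - t *: y)] for every t. The form may be
    degenerate, as the inner product is on functions that are not identified
    almost everywhere, so [B y y = 0] needs its own choice of t. *)
Lemma form_cauchy_schwarz x y : B x y ^+ 2 <= B x x * B y y.
Proof.
have q t : 0 <= B x x - t * 2 * B x y + t ^+ 2 * B y y.
  rewrite (_ : _ + _ = B (x - t *: y) (x - t *: y)); first exact: B_ge0.
  rewrite formBl !formBr !BZl !formZr (BC y x); ring.
have [y0|y0] := eqVneq (B y y) 0.
  rewrite y0 mulr0 leNgt; apply/negP => p.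
  have xy0 : B x y != 0 by apply: contraTneq p => ->; rewrite expr0n ltxx.
  have := q ((B x x + 1) / (2 * B x y)).
  rewrite y0 mulr0 addr0 (_ : _ * 2 * _ = B x x + 1); last by field.
  lra.
have yp : 0 < B y y by rewrite lt_def y0 B_ge0.
have := q (B x y / B y y).
rewrite (_ : _ + _ = B x x - B x y ^+ 2 / B y y); last by field.
by rewrite subr_ge0 ler_pdivrMr.
Qed.

Definition fnorm x := Num.sqrt (B x x).

Lemma fnorm_ge0 x : 0 <= fnorm x. Proof. exact: sqrtr_ge0. Qed.
Lemma fnorm_sqr x : fnorm x ^+ 2 = B x x. Proof. by rewrite sqr_sqrtr. Qed.
Lemma form_le_fnorm x y : `|B x y| <= fnorm x * fnorm y.
Proof.
rewrite -ler_sqr ?nnegrE ?mulr_ge0 ?fnorm_ge0// exprMn !fnorm_sqr.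
by rewrite real_normK ?num_real// form_cauchy_schwarz.
Qed.
Lemma fnormD x y : fnorm (x + y) <= fnorm x + fnorm y.
Proof.
rewrite -ler_sqr ?nnegrE ?addr_ge0 ?fnorm_ge0// sqrrD !fnorm_sqr.
rewrite BDl !formDr (BC y x).
have := le_trans (ler_norm _) (form_le_fnorm x y); lra.
Qed.
Lemma fnormZ a x : fnorm (a *: x) = `|a| * fnorm x.
Proof.
by rewrite /fnorm BZl formZr mulrA -expr2 sqrtrM ?sqr_ge0// sqrtr_sqr.
Qed.
Lemma fnormN x : fnorm (- x) = fnorm x.
Proof. by rewrite -scaleN1r fnormZ normrN1 mul1r. Qed.
Lemma fnormB x y : fnorm (x - y) <= fnorm x + fnorm y.
Proof. by rewrite -(fnormN y) fnormD. Qed.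
End PreHilbert.

(** * The space of square-integrable functions on [-1, 1] *)

Section L2.
Variable R : realType.
Notation mu := (leb11 R).
Notation leb := (@lebesgue_measure R).
Implicit Types f g h : L2 R.
Local Notation T := (measurableTypeR R).
Local Notation I11 := (`[-1, 1]%classic : set R).

Lemma measurable_I11 : measurable (I11 : set T).
Proof. exact: measurable_itv. Qed.
Local Hint Resolve measurable_I11 : core.

Lemma leb11_ae (P : R -> Prop) : (forall x, I11 x -> P x) -> \forall x \ae mu, P x.
Proof.
move=> h; exists (~` I11); split.
- exact: measurableC.
- by rewrite /leb11/= /mrestr setICl measure0.
- by move=> x /= nP xI; apply/nP/h.
Qed.

(** The measure [leb11] lives on the whole line; comparison of integrals and the
    fundamental theorem of calculus need integrals over [-1, 1]. *)
Lemma integral_leb11 (f : T -> \bar R) : measurable_fun [set: T] f ->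
  (\int[mu]_x f x = \int[leb]_(x in I11) f x)%E.
Proof.
move=> mf.
transitivity (\int[mu]_(x in I11) f x)%E.
  rewrite [RHS]integral_mkcond; apply: ae_eq_integral => //.
    apply/(measurable_restrictT _ _).1 => //.
    exact: measurable_funS mf.
  apply: leb11_ae => x xI _.
  by rewrite patchE mem_set.
apply: eq_measure_integral => A mA AI.
by rewrite /leb11/= /mrestr setIidl.
Qed.

Lemma mu_setT : mu setT = 2%:E.
Proof.
rewrite /leb11/= /mrestr setTI lebesgue_measure_itv/= lte_fin.
by rewrite ifT ?EFinN; [congr EFin|]; lra.
Qed.

Definition ip (f g : L2 R) : R := \int[mu]_x (f x * g x).

Lemma ip_int f g : mu.-integrable setT (EFin \o (fun x => f x * g x)).
Proof. by apply/Lfun1_integrable; apply: Lfun2_mul_Lfun1; apply: LfunP. Qed.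

Lemma ipC f g : ip f g = ip g f.
Proof. by apply: eq_Rintegral => x _; rewrite mulrC. Qed.
Lemma ipDl f g h : ip (f + g) h = ip f h + ip g h.
Proof.
rewrite /ip -RintegralD//; try exact: ip_int.
by apply: eq_Rintegral => x _; rewrite -mulrDl.
Qed.
Lemma ipZl a f g : ip (a *: f) g = a * ip f g.
Proof.
rewrite /ip -RintegralZl//; last exact: ip_int.
by apply: eq_Rintegral => x _; rewrite mulrA.
Qed.
Lemma ip_ge0 f : 0 <= ip f f.
Proof. by apply: Rintegral_ge0 => x _; rewrite -expr2 sqr_ge0. Qed.

Lemma eq_ip_ae f f' g : f = f' %[ae mu] -> ip f g = ip f' g.
Proof.
move=> h; rewrite /ip /Rintegral; congr fine.
apply: ae_eq_integral => //.
- exact: (measurable_int _ (ip_int f g)).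
- exact: (measurable_int _ (ip_int f' g)).
- by apply: filterS h => x /(_ I) -> _.
Qed.

Lemma ip_eq0 f : ip f f = 0 -> f = (0 : L2 R) %[ae mu].
Proof.
move=> h.
have : (\int[mu]_x `|(f x * f x)%:E| = 0)%E.
  rewrite -[RHS]/(0%:E) -h /ip /Rintegral fineK; last first.
    exact: integrable_fin_num (ip_int f f).
  by apply: eq_integral => x _; rewrite gee0_abs// lee_fin -expr2 sqr_ge0.
move/(ae_eq_integral_abs mu measurableT (measurable_int _ (ip_int f f))).
apply: filterS => x /(_ I) [] /eqP.
by rewrite mulf_eq0 orbb => /eqP -> _.
Qed.

Lemma sqr_le_of_norm_le (x s : R) : `|x| <= s -> x ^+ 2 <= s ^+ 2.
Proof.
move=> h; rewrite -real_normK ?num_real// ler_sqr ?nnegrE//.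
exact: le_trans h.
Qed.

Lemma bounded_Lfun (f : T -> R) (s : R) : measurable_fun [set: T] f ->
  (forall x, I11 x -> `|f x| <= s) -> f \in Lfun mu 2%:E.
Proof.
move=> mf hs; rewrite inE; apply/andP; split; first by rewrite inE.
rewrite inE /= /finite_norm unlock /Lnorm.
rewrite poweR_lty//.
have -> : (\int[mu]_x `|(EFin \o f) x| `^ 2 = \int[mu]_x (f x ^+ 2)%:E)%E.
  apply: eq_integral => x _.
  by rewrite [(EFin \o f) x]/= abse_EFin poweR_EFin powR_mulrn// real_normK ?num_real.
have mg : measurable_fun [set: T] (fun x : T => (f x ^+ 2)%:E).
  by apply/measurable_EFinP; exact: measurable_funX.
have mc : measurable_fun [set: T] (cst (s ^+ 2)%:E : T -> \bar R).
  exact: measurable_cst.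
apply: (@le_lt_trans _ _ (\int[mu]_x (cst (s ^+ 2)%:E x))%E); last first.
  by rewrite integral_cst// [X in (_ * X)%E]mu_setT -EFinM ltry.
rewrite !integral_leb11//; apply: ge0_le_integral => //.
- by move=> x _; rewrite lee_fin sqr_ge0.
- by apply: measurable_funS mg.
- by move=> x xI /=; rewrite lee_fin sqr_le_of_norm_le ?hs.
Qed.

Lemma cont_Lfun (f : R -> R) : continuous f -> (f : T -> R) \in Lfun mu 2%:E.
Proof.
move=> cf.
have [s [_ hs]] : bounded_set (f @` `[-1, 1]).
  apply: compact_bounded; apply: continuous_compact; last exact: segment_compact.
  exact: continuous_subspaceT.
apply: (@bounded_Lfun _ (s + 1)).
  exact: continuous_measurable_fun.
move=> x xI; apply: (hs (s + 1)); first by rewrite ltrDl.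
by exists x.
Qed.

Definition cL2 (f : R -> R) (cf : continuous f) : L2 R := Lfun_Sub (lee1n 2) (cont_Lfun cf).

Lemma ip_self_le f (s : R) : (forall x, I11 x -> `|f x| <= s) ->
  ip f f <= 2 * s ^+ 2.
Proof.
move=> h.
have -> : 2 * s ^+ 2 = \int[mu]_x (s ^+ 2).
  by rewrite Rintegral_cst// [X in fine X]mu_setT/= mulrC.
rewrite -lee_fin /ip /Rintegral !fineK; last 2 first.
- by rewrite integral_cst// [X in (_ * X)%E]mu_setT -EFinM.
- exact: integrable_fin_num (ip_int f f).
rewrite integral_leb11; last exact: (measurable_int _ (ip_int f f)).
rewrite integral_leb11; last exact: measurable_cst.
apply: ge0_le_integral => //.
- by move=> x _; rewrite lee_fin -expr2 sqr_ge0.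
- exact: measurable_funS (measurable_int _ (ip_int f f)).
- by move=> x xI /=; rewrite lee_fin -expr2 sqr_le_of_norm_le ?h.
Qed.

End L2.

(** * Extremal eigenvectors of compact positive operators *)

Lemma le0_of_le_small (R : realFieldType) (c x : R) :
  (forall e, 0 < e -> x <= c * e) -> x <= 0.
Proof.
move=> h; rewrite leNgt; apply/negP => x0.
have c0 : 0 < `|c| + 1 by rewrite ltr_wpDl.
have := h (x / (2 * (`|c| + 1))) (divr_gt0 x0 (mulr_gt0 (ltr0n _ 2) c0)).
apply/negP; rewrite -ltNge mulrCA gtr_pMr// ltr_pdivrMr ?mulr_gt0// mul1r.
have := ler_norm c; lra.
Qed.

Section TopEigenvector.
Variables (R : realType) (V : lmodType R) (B : V -> V -> R).
Hypothesis BC : forall x y, B x y = B y x.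
Hypothesis BDl : forall x y z, B (x + y) z = B x z + B y z.
Hypothesis BZl : forall a x z, B (a *: x) z = a * B x z.
Hypothesis B_ge0 : forall x, 0 <= B x x.
Variables (Q : V -> V) (C : R).
Hypothesis QB : forall x y, Q (x - y) = Q x - Q y.
Hypothesis QZ : forall a x, Q (a *: x) = a *: Q x.
Hypothesis QC : forall x y, B (Q x) y = B (Q y) x.
Hypothesis Q_ge0 : forall x, 0 <= B (Q x) x.
Hypothesis Q_le : forall x, B (Q x) x <= C * B x x.
Hypothesis Q_compact : forall u : nat -> V, (forall k, B (u k) (u k) <= 1) ->
  exists h, forall e k0, 0 < e ->
    exists2 k, (k0 <= k)%N & fnorm B (Q (u k) - h) <= e.

Let A x y := B (Q x) y.
Let AC x y : A x y = A y x. Proof. exact: QC. Qed.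
Let ADl x y z : A (x + y) z = A x z + A y z.
Proof. by rewrite AC /A formDr// !(QC z). Qed.
Let AZl a x z : A (a *: x) z = a * A x z.
Proof. by rewrite AC /A formZr// (QC z). Qed.

(** Cauchy-Schwarz for the nonnegative form [A x y = B (Q x) y] at the pair
    (x, Q x). *)
Lemma normQ_sqr_le (L : R) (x : V) : 0 <= L ->
  A (Q x) (Q x) <= L * B (Q x) (Q x) -> B (Q x) (Q x) <= L * A x x.
Proof.
move=> L0 h; have := form_cauchy_schwarz AC ADl AZl Q_ge0 x (Q x).
rewrite {1}/A; have [->|n0] := eqVneq (B (Q x) (Q x)) 0.
  by move=> _; rewrite mulr_ge0// Q_ge0.
have p : 0 < B (Q x) (Q x) by rewrite lt_def n0 B_ge0.
move=> h2; rewrite -(ler_pM2r p) -expr2 (le_trans h2)//.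
by rewrite mulrAC mulrC ler_wpM2r// Q_ge0.
Qed.

Variables (m : nat) (f : 'I_m -> V) (lam : 'I_m -> R).
Hypothesis Qf : forall i z, B (Q (f i)) z = lam i * B (f i) z.
Let S x := forall i, B x (f i) = 0.

Let SQ x : S x -> S (Q x).
Proof. by move=> Sx i; rewrite QC Qf BC Sx mulr0. Qed.

(** The supremum L of [B (Q x) x] over the unit vectors of the complement [S] of
    the [f i] is an eigenvalue. Along a maximizing sequence u, [normQ_sqr_le]
    makes [Q (u k) - L *: u k] tend to 0, and compactness gives a cluster point h
    of [Q (u k)], which is nonzero because [B (u k) (u k) = 1] and [L > 0]. The
    equation [Q h = L *: h] is stated through the seminorm of the possibly
    degenerate form. *)
Lemma top_eigenvector (d : R) (g : V) : 0 < d -> S g -> 0 < B g g ->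
  d * B g g <= B (Q g) g ->
  exists L h, [/\ d <= L, S h, 0 < B h h & fnorm B (Q h - L *: h) = 0].
Proof.
move=> d0 Sg g0 dg.
pose E := [set A x x | x in [set x | S x /\ B x x = 1]].
have unit x : S x -> 0 < B x x ->
    S ((fnorm B x)^-1 *: x) /\ B ((fnorm B x)^-1 *: x) ((fnorm B x)^-1 *: x) = 1.
  move=> Sx x0; split; first by move=> i; rewrite BZl Sx mulr0.
  rewrite BZl formZr// mulrA -expr2 exprVn fnorm_sqr// mulVf//.
  by rewrite gt_eqF.
have Aunit x : A ((fnorm B x)^-1 *: x) ((fnorm B x)^-1 *: x) = A x x / B x x.
  rewrite AZl (formZr AC AZl) mulrA -expr2 exprVn fnorm_sqr// mulrC//.
have Eg : E (A g g / B g g).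
  by rewrite -Aunit; exists ((fnorm B g)^-1 *: g) => //; exact: unit.
have ubE : ubound E C.
  by move=> _ [x [_ x1] <-]; rewrite (le_trans (Q_le x))// x1 mulr1.
have supE : has_sup E by split; [exists (A g g / B g g)|exists C].
pose L := sup E.
have dL : d <= L.
  rewrite (@le_trans _ _ (A g g / B g g))// ?ler_pdivlMr//.
  exact: sup_ubound supE.2 _ Eg.
have L0 : 0 < L by exact: lt_le_trans dL.
have AL x : S x -> A x x <= L * B x x.
  move=> Sx; have [x0|n0] := eqVneq (B x x) 0.
    by rewrite (le_trans (Q_le x))// x0 !mulr0.
  have p : 0 < B x x by rewrite lt_def n0 B_ge0.
  rewrite -ler_pdivrMr// -Aunit; apply: (sup_ubound supE.2).
  by exists ((fnorm B x)^-1 *: x) => //; exact: unit.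
have /choice[u uP] (k : nat) : exists x, [/\ S x, B x x = 1 & L - k.+1%:R^-1 < A x x].
  have [|_ [x [Sx x1] <-] xL] := @sup_adherent _ E (k.+1%:R^-1) _ supE.
    by rewrite invr_gt0.
  by exists x.
have [h hP] : exists h, forall e k0, 0 < e ->
    exists2 k, (k0 <= k)%N & fnorm B (Q (u k) - h) <= e.
  by apply: Q_compact => k; have [_ -> _] := uP k.
have C0 : 0 <= C by rewrite (le_trans (ltW d0))// (le_trans dL)// ge_sup//; exists (A g g / B g g).
have normQ x : fnorm B (Q x) <= C * fnorm B x.
  rewrite -ler_sqr ?nnegrE ?mulr_ge0 ?fnorm_ge0// exprMn !fnorm_sqr//.
  rewrite (le_trans (normQ_sqr_le C0 (Q_le _)))// expr2 -mulrA.
  by rewrite ler_wpM2l// Q_le.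
(* The squared norm of Q u - L u is |Qu|^2 - 2 L B (Q u) u + L^2, which
   [normQ_sqr_le] bounds by L (L - B (Q u) u) <= L / (k + 1). *)
have near e : 0 < e -> exists k, fnorm B (Q (u k) - h) <= e /\
    fnorm B (Q (u k) - L *: u k) <= e.
  move=> e0.
  have [k kk0 hk] := hP e (Num.truncn (L / e ^+ 2)) e0.
  exists k; split=> //; have [Su u1 uL] := uP k.
  rewrite -ler_sqr ?nnegrE ?fnorm_ge0 ?(ltW e0)// fnorm_sqr//.
  rewrite formBl// !formBr// !BZl !formZr// (BC (u k) (Q (u k))) u1.
  have := normQ_sqr_le (ltW L0) (AL _ (SQ Su)).
  have : L / k.+1%:R <= e ^+ 2.
    rewrite ler_pdivrMr// mulrC -ler_pdivrMr ?exprn_gt0//.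
    apply: ltW; apply: lt_le_trans (truncnS_gt _) _.
    by rewrite ler_nat ltnS.
  have : L * (L - k.+1%:R^-1) <= L * A (u k) (u k) by rewrite ler_pM2l// ltW.
  rewrite mulrBr /A mulr1; clearbody L.
  move: (B (Q (u k)) (Q (u k))) (B (Q (u k)) (u k)) => p q.
  move: (L / k.+1%:R) (L * L) (L * q) (e ^+ 2) => w a b z; lra.
have Bh0 : 0 < B h h.
  have [k [h1 h2]] := near (L / 3) (divr_gt0 L0 (ltr0n _ 3)).
  have [_ u1 _] := uP k.
  have n1 : fnorm B (u k) = 1 by rewrite /fnorm u1 sqrtr1.
  have t1 : L <= fnorm B (Q (u k)) + fnorm B (Q (u k) - L *: u k).
    apply: le_trans (fnormB BC BDl BZl B_ge0 _ _).
    by rewrite opprB addrC subrK fnormZ// n1 mulr1 gtr0_norm.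
  have t2 : fnorm B (Q (u k)) <= fnorm B (Q (u k) - h) + fnorm B h.
    by apply: le_trans (fnormD BC BDl BZl B_ge0 _ _); rewrite subrK.
  have : 0 < fnorm B h by lra.
  by rewrite sqrtr_gt0.
exists L, h; split => //.
- move=> i; apply/eqP; rewrite -normr_eq0 eq_le normr_ge0 andbT.
  apply: (@le0_of_le_small _ (fnorm B (f i))) => e e0.
  have [k [h1 _]] := near e e0; have [Su _ _] := uP k.
  rewrite (_ : B h (f i) = - B (Q (u k) - h) (f i)).
    rewrite normrN (le_trans (form_le_fnorm BC BDl BZl B_ge0 _ _))// mulrC.
    by rewrite ler_wpM2l ?fnorm_ge0.
  by rewrite formBl// (SQ Su) sub0r opprK.
- apply/eqP; rewrite eq_le fnorm_ge0 andbT.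
  apply: (@le0_of_le_small _ (2 * C + L)) => e e0.
  have [k [h1 h2]] := near e e0.
  have -> : Q h - L *: h = Q (Q (u k) - L *: u k) - Q (Q (u k) - h)
      + L *: (Q (u k) - h).
    rewrite !QB QZ scalerBr.
    move: (Q (Q (u k))) (L *: Q (u k)) (Q h) (L *: h) => a b q l.
    by rewrite opprB (addrC (a - b)) !subrKA.
  apply: le_trans (fnormD BC BDl BZl B_ge0 _ _) _.
  rewrite fnormZ// gtr0_norm//.
  have := fnormB BC BDl BZl B_ge0 (Q (Q (u k) - L *: u k)) (Q (Q (u k) - h)).
  have := normQ (Q (u k) - L *: u k).
  have := normQ (Q (u k) - h).
  have : C * fnorm B (Q (u k) - h) <= C * e by rewrite ler_wpM2l.
  have : C * fnorm B (Q (u k) - L *: u k) <= C * e by rewrite ler_wpM2l.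
  have : L * fnorm B (Q (u k) - h) <= L * e by rewrite ler_wpM2l// ltW.
  lra.
Qed.
End TopEigenvector.

(** * Trigonometric integrals and their Riemann sums *)

Section Riemann.
Variable R : realType.
Implicit Types a b u t c : R.

(** The points a and b may come in either order, which is why the intermediate
    point is located by its distance to a. *)
Lemma mean_value (f df : R -> R) a b : (forall x : R, is_derive x (1 : R) f (df x)) ->
  exists2 x, `|x - a| <= `|b - a| & f b - f a = df x * (b - a).
Proof.
move=> fd.
have cf x y : {within `[x, y], continuous f}.
  apply: continuous_subspaceT => z; apply: differentiable_continuous.
  by apply/derivable1_diffP; have [] := fd z.
have [ab|/ltW ba] := leP a b.
  have [x + e] := @MVT_segment _ f df a b ab (fun x _ => fd x) (cf _ _); rewrite in_itv /= => /andP[? ?].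
  exists x => //; rewrite !ger0_norm ?subr_ge0//; lra.
have [x + e] := @MVT_segment _ f df b a ba (fun x _ => fd x) (cf _ _); rewrite in_itv /= => /andP[? ?].
exists x; first by rewrite !ler0_norm ?subr_le0//; lra.
by rewrite -opprB e -mulrN opprB.
Qed.

Lemma lip_of_derive (f df : R -> R) (s : R) a b : (forall x : R, is_derive x (1 : R) f (df x)) ->
  (forall x, `|df x| <= s) -> `|f b - f a| <= s * `|b - a|.
Proof.
by move=> fd h; have [x _ ->] := mean_value a b fd; rewrite normrM ler_wpM2r.
Qed.

Lemma sin_lip a b : `|sin b - sin a| <= `|b - a|.
Proof.
rewrite -[leRHS]mul1r; apply: (@lip_of_derive sin cos) => // x; exact: cos_max.
Qed.
Lemma cos_lip a b : `|cos b - cos a| <= `|b - a|.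
Proof.
rewrite -[leRHS]mul1r; apply: (@lip_of_derive cos (fun x => - sin x)) => // x.
by rewrite normrN sin_max.
Qed.

Lemma lip_cont (f : R -> R) (s : R) :
  (forall a b, `|f b - f a| <= s * `|b - a|) -> continuous f.
Proof.
move=> h x; apply/cvgrPdist_le => e e0; near=> y.
rewrite (le_trans (h _ _))//.
have s0 : 0 < `|s| + 1 by rewrite ltr_wpDl.
apply: (@le_trans _ _ ((`|s| + 1) * `|x - y|)).
  by rewrite ler_wpM2r// (le_trans (ler_norm _))// lerDl.
rewrite -ler_pdivlMl// mulrC; near: y.
by apply: cvgr_dist_le; [exact: cvg_id|rewrite divr_gt0].
Unshelve. all: by end_near. Qed.

Definition grid (t c : R) (N : nat) (i : nat) := t + i%:R * ((c - t) / N%:R).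

Variables f df : R -> R.
Hypothesis fd : forall x : R, is_derive x (1 : R) f (df x).
Hypothesis dfl : forall a b, `|df b - df a| <= `|b - a|.

(** The integral of [df (s * u)] over s in [t, c] when [df] is the derivative of
    [f]; the value at [u = 0] is the continuous extension. *)
Definition dquot t c u : R :=
  if u == 0 then df 0 * (c - t) else (f (c * u) - f (t * u)) / u.

(** The mean value theorem turns each increment of [f] into a value of [df], and
    [df] is 1-Lipschitz. With the error explicit, inequalities about the
    integrals can be proved on finite sums. *)
Lemma dquot_riemann t c N u : (0 < N)%N ->
  `|dquot t c u - (c - t) / N%:R * \sum_(i < N) df (grid t c N i * u)|
    <= (c - t) ^+ 2 / N%:R * `|u|.
Proof.
move=> N0; have NN : N%:R != 0 :> R by rewrite pnatr_eq0 -lt0n.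
rewrite /dquot; have [->|u0] := eqVneq u 0.
  under eq_bigr do rewrite mulr0.
  rewrite sumr_const card_ord -mulr_natr normr0 mulr0.
  rewrite (_ : _ - _ = 0) ?normr0//; by field.
set h := (c - t) / N%:R.
have gE i : grid t c N i.+1 = grid t c N i + h.
  by rewrite /grid -/h -natr1 mulrDl mul1r addrA.
have -> : f (c * u) - f (t * u) =
    \sum_(i < N) (f (grid t c N i.+1 * u) - f (grid t c N i * u)).
  rewrite -(big_mkord xpredT (fun i => f (grid t c N i.+1 * u) - f (grid t c N i * u))).
  rewrite telescope_sumr// /grid mul0r addr0 mulrCA mulfV// mulr1 subrKC//.
rewrite mulr_suml mulr_sumr -sumrB.
apply: le_trans (ler_norm_sum _ _ _) _.
apply: (@le_trans _ _ (\sum_(i < N) h ^+ 2 * `|u|)); last first.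
  rewrite sumr_const card_ord.
  have -> : (c - t) ^+ 2 / N%:R * `|u| = N%:R * (h ^+ 2 * `|u|).
    by rewrite /h; field.
  by rewrite mulr_natl.
apply: ler_sum => i _; rewrite gE.
set g := grid t c N i.
have [x xa ->] := mean_value (g * u) ((g + h) * u) fd.
have e : (g + h) * u - g * u = h * u by rewrite mulrDl addrC addKr.
rewrite e in xa *; rewrite mulrA mulfK// mulrC -mulrBr normrM.
apply: (@le_trans _ _ (`|h| * `|h * u|)).
  by rewrite ler_wpM2l// (le_trans (dfl _ _)).
by rewrite (normrM h u) mulrA -expr2 real_normK ?num_real.
Qed.

(** How estimates on Riemann sums with an error of order 1/N pass to the limit. *)
Lemma limit_le (x y : R) (s : R) :
  (forall N, (0 < N)%N -> x <= y + s / N%:R) -> x <= y.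
Proof.
move=> h; rewrite -subr_le0; apply: (@le0_of_le_small _ `|s|) => e e0.
have := h (Num.truncn e^-1).+1 isT.
rewrite -lerBlDl => /le_trans; apply.
apply: (@le_trans _ _ (`|s| / (Num.truncn e^-1).+1%:R)).
  by rewrite ler_wpM2r// ?ler_norm// invr_ge0.
rewrite ler_wpM2l// -[leRHS]invrK lef_pV2 ?posrE ?invr_gt0//.
by rewrite ltW// truncnS_gt.
Qed.

Hypothesis df1 : forall a, `|df a| <= 1.

Lemma sum_le_const N (F : 'I_N -> R) (s : R) : (forall i, F i <= s) ->
  \sum_(i < N) F i <= N%:R * s.
Proof.
move=> h; rewrite mulr_natl -[N in s *+ N]card_ord -sumr_const.
exact: ler_sum.
Qed.

Lemma dquot_bound t c u : t <= c -> `|dquot t c u| <= c - t.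
Proof.
move=> tc; apply: (@limit_le _ _ ((c - t) ^+ 2 * `|u|)) => N N0.
have NN : N%:R != 0 :> R by rewrite pnatr_eq0 -lt0n.
have := dquot_riemann t c u N0; rewrite (mulrAC _ _ `|u|).
set S := _ * \sum_(i < N) _.
have : `|S| <= c - t.
  rewrite normrM ger0_norm ?divr_ge0 ?subr_ge0//.
  rewrite -[leRHS](divfK NN) ler_wpM2l ?divr_ge0 ?subr_ge0//.
  rewrite (le_trans (ler_norm_sum _ _ _))// -[leRHS]mulr1.
  by apply: sum_le_const => i; exact: df1.
have := ler_normD (dquot t c u - S) S; rewrite subrK; lra.
Qed.

Lemma dquot_lip t c u v : 0 <= t -> t <= c ->
  `|dquot t c u - dquot t c v| <= c * (c - t) * `|u - v|.
Proof.
move=> t0 tc; apply: (@limit_le _ _ ((c - t) ^+ 2 * (`|u| + `|v|))) => N N0.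
have NN : N%:R != 0 :> R by rewrite pnatr_eq0 -lt0n.
have := dquot_riemann t c v N0; have := dquot_riemann t c u N0.
set Su := _ * \sum_(i < N) _; set Sv := _ * \sum_(i < N) _.
have h : `|Su - Sv| <= c * (c - t) * `|u - v|.
  rewrite -mulrBr -sumrB normrM ger0_norm ?divr_ge0 ?subr_ge0//.
  rewrite [leRHS](_ : _ = (c - t) / N%:R * (N%:R * (c * `|u - v|))); last by field.
  rewrite ler_wpM2l ?divr_ge0 ?subr_ge0// (le_trans (ler_norm_sum _ _ _))//.
  apply: sum_le_const => i; rewrite (le_trans (dfl _ _))//.
  rewrite -mulrBr normrM ler_wpM2r//.
  have gr : 0 <= i%:R * ((c - t) / N%:R) <= c - t.
    rewrite mulr_ge0 ?divr_ge0 ?subr_ge0//= mulrC -mulrA ler_piMr ?subr_ge0//.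
    by rewrite ler_pdivrMl ?ltr0n// mulr1 ler_nat ltnW.
  by rewrite /grid; move/andP: gr => [g1 g2]; rewrite ger0_norm; lra.
have := ler_normD (dquot t c u - Su) (Su - Sv).
have := ler_normD (dquot t c u - Sv) (Sv - dquot t c v).
rewrite !subrKA (distrC Sv) (mulrAC _ (`|u| + `|v|)) mulrDr; lra.
Qed.

End Riemann.

(** * Convolution operators of frequency windows *)

Section L2norm.
Variable R : realType.
Implicit Types f g h : L2 R.
Local Notation I11 := (`[-1, 1]%classic : set R).

Definition nrm f : R := fnorm (@ip R) f.

Lemma nrm_ge0 f : 0 <= nrm f. Proof. exact: fnorm_ge0. Qed.
Lemma nrm_sqr f : nrm f ^+ 2 = ip f f.
Proof. exact: (fnorm_sqr (@ipC R) (@ip_ge0 R)). Qed.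
Lemma ip_le_nrm f g : `|ip f g| <= nrm f * nrm g.
Proof. exact: (form_le_fnorm (@ipC R) (@ipDl R) (@ipZl R) (@ip_ge0 R)). Qed.
Lemma ipBl f g h : ip (f - g) h = ip f h - ip g h.
Proof. exact: (formBl (@ipDl R) (@ipZl R)). Qed.
Lemma ipZr a f g : ip g (a *: f) = a * ip g f.
Proof. exact: (formZr (@ipC R) (@ipZl R)). Qed.
Lemma ipBr f g h : ip h (f - g) = ip h f - ip h g.
Proof. exact: (formBr (@ipC R) (@ipDl R) (@ipZl R)). Qed.
Lemma ip_suml I (r : seq I) (P : pred I) (F : I -> L2 R) z :
  ip (\sum_(i <- r | P i) F i) z = \sum_(i <- r | P i) ip (F i) z.
Proof. exact: (@form_suml _ _ _ (@ipDl R) (@ipZl R)). Qed.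
Lemma ip_sumr I (r : seq I) (P : pred I) (F : I -> L2 R) z :
  ip z (\sum_(i <- r | P i) F i) = \sum_(i <- r | P i) ip z (F i).
Proof. exact: (@form_sumr _ _ _ (@ipC R) (@ipDl R) (@ipZl R)). Qed.

Lemma nrm_le_sup f (s : R) : 0 <= s -> (forall x, I11 x -> `|f x| <= s) ->
  nrm f <= Num.sqrt 2 * s.
Proof.
move=> s0 h; rewrite -ler_sqr ?nnegrE ?nrm_ge0 ?mulr_ge0 ?sqrtr_ge0//.
by rewrite nrm_sqr exprMn sqr_sqrtr// ip_self_le.
Qed.

Lemma ip_le_sup f g (s : R) : 0 <= s -> (forall x, I11 x -> `|f x| <= s) ->
  `|ip f g| <= Num.sqrt 2 * s * nrm g.
Proof.
move=> s0 h; rewrite (le_trans (ip_le_nrm f g))// ler_wpM2r ?nrm_ge0//.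
exact: nrm_le_sup.
Qed.

Lemma L2addE f g x : (f + g : L2 R) x = f x + g x. Proof. by []. Qed.
Lemma L2scaleE a f x : (a *: f : L2 R) x = a * f x. Proof. by []. Qed.
Lemma L2subE f g x : (f - g : L2 R) x = f x - g x. Proof. by []. Qed.
Lemma L2sumE I (r : seq I) (P : pred I) (F : I -> L2 R) x :
  (\sum_(i <- r | P i) F i : L2 R) x = \sum_(i <- r | P i) F i x.
Proof.
by elim/big_rec2: _ => [|i y1 y2 _ <-].
Qed.

Lemma trig_cont (f : R -> R) (t : R) : (forall a b, `|f b - f a| <= `|b - a|) ->
  continuous (fun y : R => f (t * y)).
Proof.
move=> fl; apply: (@lip_cont _ _ `|t|) => a b.
by rewrite (le_trans (fl _ _))// -mulrBr normrM.
Qed.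

Definition cosL t : L2 R := cL2 (@trig_cont _ t (@cos_lip R)).
Definition sinL t : L2 R := cL2 (@trig_cont _ t (@sin_lip R)).

Lemma cosLE t y : cosL t y = cos (t * y). Proof. by []. Qed.
Lemma sinLE t y : sinL t y = sin (t * y). Proof. by []. Qed.

Lemma is_derive_Ncos (x : R) : is_derive x (1 : R) (fun x => - cos x) (sin x).
Proof. by apply: is_derive_eq; rewrite opprK. Qed.

(** The integral of [cos (s * u)] over s in [t, c]. *)
Definition kc t c (u : R) := dquot (@sin R) cos t c u.
(** The integral of [sin (s * u)] over s in [t, c]. *)
Definition ks t c (u : R) := dquot (fun x : R => - cos x) sin t c u.

Section Window.
Variables (t c : R).
Hypotheses (t0 : 0 <= t) (tc : t <= c).

Lemma kc_bound u : `|kc t c u| <= c - t.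
Proof. by apply: dquot_bound => //; [exact: cos_lip|exact: cos_max]. Qed.
Lemma kc_lip u v : `|kc t c v - kc t c u| <= c * (c - t) * `|v - u|.
Proof. by apply: dquot_lip => //; exact: cos_lip. Qed.
Lemma ks_lip u v : `|ks t c v - ks t c u| <= c * (c - t) * `|v - u|.
Proof.
by apply: dquot_lip => //; [move=> x; exact: is_derive_Ncos|exact: sin_lip].
Qed.

Lemma kc_cont x : continuous (fun y : R => kc t c (x - y)).
Proof.
apply: (@lip_cont _ _ (c * (c - t))) => a b.
rewrite (le_trans (kc_lip _ _))// (_ : x - b - (x - a) = a - b); last by ring.
by rewrite distrC.
Qed.
Definition kcL x : L2 R := cL2 (@kc_cont x).

Lemma window_lip f a b : `|ip (kcL b) f - ip (kcL a) f|
   <= Num.sqrt 2 * (c * (c - t)) * nrm f * `|b - a|.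
Proof.
have c0 : 0 <= c by exact: le_trans tc.
rewrite -ipBl mulrAC -(mulrA (Num.sqrt 2)); apply: ip_le_sup.
  by rewrite !mulr_ge0// subr_ge0.
move=> y _; rewrite L2subE (le_trans (kc_lip (a - y) (b - y)))//.
by rewrite (_ : b - y - (a - y) = b - a)//; ring.
Qed.

(** The part of the sinc operator, times pi, that comes from the frequencies in
    [t, c]. *)
Definition windowL f : L2 R := cL2 (@lip_cont _ _ _ (window_lip f)).

Lemma windowLE f x : windowL f x = ip (kcL x) f. Proof. by []. Qed.

(** A Riemann sum for the integral over the frequencies s in [t, c] of the
    products of the Fourier coefficients of f and g. *)
Definition trigform N f g := (c - t) / N%:R * \sum_(i < N)
  (ip (cosL (grid t c N i)) f * ip (cosL (grid t c N i)) g
   + ip (sinL (grid t c N i)) f * ip (sinL (grid t c N i)) g).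

(** The addition theorem for [cos (s * (x - y))] separates the variables of the
    kernel, so the form of a window is an integral of products of Fourier
    coefficients. Symmetry, positivity and upper bounds follow from this. *)
Lemma window_approx N f g : (0 < N)%N ->
  `|ip (windowL f) g - trigform N f g| <=
     4 * (c - t) ^+ 2 * nrm f * nrm g / N%:R.
Proof.
move=> N0; have NN : N%:R != 0 :> R by rewrite pnatr_eq0 -lt0n.
set h := (c - t) / N%:R.
pose G i := grid t c N i.
have e0 : 0 <= 2 * (c - t) ^+ 2 / N%:R by rewrite divr_ge0// mulr_ge0// sqr_ge0.
pose w : L2 R := windowL f - h *: \sum_(i < N)
   (ip (cosL (G i)) f *: cosL (G i) + ip (sinL (G i)) f *: sinL (G i)).
have -> : ip (windowL f) g - trigform N f g = ip w g.
  rewrite /w ipBl ipZl ip_suml /trigform -/h; congr (_ - _ * _).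
  by apply: eq_bigr => i _; rewrite ipDl !ipZl.
rewrite [leRHS](_ : _ = (Num.sqrt 2 * (Num.sqrt 2 * (2 * (c - t) ^+ 2 / N%:R) * nrm f)) * nrm g); last first.
  have := @sqr_sqrtr R 2 (ler0n _ _); rewrite expr2 => s2.
  rewrite [RHS](_ : _ = (Num.sqrt 2 * Num.sqrt 2) * ((2 * (c - t) ^+ 2 / N%:R) * nrm f * nrm g)); last by ring.
  by rewrite s2; field.
apply: ip_le_sup; first by rewrite mulr_ge0 ?nrm_ge0 ?mulr_ge0 ?sqrtr_ge0 ?nrm_ge0 ?subr_ge0 ?sqr_ge0 ?invr_ge0.
move=> x xI.
pose k : L2 R := kcL x - h *: \sum_(i < N)
   (cos (G i * x) *: cosL (G i) + sin (G i * x) *: sinL (G i)).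
have -> : w x = ip k f.
  rewrite /w /k L2subE windowLE ipBl L2scaleE ipZl; congr (_ - _ * _).
  rewrite L2sumE ip_suml; apply: eq_bigr => i _.
  by rewrite L2addE !L2scaleE ipDl !ipZl; congr (_ + _); exact: mulrC.
apply: ip_le_sup => // y yI.
rewrite /k L2subE L2scaleE L2sumE.
under eq_bigr do rewrite L2addE !L2scaleE cosLE sinLE -cosB -mulrBr.
apply: le_trans (dquot_riemann (@is_derive_sin R) (@cos_lip R) t c (x - y) N0) _.
rewrite [leRHS](_ : _ = (c - t) ^+ 2 / N%:R * 2); last by ring.
rewrite ler_wpM2l ?divr_ge0 ?sqr_ge0//.
move: xI yI; rewrite /= !in_itv/= => /andP[? ?] /andP[? ?].
rewrite ler_norml; lra.
Qed.

Lemma windowC f g : ip (windowL f) g = ip (windowL g) f.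
Proof.
apply/eqP; rewrite -subr_eq0 -normr_eq0 eq_le normr_ge0 andbT.
apply: (@limit_le _ _ _ (8 * (c - t) ^+ 2 * nrm f * nrm g)) => N N0.
have := window_approx f g N0; have := window_approx g f N0.
have -> : trigform N g f = trigform N f g.
  by rewrite /trigform; congr (_ * _); apply: eq_bigr => i _; rewrite !(mulrC (ip _ g)).
rewrite (mulrAC _ (nrm g)) add0r.
have -> : 8 * (c - t) ^+ 2 * nrm f * nrm g / N%:R =
  2 * (4 * (c - t) ^+ 2 * nrm f * nrm g / N%:R) by ring.
have := ler_normD (ip (windowL f) g - trigform N f g) (trigform N f g - ip (windowL g) f).
rewrite subrKA (distrC (trigform N f g)); lra.
Qed.

Lemma window_ge0 f : 0 <= ip (windowL f) f.
Proof.
apply: (@limit_le _ _ _ (4 * (c - t) ^+ 2 * nrm f * nrm f)) => N N0.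
have := window_approx f f N0; rewrite ler_norml => /andP[h _].
have : 0 <= trigform N f f.
  rewrite /trigform mulr_ge0 ?divr_ge0 ?subr_ge0//.
  by apply: sumr_ge0 => i _; rewrite addr_ge0// -expr2 sqr_ge0.
lra.
Qed.

Lemma window_le f (s : R) :
  (forall x, t <= x -> x <= c -> ip (cosL x) f ^+ 2 + ip (sinL x) f ^+ 2 <= s) ->
  ip (windowL f) f <= (c - t) * s.
Proof.
move=> h.
apply: (@limit_le _ _ _ (4 * (c - t) ^+ 2 * nrm f * nrm f)) => N N0.
have NN : N%:R != 0 :> R by rewrite pnatr_eq0 -lt0n.
have := window_approx f f N0; rewrite ler_norml => /andP[_].
have : trigform N f f <= (c - t) * s.
  rewrite /trigform [leRHS](_ : _ = (c - t) / N%:R * (N%:R * s)); last by field.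
  rewrite ler_wpM2l ?divr_ge0 ?subr_ge0//; apply: sum_le_const => i.
  rewrite -!expr2; apply: h; rewrite /grid.
    by rewrite lerDl mulr_ge0 ?divr_ge0 ?subr_ge0.
  rewrite -lerBrDl mulrCA ler_piMr ?subr_ge0//.
  by rewrite ler_pdivrMr ?ltr0n// mul1r ler_nat ltnW.
lra.
Qed.

End Window.
End L2norm.

(** * Cluster points of equi-Lipschitz sequences *)

Section Compactness.
Variable R : realType.

Lemma ultra_bounded (G : set_system nat) (u : nat -> R) (C : R) :
  UltraFilter G -> (forall k, `|u k| <= C) ->
  exists p, forall e, 0 < e -> \forall k \near G, `|u k - p| <= e.
Proof.
move=> UG uC.
have PG : ProperFilter G by exact: ultra_proper.
have [|p [_ cp]] := @segment_compact R (- C) C (u @ G) _.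
  by apply: nearW => k; rewrite /= in_itv /= -ler_norml.
exists p => e e0.
have [//|nG] := in_ultra_setVsetC [set k | `|u k - p| <= e] UG.
have pb : nbhs p (ball p e) by exact: nbhsx_ballx.
have [q [/= q1 q2]] := cp [set x | ~ `|x - p| <= e] (ball p e) nG pb.
by exfalso; apply: q1; rewrite distrC ltW.
Qed.

(** A form of the Arzela-Ascoli theorem. The pointwise limit along an ultrafilter
    exists by boundedness and inherits the Lipschitz constant; the approximation
    is uniform on [-1, 1] because the values on a fine grid control all others. *)
Lemma equilipschitz_cluster (v : nat -> R -> R) (C L : R) : 0 <= L ->
  (forall k x, `|v k x| <= C) ->
  (forall k x y, `|v k y - v k x| <= L * `|y - x|) ->
  exists2 h : R -> R, (forall x y, `|h y - h x| <= L * `|y - x|) &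
    forall e k0, 0 < e -> exists2 k, (k0 <= k)%N &
      forall x, -1 <= x <= 1 -> `|v k x - h x| <= e.
Proof.
move=> L0 vC vL.
have [G [UG sG]] := @ultraFilterLemma nat \oo _.
have PG : ProperFilter G by exact: ultra_proper.
have /choice[h hP] x : exists p, forall e, 0 < e -> \forall k \near G, `|v k x - p| <= e.
  by apply: (@ultra_bounded _ _ C).
have hL x y : `|h y - h x| <= L * `|y - x|.
  rewrite -subr_le0; apply: (@le0_of_le_small _ 2) => e e0.
  have : \forall k \near G, `|v k y - h y| <= e /\ `|v k x - h x| <= e.
    by apply: filterI; exact: hP.
  move=> /filter_ex[k [h1 h2]].
  have := ler_normD (h y - v k y) (v k y - h x).
  have := ler_normD (v k y - v k x) (v k x - h x).
  have := vL k x y.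
  rewrite !subrKA (distrC (h y) (v k y)); lra.
exists h => // e k0 e0.
have L1 : 0 < L + 1 by lra.
pose M := (Num.truncn (6 * (L + 1) / e)).+1.
have M0 : 0 < M%:R :> R by rewrite ltr0n.
have MP : 6 * (L + 1) / e < M%:R by exact: truncnS_gt.
pose g (j : 'I_M.+1) : R := -1 + j%:R * (2 / M%:R).
have : \forall k \near G, (k0 <= k)%N /\ forall j, `|v k (g j) - h (g j)| <= e / 3.
  apply: filterI; first by apply: sG; exact: nbhs_infty_ge.
  by apply: filter_forall => j; apply: hP; rewrite divr_gt0.
move=> /filter_ex[k [kk0 kP]]; exists k => // x /andP[x1 x2].
pose j := Num.truncn ((x + 1) * M%:R / 2).
have jn : 0 <= (x + 1) * M%:R / 2 by rewrite divr_ge0// mulr_ge0 ?(ltW M0)//; lra.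
have jM : (j < M.+1)%N.
  rewrite ltnS truncn_le_nat -[M.+1%:R]natr1.
  have : (x + 1) * M%:R <= 2 * M%:R by rewrite ler_wpM2r ?(ltW M0)//; lra.
  lra.
have /andP[j1 j2] : j%:R <= (x + 1) * M%:R / 2 < j.+1%:R by exact: truncn_itv.
have xg : `|x - g (Ordinal jM)| <= 2 / M%:R.
  have jl : j%:R * (2 / M%:R) <= x + 1 by rewrite mulrA ler_pdivrMr//; lra.
  have ju : x + 1 < j%:R * (2 / M%:R) + 2 / M%:R.
    rewrite (_ : _ + _ = (j%:R + 1) * 2 / M%:R) ?ltr_pdivlMr//; last by ring.
    by move: j2; rewrite -[j.+1%:R]natr1; lra.
  by rewrite /g/= ger0_norm; lra.
have xe : L * (2 / M%:R) <= e / 3.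
  rewrite mulrA ler_pdivrMr//.
  have : 6 * (L + 1) < e * M%:R by rewrite [ltRHS]mulrC -ltr_pdivrMr.
  lra.
have := kP (Ordinal jM).
have := vL k (g (Ordinal jM)) x; have := hL (g (Ordinal jM)) x.
have : L * `|x - g (Ordinal jM)| <= L * (2 / M%:R) by rewrite ler_wpM2l.
have := ler_normD (v k x - v k (g (Ordinal jM))) (v k (g (Ordinal jM)) - h x).
have := ler_normD (v k (g (Ordinal jM)) - h (g (Ordinal jM))) (h (g (Ordinal jM)) - h x).
rewrite !subrKA (distrC (h _) (h x)); lra.
Qed.
End Compactness.

(** * The sinc operator and its eigenfunctions *)

Section SincOperator.
Variables (R : realType) (c : R).
Hypothesis c0 : 0 <= c.
Notation mu := (leb11 R).
Implicit Types f g h : L2 R.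
Local Notation I11 := (`[-1, 1]%classic : set R).

Definition sincL f : L2 R := pi^-1 *: windowL (lexx 0) c0 f.

Lemma piV_gt0 : 0 < pi^-1 :> R. Proof. by rewrite invr_gt0 pi_gt0. Qed.
Local Hint Resolve piV_gt0 : core.

(** The kernel [sin (c * u) / (pi * u)] is 1/pi times the integral of
    [cos (s * u)] over s in [0, c]. *)
Lemma sinc_operatorE f x : sinc_operator c f x = sincL f x.
Proof.
transitivity (ip (pi^-1 *: kcL (lexx 0) c0 x) f); last by rewrite ipZl.
rewrite /sinc_operator /ip /Rintegral integral_leb11; last first.
  exact: (measurable_int _ (ip_int (pi^-1 *: kcL (lexx 0) c0 x) f)).
congr fine; apply: eq_integral => y _; congr (_ * _)%:E.
rewrite L2scaleE -[kcL _ _ x y]/(kc 0 c (x - y)) /kc /dquot /sinc_kernel subr_eq0.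
case: eqP => _; first by rewrite cos0 mul1r subr0 mulrC.
by rewrite mul0r sin0 subr0 mulrCA invfM.
Qed.

Lemma sincLB f g : sincL (f - g) = sincL f - sincL g.
Proof.
apply/LfuneqP => x; rewrite L2subE !L2scaleE -mulrBr; congr (_ * _).
by rewrite !windowLE ipBr.
Qed.
Lemma sincLZ a f : sincL (a *: f) = a *: sincL f.
Proof.
apply/LfuneqP => x; rewrite !L2scaleE mulrCA; congr (_ * _).
by rewrite !windowLE ipZr.
Qed.
Lemma sincLC f g : ip (sincL f) g = ip (sincL g) f.
Proof. by rewrite !ipZl windowC. Qed.
Lemma sincL_ge0 f : 0 <= ip (sincL f) f.
Proof. by rewrite ipZl mulr_ge0 ?window_ge0// ltW. Qed.

Lemma sincL_bound f x : `|sincL f x| <= pi^-1 * (Num.sqrt 2 * c * nrm f).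
Proof.
rewrite L2scaleE normrM gtr0_norm// ler_pM2l// windowLE.
apply: ip_le_sup => // y _.
by rewrite -[kcL _ _ x y]/(kc 0 c (x - y)) (le_trans (kc_bound _ _))// subr0.
Qed.
Lemma sincL_lip f x y : `|sincL f y - sincL f x| <=
  pi^-1 * (Num.sqrt 2 * (c * c) * nrm f) * `|y - x|.
Proof.
rewrite !L2scaleE -mulrBr normrM gtr0_norm// -mulrA ler_pM2l// !windowLE.
by rewrite (le_trans (window_lip _ _ _ _ _))// subr0.
Qed.

Lemma sincL_le f : ip (sincL f) f <= 2 * c / pi * ip f f.
Proof.
rewrite (le_trans (ler_norm _))//.
rewrite (le_trans (@ip_le_sup _ _ _ (pi^-1 * (Num.sqrt 2 * c * nrm f)) _ _))//.
- by rewrite !mulr_ge0 ?nrm_ge0 ?sqrtr_ge0// ltW.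
- by move=> x _; exact: sincL_bound.
rewrite -nrm_sqr; have := @sqr_sqrtr R 2 (ler0n _ _); rewrite expr2 => s2.
rewrite [leLHS](_ : _ = (Num.sqrt 2 * Num.sqrt 2) * c / pi * nrm f ^+ 2); last by ring.
by rewrite s2.
Qed.

(** The image of a bounded sequence is bounded and equi-Lipschitz. *)
Lemma sincL_compact (u : nat -> L2 R) : (forall k, ip (u k) (u k) <= 1) ->
  exists h, forall e k0, 0 < e ->
    exists2 k, (k0 <= k)%N & nrm (sincL (u k) - h) <= e.
Proof.
move=> u1.
have n1 k : nrm (u k) <= 1.
  by rewrite -(@ler_pXn2r _ 2) ?nnegrE ?nrm_ge0// nrm_sqr expr1n.
have s20 : 0 <= Num.sqrt 2 :> R by exact: sqrtr_ge0.
have [|||h hl hP] := @equilipschitz_cluster R (fun k => sincL (u k) : R -> R)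
  (pi^-1 * (Num.sqrt 2 * c)) (pi^-1 * (Num.sqrt 2 * (c * c))).
- by rewrite !mulr_ge0// ltW.
- move=> k x; rewrite (le_trans (sincL_bound _ _))// ler_pM2l//.
  by rewrite ler_piMr// mulr_ge0.
- move=> k x y; rewrite (le_trans (sincL_lip _ _ _))// ler_wpM2r// ler_pM2l//.
  by rewrite ler_piMr// !mulr_ge0.
exists (cL2 (lip_cont hl)) => e k0 e0.
have s2 : 0 < Num.sqrt 2 :> R by rewrite sqrtr_gt0.
have [k kk0 hk] := hP (e / Num.sqrt 2) k0 (divr_gt0 e0 s2).
exists k => //.
rewrite [leRHS](_ : _ = Num.sqrt 2 * (e / Num.sqrt 2)); last by rewrite mulrC divfK// gt_eqF.
apply: nrm_le_sup; first by rewrite ltW ?divr_gt0.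
by move=> x; rewrite /= in_itv/= => /hk.
Qed.

Lemma eigenspace_ip f l g : sinc_eigenspace c l f -> ip (sincL f) g = l * ip f g.
Proof.
rewrite /sinc_eigenspace /= => h; rewrite -ipZl; apply: eq_ip_ae; move: h.
apply: (@filterS _ _ (ae_filter_ringOfSetsType mu)) => x /(_ I) h _; by rewrite -sinc_operatorE h.
Qed.

Lemma eigenspace_of_nrm f l : nrm (sincL f - l *: f) = 0 -> sinc_eigenspace c l f.
Proof.
move=> h.
have /ip_eq0 : ip (sincL f - l *: f) (sincL f - l *: f) = 0.
  by rewrite -nrm_sqr h expr0n.
apply: (@filterS _ _ (ae_filter_ringOfSetsType mu)) => x /(_ I) e _.
by rewrite sinc_operatorE; apply/eqP; rewrite -subr_eq0; apply/eqP; exact: e.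
Qed.

Variable lam : nat -> R.
Hypothesis lamP : eigenvalues_in_decreasing_order c lam.

(** Multiplicities are counted by the index sets [[set n | lam n = l]]. Carrying a
    basis of each eigenspace along the bijection with this set attaches one
    eigenfunction to every index n. Independence and generation are stated for
    one eigenvalue l at a time, where they come from that basis. *)
Lemma eigenfamily : exists f : nat -> L2 R,
  [/\ forall n, sinc_eigenspace c (lam n) (f n),
      forall (l : R) (s : seq nat) (a : nat -> R), uniq s ->
        {in s, forall i, lam i = l} ->
        (\sum_(i <- s) a i *: f i : L2 R) = (0 : L2 R) %[ae mu] ->
        {in s, forall i, a i = 0}
    & forall (l : R) g, sinc_eigenspace c l g ->
        exists (d : nat) (k : 'I_d -> nat) (b : 'I_d -> R),
          (forall j, lam (k j) = l) /\
          g = (\sum_(j < d) b j *: f (k j) : L2 R) %[ae mu]].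
Proof.
have [_ lamd] := lamP.
have /choice[D DP] l : exists D : nat * (nat -> L2 R) * (nat -> nat),
   [/\ forall i, (i < D.1.1)%N -> sinc_eigenspace c l (D.1.2 i),
    forall a : nat -> R, (\sum_(i < D.1.1) a i *: D.1.2 i : L2 R) = (0 : L2 R) %[ae mu] ->
      forall i, (i < D.1.1)%N -> a i = 0,
    forall f, sinc_eigenspace c l f -> exists a : nat -> R,
      f = (\sum_(i < D.1.1) a i *: D.1.2 i : L2 R) %[ae mu]
    & set_bij [set n | lam n = l] `I_(D.1.1) D.2].
  have [d [v [h1 h2 h3]] /card_set_bijP[p pb]] := lamd l.
  pose v' i := oapp v 0 (insub i : option 'I_d).
  have v'E (i : 'I_d) : v' i = v i by rewrite /v' valK.
  exists (d, v', p); split => //=.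
  - by move=> i id; rewrite (v'E (Ordinal id)).
  - move=> a; under eq_bigr do rewrite v'E.
    by move=> /(h2 (fun i => a i)) h i id; exact: (h (Ordinal id)).
  - move=> f /h3[a fa]; exists (fun i => oapp a 0 (insub i : option 'I_d)).
    by under eq_bigr do rewrite v'E valK.
exists (fun n => (D (lam n)).1.2 ((D (lam n)).2 n)); split.
- move=> n; have [h _ _ [p _ _]] := DP (lam n); apply: h.
  by apply: (p n).
- move=> l s a us sl.
  have [_ indep _ [pfun pinj _]] := DP l.
  rewrite (_ : (\sum_(i <- s) _ : L2 R) =
    \sum_(k < (D l).1.1) (\sum_(i <- s | (D l).2 i == k) a i) *: (D l).1.2 k).
    move=> /(indep (fun k => \sum_(i <- s | (D l).2 i == k) a i)) b0 i si; have := b0 ((D l).2 i) (pfun i (sl _ si)).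
    rewrite -big_filter (perm_big [:: i]) ?big_seq1//.
    apply: uniq_perm; [exact: filter_uniq|by []|move=> x].
    rewrite mem_filter inE; apply/andP/eqP => [[/eqP e sx]|->]; last by [].
    by apply: pinj => //; rewrite inE; exact: sl.
  under eq_big_seq => i si do rewrite (sl _ si).
  under [RHS]eq_bigr do rewrite scaler_suml.
  rewrite (exchange_big_dep xpredT)//= big_seq [RHS]big_seq.
  apply: eq_bigr => i si.
  rewrite (big_pred1 (Ordinal (pfun i (sl _ si))))//.
- move=> l g gl.
  have [_ _ /(_ g gl) [b gb] [_ _ surj]] := DP l.
  have /choice[k kP] (j : 'I_(D l).1.1) : exists k, lam k = l /\ (D l).2 k = j.
    by have [k kl kj] := surj j (ltn_ord j); exists k.
  exists (D l).1.1, k, (fun i => b i); split; first by move=> j; have [] := kP j.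
  under eq_bigr => j _.
    have [kl kj] := kP j; rewrite kl kj; over.
  exact: gb.
Qed.
End SincOperator.

(** * Min-max bounds for the eigenvalues *)

Section MinMax.
Variables (R : realType) (c : R).
Hypothesis c0 : 0 <= c.
Notation mu := (leb11 R).
Implicit Types g h : L2 R.
Notation Q := (sincL c0).
Variable lam : nat -> R.
Hypothesis lamP : eigenvalues_in_decreasing_order c lam.
Variable f : nat -> L2 R.
Hypothesis fE : forall n, sinc_eigenspace c (lam n) (f n).
Hypothesis f_indep : forall (l : R) (s : seq nat) (a : nat -> R), uniq s ->
        {in s, forall i, lam i = l} ->
        (\sum_(i <- s) a i *: f i : L2 R) = (0 : L2 R) %[ae mu] ->
        {in s, forall i, a i = 0}.
Hypothesis f_span : forall (l : R) g, sinc_eigenspace c l g ->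
        exists (d : nat) (k : 'I_d -> nat) (b : 'I_d -> R),
          (forall j, lam (k j) = l) /\
          g = (\sum_(j < d) b j *: f (k j) : L2 R) %[ae mu].

Lemma eigen_orthogonal i j : lam i != lam j -> ip (f i) (f j) = 0.
Proof.
move=> ij; have := sincLC c0 (f i) (f j).
rewrite !(eigenspace_ip c0 _ (fE _)) (ipC (f j)) => /eqP.
by rewrite -subr_eq0 -mulrBl mulf_eq0 subr_eq0 (negbTE ij) => /eqP.
Qed.

(** Eigenfunctions of the same eigenvalue are only independent, not orthogonal.
    Grouping the terms of g by eigenvalue gives pairwise orthogonal eigenvectors
    [G j] with eigenvalues at least [lam n], on which the form is diagonal. *)
Lemma span_form_ge n (a : 'I_n.+1 -> R) : (exists i, a i != 0) ->
  let g : L2 R := \sum_i a i *: f i in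
  0 < ip g g /\ lam n * ip g g <= ip (Q g) g.
Proof.
move=> [i0 ai0] g.
(* One index for each eigenvalue. *)
pose rep (i : 'I_n.+1) : 'I_n.+1 := odflt i [pick k : 'I_n.+1 | lam k == lam i].
have rep_lam i : lam (rep i) = lam i.
  by rewrite /rep; case: pickP => //= k /eqP.
have rep_eq (i j : 'I_n.+1) : lam i = lam j -> rep i = rep j.
  move=> e; rewrite /rep e; case: pickP => //= /(_ j); by rewrite eqxx.
pose G (j : 'I_n.+1) : L2 R := \sum_(i | rep i == j) a i *: f i.
have gE : g = \sum_j G j by rewrite /g (partition_big rep xpredT).
have GQ j z : ip (Q (G j)) z = lam j * ip (G j) z.
  rewrite sincLC /G ip_sumr ip_suml mulr_sumr; apply: eq_bigr => i /eqP ij.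
  by rewrite ipZr sincLC (eigenspace_ip c0 _ (fE i)) ipZl -ij rep_lam mulrCA.
have Gorth j k : j != k -> ip (G j) (G k) = 0.
  move=> jk; rewrite /G ip_suml big1// => i /eqP ij.
  rewrite ip_sumr big1// => i' /eqP ik.
  rewrite ipZl ipZr eigen_orthogonal ?mulr0//.
  by apply: contra_neq jk => /rep_eq; rewrite ij ik.
have gg : ip g g = \sum_j ip (G j) (G j).
  rewrite {1}gE ip_suml; apply: eq_bigr => j _.
  rewrite gE ip_sumr (bigD1 j)//= big1 ?addr0// => k kj.
  by rewrite Gorth// eq_sym.
have gQ : ip (Q g) g = \sum_(j < n.+1) lam j * ip (G j) (G j).
  rewrite ipC {1}gE ip_suml; apply: eq_bigr => j _.
  rewrite ipC sincLC GQ gE ip_sumr (bigD1 j)//= big1 ?addr0// => k kj.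
  by rewrite Gorth// eq_sym.
have ggp : 0 < ip g g.
  rewrite lt_def ip_ge0 andbT; apply/eqP => gg0.
  have : ip (G (rep i0)) (G (rep i0)) = 0.
    move: gg0; rewrite gg => /psumr_eq0P -> // j _; exact: ip_ge0.
  move/ip_eq0 => G0.
  pose s := [seq val i | i <- enum 'I_n.+1 & rep i == rep i0].
  have us : uniq s by rewrite (map_inj_uniq val_inj) filter_uniq// enum_uniq.
  have i0s : val i0 \in s by apply: map_f; rewrite mem_filter eqxx mem_enum.
  have sl : {in s, forall i, lam i = lam (rep i0)}.
    by move=> _ /mapP[i + ->]; rewrite mem_filter => /andP[/eqP <- _]; rewrite rep_lam.
  have := f_indep (a := fun k => a (inord k)) us sl.
  rewrite /s big_map big_filter big_enum_cond/=.
  under eq_bigr do rewrite inord_val.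
  move=> /(_ G0) /(_ _ i0s) /eqP; rewrite inord_val; exact/negP.
split=> //; rewrite gg gQ mulr_sumr; apply: ler_sum => j _.
rewrite ler_wpM2r ?ip_ge0//; have [h _] := lamP; apply: h.
by rewrite -ltnS.
Qed.

(** If [lam n < d], the extremal eigenvector h on the complement of f 0, ...,
    f (n - 1) has an eigenvalue at least d. So it is a combination of
    eigenfunctions of index below n, to all of which it is orthogonal. *)
Lemma lam_ge_of_orthogonal n g (d : R) : (forall i, (i < n)%N -> ip g (f i) = 0) ->
  0 < d -> 0 < ip g g -> d * ip g g <= ip (Q g) g -> d <= lam n.
Proof.
move=> gf d0 g0 dg; rewrite leNgt; apply/negP => lamd.
have [L [h [dL hf h0 hL]]] := @top_eigenvector R _ (@ip R) (@ipC R) (@ipDl R)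
  (@ipZl R) (@ip_ge0 R) Q (2 * c / pi) (sincLB c0) (sincLZ c0) (sincLC c0)
  (sincL_ge0 c0) (sincL_le c0) (sincL_compact c0) n (fun i => f i) (fun i => lam i)
  (fun i z => eigenspace_ip c0 z (fE i)) d g d0 (fun i => gf i (ltn_ord i)) g0 dg.
have [d' [k [b [kL hb]]]] := f_span (eigenspace_of_nrm hL).
suff : ip h h = 0 by move=> e; rewrite e ltxx in h0.
rewrite (eq_ip_ae _ hb) ip_suml big1// => j _; rewrite ipZl ipC.
have kn : (k j < n)%N.
  rewrite ltnNge; apply/negP => nk.
  have [mono _] := lamP; have := mono _ _ nk; rewrite kL; lra.
by rewrite (hf (Ordinal kn)) mulr0.
Qed.
End MinMax.

(** * Chebyshev polynomials *)

Section Chebyshev.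
Variable R : realType.
Implicit Types (p : {poly R}) (x z s : R).

Fixpoint cheb (n : nat) : {poly R} :=
  if n is n1.+1 then
    if n1 is n2.+1 then 'X *+ 2 * cheb n1 - cheb n2 else 'X
  else 1.

Lemma chebSS n : cheb n.+2 = 'X *+ 2 * cheb n.+1 - cheb n.
Proof. by []. Qed.

Lemma nat_ind2 (P : nat -> Prop) : P 0 -> P 1 ->
  (forall n, P n -> P n.+1 -> P n.+2) -> forall n, P n.
Proof.
move=> p0 p1 pS n; suff : P n /\ P n.+1 by case.
by elim: n => // n [h1 h2]; split => //; exact: pS.
Qed.

Lemma cheb_cos n x : (cheb n).[cos x] = cos (n%:R * x).
Proof.
elim/nat_ind2: n => [||n h1 h2]; first by rewrite hornerE mul0r cos0.
  by rewrite hornerX mul1r.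
rewrite chebSS !hornerE h1 h2.
have -> : n.+2%:R * x = n.+1%:R * x + x by rewrite -natr1 mulrDl mul1r.
have -> : n%:R * x = n.+1%:R * x - x by rewrite -[n.+1%:R]natr1 mulrDl mul1r addrK.
rewrite cosB cosD; ring.
Qed.

Lemma cheb_bound n x : -1 <= x <= 1 -> `|(cheb n).[x]| <= 1.
Proof.
by move=> hx; rewrite -(@acosK _ x) ?in_itv//= cheb_cos cos_max.
Qed.

Lemma size_cheb n : (size (cheb n) <= n.+1)%N.
Proof.
elim/nat_ind2: n => [||n h1 h2]; rewrite ?size_poly1 ?size_polyX//.
rewrite chebSS (leq_trans (size_polyD _ _))// size_polyN geq_max.
rewrite (leq_trans h1 (leqW (leqnSn _))) andbT.
rewrite mulrnAl -scaler_nat (leq_trans (size_scale_leq _ _))//.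
rewrite mulrC (leq_trans (size_polyMleq _ _))// size_polyX addn2/=.
exact: leq_trans h2 _.
Qed.

Lemma cheb_lead n : (cheb n.+1)`_n.+1 = 2 ^+ n.
Proof.
elim: n => [|n ih]; first by rewrite coefX.
rewrite chebSS coefB mulrnAl coefMn coefXM/= ih.
rewrite (_ : (cheb n)`_n.+2 = 0) ?subr0 ?exprSr ?mulr_natr//.
by rewrite nth_default// (leq_trans (size_cheb n)).
Qed.

(** The number [r = 2 * z + (2 * z)^-1] satisfies [2 * z * r + 1 <= r ^+ 2], so its
    powers dominate the three-term recursion of the coefficients weighted by
    powers of z. *)
Lemma cheb_coef_le n j z : 0 < z ->
  `|(cheb n)`_j| * z ^+ j <= (2 * z + (2 * z)^-1) ^+ n.
Proof.
move=> z0; set r := 2 * z + _.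
have z20 : 0 < 2 * z by rewrite mulr_gt0.
have rz : 2 * z <= r by rewrite lerDl invr_ge0 ltW.
have r0 : 0 < r by exact: lt_le_trans rz.
elim/nat_ind2: n j => [||n h1 h2] j.
- rewrite coef1; case: j => [|j]/=; first by rewrite normr1 mul1r !expr0.
  by rewrite normr0 mul0r expr0.
- rewrite coefX; case: j => [|[|j]]/=; rewrite ?normr0 ?mul0r ?expr1 ?(ltW r0)//.
  by rewrite normr1 mul1r (le_trans _ rz)// ler_peMl// ?ltW//; lra.
- rewrite chebSS coefB mulrnAl coefMn coefXM.
  have h : 2 * z * r + 1 <= r ^+ 2.
    have -> : r ^+ 2 = 2 * z * r + (2 * z)^-1 * r by rewrite expr2 {1}/r mulrDl.
    rewrite lerD2l.
    by rewrite /r mulrDr mulVf ?gt_eqF// lerDl mulr_ge0// invr_ge0 ltW.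
  have h' : 2 * z * r ^+ n.+1 + r ^+ n <= r ^+ n.+2.
    rewrite [leRHS](_ : _ = r ^+ n * r ^+ 2); last by rewrite -exprD addn2.
    rewrite exprS [leLHS](_ : _ = r ^+ n * (2 * z * r + 1)); last by ring.
    by rewrite ler_wpM2l// exprn_ge0// ltW.
  apply: le_trans h'; apply: (@le_trans _ _
    ((`|(if j == 0%N then 0 else (cheb n.+1)`_j.-1) *+ 2| + `|(cheb n)`_j|) * z ^+ j)).
    by rewrite ler_wpM2r ?ler_normB// exprn_ge0// ltW.
  rewrite mulrDl lerD//; case: j => [|j]/=.
    by rewrite mul0rn normr0 mul0r mulr_ge0 ?exprn_ge0 ?ltW.
  rewrite normrMn exprS -(mulr_natl `|_|) [leLHS](_ : _ = 2 * z * (`|(cheb n.+1)`_j| * z ^+ j)); last by ring.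
  by rewrite ler_pM2l// h2.
Qed.

Lemma X_cheb k : 'X * cheb k.+1 = 2^-1 *: cheb k.+2 + 2^-1 *: cheb k.
Proof.
rewrite chebSS -scalerDr subrK mulrnAl -scalerMnr scalerMnl.
by rewrite -[2^-1 *+ 2]mulr_natr mulVf// scale1r.
Qed.

Let V w k : R := w ^+ k + w ^- k.

(** The weight [V w k] is twice the value of the k-th Chebyshev polynomial at
    (w + 1/w) / 2. Multiplication by 'X moves an index up or down with weight 1/2
    each, so the weighted sum of the coefficients grows like the powers of that
    point. *)
Lemma monomial_cheb m : exists2 l : seq (R * nat),
  'X^m = \sum_(u <- l) u.1 *: cheb u.2 &
  forall w, 0 < w -> \sum_(u <- l) `|u.1| * V w u.2 <= 2 * ((w + w^-1) / 2) ^+ m.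
Proof.
elim: m => [|m [l lE lw]].
  exists [:: (1, 0)]; first by rewrite big_seq1/= scale1r.
  by move=> w _; rewrite big_seq1/= normr1 /V !expr0 invr1; lra.
exists (flatten [seq if u.2 is k.+1 then [:: (u.1 / 2, k.+2); (u.1 / 2, k)]
   else [:: (u.1, 1%N)] | u <- l]).
  rewrite exprS lE mulr_sumr big_flatten big_map; apply: eq_bigr => -[a [|k]] _ /=.
    by rewrite big_seq1/= -scalerAr mulr1.
  by rewrite big_cons big_seq1/= -scalerAr X_cheb scalerDr !scalerA.
move=> w w0; rewrite exprSr mulrA; set W := _ / 2.
have W0 : 0 <= W by rewrite /W divr_ge0 ?addr_ge0 ?invr_ge0 ?(ltW w0).
apply: le_trans (ler_wpM2r W0 (lw w w0)).
rewrite big_flatten big_map mulr_suml; apply: ler_sum => -[a [|k]] _ /=.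
  rewrite big_seq1/= /V /W expr1 !expr0 invr1.
  by rewrite le_eqVlt; apply/orP; left; apply/eqP; field; rewrite gt_eqF.
rewrite big_cons big_seq1/= /V /W normrM [`|2^-1|]ger0_norm// !exprS.
by rewrite le_eqVlt; apply/orP; left; apply/eqP; field; rewrite ?expf_neq0 ?gt_eqF.
Qed.

(** Chebyshev terms of index at least n are dropped: each is bounded by its
    coefficient, to which [monomial_cheb] gives a weight at least [w ^+ n]. For
    m = n and large w the remainder is close to 2 / 2^n. *)
Lemma monomial_truncation n m w : 1 <= w ->
  exists2 q : {poly R}, (size q <= n)%N &
    forall x, -1 <= x <= 1 ->
      `|('X^m - q).[x]| <= 2 * ((w + w^-1) / 2) ^+ m / w ^+ n.
Proof.
move=> w1; have w0 : 0 < w by exact: lt_le_trans w1.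
have [l lE /(_ w w0) lw] := monomial_cheb m.
exists (\sum_(u <- l | (u.2 < n)%N) u.1 *: cheb u.2).
  apply: (leq_trans (size_sum _ _ _)); apply/bigmax_leqP_seq => u _ un.
  by rewrite (leq_trans (size_scale_leq _ _))// (leq_trans (size_cheb _)).
move=> x hx; rewrite lE (bigID (fun u => u.2 < n)%N)/= addrAC subrr add0r horner_sum.
rewrite (le_trans (ler_norm_sum _ _ _))// ler_pdivlMr ?exprn_gt0//.
apply: le_trans lw; rewrite mulr_suml [leRHS](bigID (fun u => u.2 < n)%N)/=.
apply: (@le_trans _ _ (\sum_(u <- l | ~~ (u.2 < n)%N) `|u.1| * V w u.2)).
  apply: ler_sum => u; rewrite -leqNgt => nu.
  rewrite hornerZ normrM -mulrA ler_wpM2l//.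
  rewrite (@le_trans _ _ (w ^+ n))//.
    by rewrite ler_piMl ?exprn_ge0 ?(ltW w0)// cheb_bound.
  rewrite /V (@le_trans _ _ (w ^+ u.2))// ?ler_weXn2l//.
  by rewrite lerDl invr_ge0 exprn_ge0// ltW.
rewrite lerDr; apply: sumr_ge0 => u _.
by rewrite mulr_ge0// addr_ge0 ?invr_ge0 ?exprn_ge0// ltW.
Qed.
End Chebyshev.

(** * Chebyshev nodes and coefficient bounds *)

Section ChebyshevNodes.
Variable R : realType.
Implicit Types (p : {poly R}) (x z s : R).

(** The angles whose cosines are the zeros of the N-th Chebyshev polynomial. *)
Definition node (N i : nat) : R := i.*2.+1%:R * (pi / N.*2%:R).

Lemma node_itv N i : (i < N)%N -> 0 < node N i < pi.
Proof.
move=> iN; have N0 : 0 < N.*2%:R :> R by rewrite ltr0n double_gt0 (leq_trans _ iN).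
rewrite /node mulr_gt0 ?divr_gt0 ?pi_gt0//= mulrA ltr_pdivrMr// mulrC.
by rewrite ltr_pM2l ?pi_gt0// ltr_nat ltn_Sdouble.
Qed.

Lemma sin_nat_pi (l : nat) : sin (l%:R * pi) = 0 :> R.
Proof.
elim: l => [|l ih]; first by rewrite mul0r sin0.
by rewrite -natr1 mulrDl mul1r sinDpi ih oppr0.
Qed.

Lemma cos_half_pi (i : nat) : cos (i.*2.+1%:R * (pi / 2)) = 0 :> R.
Proof.
elim: i => [|i ih]; first by rewrite mul1r cos_pihalf.
rewrite doubleS (_ : _ * _ = i.*2.+1%:R * (pi / 2) + pi).
  by rewrite cosDpi ih oppr0.
have -> : i.*2.+3%:R = i.*2.+1%:R + 2 :> R by rewrite -[in LHS]addn2 natrD.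
by field.
Qed.

Lemma cheb_prod N x : (0 < N)%N ->
  (cheb R N).[x] = 2 ^+ N.-1 * \prod_(i < N) (x - cos (node N i)).
Proof.
move=> N0; pose rs := [seq cos (node N i) | i <- iota 0 N].
have N20 : N.*2%:R != 0 :> R by rewrite pnatr_eq0 double_eq0 -lt0n.
have szT : size (cheb R N) = N.+1.
  apply/eqP; rewrite eqn_leq size_cheb/= ltnNge; apply/negP => h.
  have := cheb_lead R N.-1; rewrite prednK// nth_default// => /eqP.
  by rewrite eq_sym expf_eq0 pnatr_eq0 andbF.
have /all_roots_prod_XsubC : size (cheb R N) = (size rs).+1.
  by rewrite szT size_map size_iota.
move=> -> //.
- rewrite hornerZ horner_prod /lead_coef szT/= -[in (cheb R N)`_N](prednK N0) cheb_lead.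
  rewrite big_map -[N in iota 0 N]subn0 -/(index_iota 0 N) big_mkord; congr (_ * _).
  by apply: eq_bigr => i _; rewrite hornerXsubC.
- apply/allP => _ /mapP[i _ ->]; rewrite /root cheb_cos /node.
  rewrite (_ : _ * _ = i.*2.+1%:R * (pi / 2)) ?cos_half_pi//.
  have -> : N.*2%:R = N%:R * 2 :> R by rewrite -muln2 natrM.
  by field; rewrite pnatr_eq0 -lt0n.
- rewrite uniq_rootsE map_inj_in_uniq ?iota_uniq// => i j.
  rewrite !mem_iota !add0n => /andP[_ /node_itv iN] /andP[_ /node_itv jN] /cos_inj.
  rewrite !in_itv/=; move/andP: iN => [/ltW -> /ltW ->]; move/andP: jN => [/ltW -> /ltW ->].
  have c0 : pi / N.*2%:R != 0 :> R by rewrite mulf_neq0 ?invr_eq0// gt_eqF ?pi_gt0.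
  move=> /(_ isT isT) /(mulIf c0) /eqP; rewrite eqr_nat eqSS => /eqP.
  exact: double_inj.
Qed.

(** After multiplication by twice the sine of half the angle step the sum
    telescopes to the sine of a multiple of pi. *)
Lemma sum_cos_nodes N l : (0 < l)%N -> (l < N.*2)%N ->
  \sum_(i < N) cos (l%:R * node N i) = 0.
Proof.
move=> l0 lN.
have N20 : 0 < N.*2%:R :> R by rewrite ltr0n (leq_trans _ lN).
pose phi : R := l%:R * (pi / N.*2%:R).
have sp : sin phi != 0.
  rewrite gt_eqF// sin_gt0_pi// /phi mulr_gt0 ?ltr0n ?divr_gt0 ?pi_gt0//=.
  by rewrite mulrCA gtr_pMr ?pi_gt0// ltr_pdivrMr// mul1r ltr_nat.
apply: (mulIf sp); apply: (@mulIf _ 2) => //; rewrite !mul0r !mulr_suml.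
under eq_bigr => i _.
  rewrite (_ : _ * _ * 2 = sin (i.+1.*2%:R * phi) - sin (i.*2%:R * phi)).
    over.
  have -> : i.+1.*2%:R * phi = l%:R * node N i + phi.
    by rewrite /phi /node doubleS -[i.*2.+2%:R]natr1; ring.
  have -> : i.*2%:R * phi = l%:R * node N i - phi.
    by rewrite /phi /node -[i.*2.+1%:R]natr1; ring.
  rewrite sinD sinB; ring.
rewrite -(big_mkord xpredT (fun i => sin (i.+1.*2%:R * phi) - sin (i.*2%:R * phi))).
rewrite telescope_sumr// mul0r sin0 subr0 /phi.
by rewrite mulrCA [N.*2%:R * _]mulrC divfK ?gt_eqF// sin_nat_pi.
Qed.

Lemma node_orthogonal N b b' : (b < N)%N -> (b' < N)%N ->
  \sum_(i < N) cos (b%:R * node N i) * cos (b'%:R * node N i) =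
  if b == b' then (if b == 0%N then N%:R else N%:R / 2) else 0.
Proof.
wlog bb' : b b' / (b' <= b)%N => [h|] bN b'N.
  have [h1|/ltnW h1] := leqP b' b; first exact: h.
  rewrite eq_sym; under eq_bigr do rewrite mulrC; rewrite h//.
  by case: eqP => // ->.
have e (i : 'I_N) : cos (b%:R * node N i) * cos (b'%:R * node N i) =
  (cos ((b + b')%:R * node N i) + cos ((b - b')%:R * node N i)) / 2.
  have -> : (b + b')%:R * node N i = b%:R * node N i + b'%:R * node N i.
    by rewrite natrD mulrDl.
  have -> : (b - b')%:R * node N i = b%:R * node N i - b'%:R * node N i.
    by rewrite natrB// mulrBl.
  by rewrite cosB cosD; field.
under eq_bigr do rewrite e.
rewrite -mulr_suml big_split/=.
have [<-|nb] := eqVneq b b'.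
  rewrite subnn; under [X in _ + X]eq_bigr do rewrite mul0r cos0.
  rewrite sumr_const card_ord; have [->|b0] := eqVneq b 0%N.
    under eq_bigr do rewrite mul0r cos0.
    by rewrite sumr_const card_ord; field.
  by rewrite sum_cos_nodes ?add0r ?addn_gt0 ?lt0n ?b0// addnn ltn_double.
rewrite !sum_cos_nodes ?addr0 ?mul0r//.
- by rewrite subn_gt0 ltn_neqAle eq_sym nb.
- by rewrite (leq_ltn_trans (leq_subr _ _))// (leq_trans bN)// -addnn leq_addr.
- by rewrite addn_gt0 lt0n; case: (b) nb bb' => //; case: (b').
- by rewrite -addnn (leq_ltn_trans (leq_add (leqnn _) (ltnW b'N)))// ltn_add2r.
Qed.

Lemma poly_cheb p m : (size p <= m.+1)%N ->
  exists a : nat -> R, p = \sum_(b < m.+1) a b *: cheb R b.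
Proof.
elim: m p => [|m ih] p sp.
  exists (fun=> p`_0); rewrite big_ord1 /= alg_polyC; exact: size1_polyC.
pose q := p - (p`_m.+1 / 2 ^+ m) *: cheb R m.+1.
have [|a qa] := ih q.
  apply/leq_sizeP => j; rewrite leq_eqVlt => /predU1P[<-|mj].
    by rewrite coefB coefZ cheb_lead divfK ?subrr// expf_neq0.
  have -> : q`_j = p`_j - p`_m.+1 / 2 ^+ m * (cheb R m.+1)`_j by rewrite coefB coefZ.
  have -> : (cheb R m.+1)`_j = 0 by rewrite nth_default// (leq_trans (size_cheb _ _)).
  by rewrite nth_default ?(leq_trans sp)// mulr0 subr0.
exists (fun b => if b == m.+1 then p`_m.+1 / 2 ^+ m else a b).
rewrite big_ord_recr/= eqxx; apply/eqP; rewrite -subr_eq; apply/eqP.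
by rewrite -/q qa; apply: eq_bigr => i _; rewrite ltn_eqF.
Qed.

(** Discrete orthogonality at the m + 1 nodes bounds every Chebyshev coefficient
    of p by 2 s; [cheb_coef_le] then bounds the coefficients of the monomials. *)
Lemma coef_le_sup p m (s z : R) j : (size p <= m.+1)%N -> 1 <= z ->
  (forall x, -1 <= x <= 1 -> `|p.[x]| <= s) ->
  `|p`_j| * z ^+ j <= 2 * m.+1%:R * (2 * z + (2 * z)^-1) ^+ m * s.
Proof.
move=> sp z1 ps; have [a pa] := poly_cheb sp.
have N0 : 0 < m.+1%:R :> R by [].
have s0 : 0 <= s by rewrite (le_trans _ (ps 0 _))//; lra.
(* The index 0 has twice the squared norm of the others at the nodes. *)
have al (b : 'I_m.+1) : `|a b| <= 2 * s.
  have : \sum_(i < m.+1) p.[cos (node m.+1 i)] * cos (b%:R * node m.+1 i) =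
         a b * (if val b == 0%N then m.+1%:R else m.+1%:R / 2).
    rewrite pa; under eq_bigr do rewrite horner_sum mulr_suml.
    rewrite exchange_big/= (bigD1 b)//= [X in _ + X]big1 ?addr0.
      under eq_bigr do rewrite hornerZ cheb_cos -mulrA.
      by rewrite -mulr_sumr node_orthogonal// eqxx.
    move=> b' b'b; under eq_bigr do rewrite hornerZ cheb_cos -mulrA.
    by rewrite -mulr_sumr node_orthogonal// ifN ?mulr0.
  move=> e.
  have h : `|a b| * (m.+1%:R / 2) <= m.+1%:R * s.
    apply: (@le_trans _ _ `|a b * (if val b == 0%N then m.+1%:R else m.+1%:R / 2)|).
      rewrite normrM ler_wpM2l//; case: ifP => _; rewrite ger0_norm ?divr_ge0//.
      by rewrite ler_pdivrMr// ler_peMr//; lra.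
    rewrite -e (le_trans (ler_norm_sum _ _ _))//.
    rewrite mulr_natl -[m.+1 in leRHS]card_ord -sumr_const; apply: ler_sum => i _.
    rewrite normrM -[leRHS]mulr1 ler_pM ?cos_max// ps//.
    by rewrite cos_geN1 cos_le1.
  rewrite -(ler_pM2r (divr_gt0 N0 (ltr0n _ 2))) (le_trans h)//.
  by rewrite le_eqVlt; apply/orP; left; apply/eqP; field.
have z0 : 0 < z by exact: lt_le_trans z1.
have r1 : 1 <= 2 * z + (2 * z)^-1.
  rewrite (@le_trans _ _ (2 * z))// ?lerDl ?invr_ge0; lra.
have zj : 0 <= z ^+ j by rewrite exprn_ge0// ltW.
rewrite pa coef_sum (le_trans (ler_wpM2r zj (ler_norm_sum _ _ _)))//.
rewrite mulr_suml [leRHS](_ : _ = m.+1%:R * (2 * s * (2 * z + (2 * z)^-1) ^+ m)); last by ring.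
rewrite mulr_natl -[m.+1 in leRHS]card_ord -sumr_const; apply: ler_sum => b _.
rewrite coefZ normrM -mulrA ler_pM// ?mulr_ge0 ?exprn_ge0 ?(ltW z0)//.
apply: le_trans (cheb_coef_le _ _ z0) _.
by rewrite ler_weXn2l// -ltnS.
Qed.
End ChebyshevNodes.

(** * Primitives of polynomials *)

Section Primitive.
Variable R : realType.
Implicit Types (p q : {poly R}) (k s y : R).

Definition prim p : {poly R} :=
  \poly_(i < (size p).+1) (if i is j.+1 then p`_j / j.+1%:R else 0).

Lemma coef_prim p j : (prim p)`_j = if j is j1.+1 then p`_j1 / j%:R else 0.
Proof.
rewrite coef_poly; case: j => [|j]//=; rewrite ltnS; case: ltnP => // pj.
by rewrite nth_default// mul0r.
Qed.

Lemma prim_linear a p q : prim (a *: p + q) = a *: prim p + prim q.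
Proof.
apply/polyP => -[|j]; rewrite !(coef_prim, coefD, coefZ)/= ?mulr0 ?addr0//.
by rewrite mulrDl mulrA.
Qed.

Lemma primZ a p : prim (a *: p) = a *: prim p.
Proof.
by apply/polyP => -[|j]; rewrite !(coef_prim, coefZ)/= ?mulr0// mulrA.
Qed.

Lemma size_prim p : (size (prim p) <= (size p).+1)%N.
Proof. exact: size_poly. Qed.

Lemma prim_deriv p : (prim p)^`() = p.
Proof.
apply/polyP => j; by rewrite coef_deriv coef_prim -[LHS]mulr_natr divfK.
Qed.

Lemma prim0 p : (prim p).[0] = 0.
Proof. by rewrite horner_coef0 coef_prim. Qed.

Lemma prim_Xn j : prim 'X^j = (j.+1%:R^-1 : R) *: 'X^(j.+1).
Proof.
apply/polyP => -[|i]; rewrite coef_prim coefZ !coefXn ?mulr0//= eqSS.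
by case: eqP => [->|_]; rewrite ?mul1r ?mulr1 ?mul0r ?mulr0.
Qed.

Lemma is_derive_expM (k u : R) :
  is_derive u (1 : R) (fun v : R => expR (k * v)) (k * expR (k * u)).
Proof.
have -> : (fun v : R => expR (k * v)) = expR \o (fun v : R => k * v) by [].
by apply: is_derive_eq; rewrite /GRing.scale/= mulr1 mulrC.
Qed.

(** A weighted supremum norm on [-1, 1]: for the weight [expR (k * `|y|)], taking
    a primitive gains a factor 1 / k. *)
Definition exp_bdd k p s := forall y, -1 <= y <= 1 -> `|p.[y]| <= s * expR (k * `|y|).

(** On either side of 0 the primitive [s / k * expR (k * `|u|)] of the bound is
    compared with [prim p] by the mean value theorem, applied to the difference
    of the two. *)
Lemma exp_bdd_prim k p s : 0 < k -> exp_bdd k p s -> exp_bdd k (prim p) (s / k).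
Proof.
move=> k0 ps y y1.
have s0 : 0 <= s.
  by have := ps 0; rewrite normr0 mulr0 expR0 mulr1 => /(_ _)/(le_trans _) ->//; lra.
suff h (d : R) : `|d| = 1 -> d * (prim p).[y] <= s / k * expR (k * `|y|).
  have := h 1 (normr1 _); have := h (-1) (normrN1 _); rewrite ler_norml; lra.
move=> d1.
have fd (e u : R) : is_derive u (1 : R)
    (fun u => s / k * expR (e * k * u) - d * (prim p).[u])
    (s / k * (e * k * expR (e * k * u)) - d * p.[u]).
  have h1 := is_derive_expM (e * k) u; have h2 := is_derive_poly (prim p) u.
  rewrite prim_deriv in h2.
  exact: (is_deriveB (is_deriveZ (s / k) h1) (is_deriveZ d h2)).
have cont (e a b : R) : {within `[a, b],
    continuous (fun u => s / k * expR (e * k * u) - d * (prim p).[u])}.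
  apply: continuous_subspaceT => z; apply: differentiable_continuous.
  by apply/derivable1_diffP; have [] := fd e z.
have sk0 : 0 <= s / k by rewrite divr_ge0// ltW.
have dp u : -1 <= u <= 1 -> `|d * p.[u]| <= s * expR (k * `|u|).
  by move=> u1; rewrite normrM d1 mul1r; exact: ps.
have [yp|/ltW yn] := leP 0 y.
  have [x + e] := @MVT_segment _ _ _ 0 y yp (fun x _ => fd 1 x) (cont 1 _ _).
  rewrite in_itv/= => /andP[x0 xy].
  have hx : 0 <= s * expR (k * x) - d * p.[x].
    rewrite subr_ge0 (le_trans (ler_norm _))// -[x in expR (k * x)]ger0_norm//.
    by apply: dp; lra.
  move: e; rewrite !mul1r mulrA divfK ?gt_eqF// mulr0 expR0 mulr1 prim0 mulr0 !subr0.
  have : 0 <= (s * expR (k * x) - d * p.[x]) * y by rewrite mulr_ge0.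
  rewrite (ger0_norm yp); lra.
have [x + e] := @MVT_segment _ _ _ y 0 yn (fun x _ => fd (-1) x) (cont (-1) _ _).
rewrite in_itv/= => /andP[yx x0].
have hx : 0 <= s * expR (k * - x) + d * p.[x].
  rewrite -lerBlDr sub0r (le_trans (ler_norm _))// normrN -[- x]ler0_norm//.
  by apply: dp; lra.
move: e; rewrite !mulN1r !mulNr !mulrN mulr0 oppr0 expR0 mulr1 prim0 mulr0 subr0 sub0r.
rewrite mulrA divfK ?gt_eqF//.
have : 0 <= (s * expR (k * - x) + d * p.[x]) * - y by rewrite mulr_ge0// oppr_ge0.
rewrite (ler0_norm yn) !mulrN; lra.
Qed.

End Primitive.

(** * Neumann series of functionals on polynomials *)

Section SeriesHelpers.
Variable R : realType.

Lemma cvgn_series_dominated (u v : R^nat) :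
  (forall n, `|u n| <= v n) -> cvgn (series v) -> cvgn (series u).
Proof.
move=> uv cv; apply: normed_cvg; apply: series_le_cvg cv => n /=.
- exact: normr_ge0.
- exact: le_trans (uv n).
- exact: uv.
Qed.

Lemma limit_norm_le (u : R^nat) (l s : R) :
  u @ \oo --> l -> (forall n, `|u n| <= s) -> `|l| <= s.
Proof.
move=> ul us; have nl : `|u n| @[n --> \oo] --> `|l| by exact: cvg_norm.
rewrite -(cvg_lim _ nl)//; apply: limr_le; first by apply/cvg_ex; exists `|l|.
by apply: nearW => n; exact: us.
Qed.

End SeriesHelpers.

Section Functional.
Variables (R : realType) (k : R).
Hypothesis k0 : 0 < k.
Implicit Types (p q : {poly R}) (L : {poly R} -> R) (a B s : R).

Definition prim2 p := prim (prim p).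
Definition lin L := forall a p q, L (a *: p + q) = a * L p + L q.
Definition bdd B L := forall p s, exp_bdd k p s -> `|L p| <= B * s.

Lemma prim2_lin a p q : prim2 (a *: p + q) = a *: prim2 p + prim2 q.
Proof. by rewrite /prim2 !prim_linear. Qed.

Lemma iterW_lin l a p q : iter l prim2 (a *: p + q) = a *: iter l prim2 p + iter l prim2 q.
Proof. by elim: l => // l ih; rewrite !iterS ih prim2_lin. Qed.

Lemma exp_bddW p s l : exp_bdd k p s -> exp_bdd k (iter l prim2 p) (s / k ^+ 2 ^+ l).
Proof.
move=> ps; elim: l => [|l ih]; first by rewrite divr1.
rewrite iterS /prim2; have := exp_bdd_prim k0 (exp_bdd_prim k0 ih).
by rewrite -!mulrA -!invfM -expr2 -exprSr.
Qed.

Lemma exp_bdd_ge0 p s : exp_bdd k p s -> 0 <= s.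
Proof.
move=> ps; have := ps 0; rewrite normr0 mulr0 expR0 mulr1.
move=> /(_ _)/(le_trans _) ->//; lra.
Qed.

Lemma exp_bddW_sup p s : 0 <= s -> (forall y, -1 <= y <= 1 -> `|p.[y]| <= s) -> exp_bdd k p s.
Proof.
move=> s0 ps y y1; rewrite (le_trans (ps _ y1))// ler_peMr// -expR0 ler_expR.
by rewrite mulr_ge0// ltW.
Qed.

Lemma exp_bdd_ex p : exists s, exp_bdd k p s.
Proof.
exists (\sum_(i < size p) `|p`_i|); apply: exp_bddW_sup.
  by apply: sumr_ge0.
move=> y y1; rewrite horner_coef (le_trans (ler_norm_sum _ _ _))//.
apply: ler_sum => i _; rewrite normrM normrX ler_piMr// exprn_ile1// ler_norml; lra.
Qed.

Lemma bdd_ge0 B L : bdd B L -> 0 <= B.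
Proof.
move=> LB; rewrite -[B]mulr1; apply: le_trans (LB 0 1 _); first exact: normr_ge0.
by apply: exp_bddW_sup => // y _; rewrite horner0 normr0.
Qed.

Lemma lin0 L : lin L -> L 0 = 0.
Proof. by move=> h; have := h (-1) 0 0; rewrite scaler0 addr0 mulN1r addNr. Qed.
Lemma linD L p q : lin L -> L (p + q) = L p + L q.
Proof. by move=> h; have := h 1 p q; rewrite scale1r mul1r. Qed.
Lemma linZ L a p : lin L -> L (a *: p) = a * L p.
Proof. by move=> h; have := h a p 0; rewrite addr0 lin0// addr0. Qed.
Lemma linB L p q : lin L -> L (p - q) = L p - L q.
Proof. by move=> h; rewrite addrC -scaleN1r h mulN1r addrC. Qed.
Lemma lin_sum L I (r : seq I) (P : pred I) (F : I -> {poly R}) : lin L ->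
  L (\sum_(i <- r | P i) F i) = \sum_(i <- r | P i) L (F i).
Proof.
by move=> h; elim/big_rec2: _ => [|i y1 y2 _ <-]; rewrite ?lin0 ?linD.
Qed.

Section Neumann.
Variables (a : R).
Hypotheses (a0 : 0 <= a) (ak : a < k ^+ 2).

Definition neumann_term L p l := (- a) ^+ l * L (iter l prim2 p).
(** The Neumann series for the functional L' that solves
    [L' p + a * L' (prim2 p) = L p]. *)
Definition neumann L p := limn (series (neumann_term L p)).

Let q := a / k ^+ 2.
Let k2 : 0 < k ^+ 2. Proof. by rewrite exprn_gt0. Qed.
Let q0 : 0 <= q. Proof. by rewrite divr_ge0// ltW. Qed.
Let q1 : q < 1. Proof. by rewrite ltr_pdivrMr// mul1r. Qed.

(** Every double primitive gains a factor [k ^- 2], so the terms decrease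
    geometrically as soon as [a < k ^+ 2]. *)
Lemma neumann_term_le B L p s l : bdd B L -> exp_bdd k p s ->
  `|neumann_term L p l| <= B * s * q ^+ l.
Proof.
move=> LB ps; rewrite /neumann_term normrM normrX normrN (ger0_norm a0).
have := LB _ _ (exp_bddW l ps) => h.
apply: le_trans (ler_wpM2l (exprn_ge0 l a0) h) _.
by rewrite /q expr_div_n le_eqVlt; apply/orP; left; apply/eqP; ring.
Qed.

Lemma neumann_cvg B L p : bdd B L -> series (neumann_term L p) @ \oo --> neumann L p.
Proof.
move=> LB; have [s ps] := exp_bdd_ex p.
apply: (@cvgn_series_dominated _ _ (geometric (B * s) q)).
  by move=> n; exact: neumann_term_le.
by apply: is_cvg_geometric_series; rewrite ger0_norm.
Qed.

Lemma neumann_eq B L p : bdd B L -> neumann L p + a * neumann L (prim2 p) = L p.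
Proof.
move=> LB.
have h : [sequence L p - a * series (neumann_term L (prim2 p)) n]_n @ \oo --> neumann L p.
  have := @neumann_cvg _ _ p LB; rewrite -cvg_shiftS; apply: cvg_trans.
  apply: near_eq_cvg; apply: nearW => n /=.
  rewrite /series/= big_nat_recl// mulr_sumr -sumrN /neumann_term expr0 mul1r/=.
  congr (_ + _); apply: eq_bigr => i _.
  by rewrite -iterSr /= exprS; ring.
have h' : [sequence L p - a * series (neumann_term L (prim2 p)) n]_n @ \oo --> L p - a * neumann L (prim2 p).
  apply: cvgB; first exact: cvg_cst.
  by apply: cvgM; [exact: cvg_cst|exact: neumann_cvg LB].
by rewrite (cvg_unique _ h h')// subrK.
Qed.

Lemma neumann_lin B L : bdd B L -> lin L -> lin (neumann L).
Proof.
move=> LB Ll b p p'.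
have h := cvgD (cvgM (cvg_cst b) (@neumann_cvg _ _ p LB)) (@neumann_cvg _ _ p' LB).
apply/cvg_lim => //; rewrite (_ : series (neumann_term L (b *: p + p')) =
  (fun n => b * series (neumann_term L p) n + series (neumann_term L p') n)); first exact: h.
apply/funext => n; rewrite /series/= mulr_sumr -big_split/=.
by apply: eq_bigr => i _; rewrite /neumann_term iterW_lin Ll; ring.
Qed.

Lemma neumann_comb B B' c L L' : bdd B L -> bdd B' L' ->
  neumann (fun p => c * L p + L' p) =1 (fun p => c * neumann L p + neumann L' p).
Proof.
move=> LB LB' p.
have h := cvgD (cvgM (cvg_cst c) (@neumann_cvg _ _ p LB)) (@neumann_cvg _ _ p LB').
apply/cvg_lim => //; rewrite (_ : series (neumann_term (fun p => c * L p + L' p) p) =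
  (fun n => c * series (neumann_term L p) n + series (neumann_term L' p) n)); first exact: h.
apply/funext => n; rewrite /series/= mulr_sumr -big_split/=.
by apply: eq_bigr => i _; rewrite /neumann_term; ring.
Qed.

Lemma neumann_bdd B L : bdd B L -> bdd (B / (1 - q)) (neumann L).
Proof.
move=> LB p s ps; apply: limit_norm_le (@neumann_cvg _ _ p LB) _ => n.
rewrite /series/= (le_trans (ler_norm_sum _ _ _))//.
apply: (@le_trans _ _ (\sum_(0 <= l < n) B * s * q ^+ l)).
  by apply: ler_sum => l _; exact: neumann_term_le.
rewrite -mulr_sumr [leRHS]mulrAC ler_wpM2l// ?mulr_ge0 ?(bdd_ge0 LB) ?(exp_bdd_ge0 ps)//.
have d0 : 0 < 1 - q by rewrite subr_gt0.
rewrite -[leRHS]mul1r ler_pdivlMr// mulrC.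
have := subrX1 q n; rewrite big_mkord => e.
have -> : (1 - q) * \sum_(i < n) q ^+ i = 1 - q ^+ n.
  by rewrite -[1 - q]opprB mulNr -e opprB.
by rewrite gerBl exprn_ge0.
Qed.

End Neumann.
End Functional.

(** * Trigonometric series under a functional *)

Section ExpTail.
Variable R : realType.
Implicit Types (T : R).

Lemma exp_partial_le T n : 0 <= T -> \sum_(i < n) T ^+ i / i`!%:R <= expR T.
Proof.
move=> T0; rewrite -(big_mkord xpredT (fun i => T ^+ i / i`!%:R)).
apply: (@nondecreasing_cvgn_le _ (series (exp_coeff T))); last exact: is_cvg_series_exp_coeff.
apply/nondecreasing_seqP => m.
by rewrite /series/= big_nat_recr//= lerDl exp_coeff_ge0.
Qed.

(** Since [(i + n)`! >= i`! * n`!], the tail is its first term times an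
    exponential series. *)
Lemma exp_tail T n M : 0 <= T ->
  \sum_(n <= i < M) T ^+ i / i`!%:R <= T ^+ n / n`!%:R * expR T.
Proof.
move=> T0; rewrite -{1}[n]add0n big_addn.
apply: (@le_trans _ _ (T ^+ n / n`!%:R * \sum_(i < (M - n)%N) T ^+ i / i`!%:R)); last first.
  by rewrite ler_wpM2l ?exp_partial_le// divr_ge0// exprn_ge0.
rewrite big_mkord mulr_sumr; apply: ler_sum => i _.
rewrite exprD mulrACA (mulrC (T ^+ i)) ler_wpM2l ?mulr_ge0 ?exprn_ge0//.
rewrite -invfM -natrM lef_pV2 ?posrE ?ltr0n ?muln_gt0 ?fact_gt0// ler_nat.
have := @bin_fact (i + n) n (leq_addl _ _); rewrite addnK => <-.
by rewrite leq_pmull ?bin_gt0 ?leq_addl// mulnC.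
Qed.

End ExpTail.

Section Chain.
Variables (R : realType) (k x2 : R).
Hypotheses (k0 : 0 < k) (x20 : 0 <= x2) (x21 : x2 < 1).
Implicit Types (p q : {poly R}) (L : {poly R} -> R) (a B s t : R) (ss : seq R).

Fixpoint neumann_iter ss L := if ss is a :: s' then neumann_iter s' (neumann a L) else L.

Definition okseq ss := all (fun a => 0 <= a <= x2 * k ^+ 2) ss.

Let k2 : 0 < k ^+ 2. Proof. by rewrite exprn_gt0. Qed.
Let ok_lt a : a <= x2 * k ^+ 2 -> a < k ^+ 2.
Proof. by move=> /le_lt_trans; apply; rewrite gtr_pMl. Qed.

Lemma bdd_mono B B' L : B <= B' -> bdd k B L -> bdd k B' L.
Proof.
move=> BB h p s ps; apply: le_trans (h p s ps) _.
by rewrite ler_wpM2r// (exp_bdd_ge0 ps).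
Qed.

Lemma neumann_bdd_ok a B L : 0 <= a <= x2 * k ^+ 2 -> bdd k B L -> bdd k (B / (1 - x2)) (neumann a L).
Proof.
move=> /andP[a0 ax] LB; apply: bdd_mono (neumann_bdd k0 a0 (ok_lt ax) LB).
rewrite ler_wpM2l ?(bdd_ge0 k0 LB)// lef_pV2 ?posrE ?subr_gt0// ?lerD2l ?lerN2 ?ler_pdivrMr//.
by rewrite ltr_pdivrMr// mul1r ok_lt.
Qed.

Lemma neumann_iter_lin_bdd ss B L : okseq ss -> bdd k B L -> lin L ->
  lin (neumann_iter ss L) /\ bdd k (B / (1 - x2) ^+ size ss) (neumann_iter ss L).
Proof.
elim: ss B L => [|a ss ih] B L /=; first by rewrite expr0 divr1.
move=> /andP[ax os] LB Ll; have /andP[a0 al] := ax.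
have [h1 h2] := ih _ _ os (neumann_bdd_ok ax LB) (neumann_lin k0 a0 (ok_lt al) LB Ll).
split => //; apply: bdd_mono h2.
by rewrite exprS invfM mulrA.
Qed.

Lemma neumann_iter_comb ss B B' c L L' : okseq ss -> bdd k B L -> bdd k B' L' ->
  neumann_iter ss (fun p => c * L p + L' p) = (fun p => c * neumann_iter ss L p + neumann_iter ss L' p).
Proof.
elim: ss B B' L L' => [//|a ss ih] B B' L L' /= /andP[ax os] LB LB'.
have /andP[a0 al] := ax.
rewrite (_ : neumann a _ = (fun p => c * neumann a L p + neumann a L' p)); last first.
  by apply/funext => p; apply: (neumann_comb k0 a0 (ok_lt al) _ LB LB').
exact: (ih _ _ _ _ os (neumann_bdd_ok ax LB) (neumann_bdd_ok ax LB')).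
Qed.

Lemma neumann_iter_sum ss n (c : nat -> R) (L : nat -> {poly R} -> R) (B : nat -> R) :
  okseq ss -> (forall i, bdd k (B i) (L i)) ->
  neumann_iter ss (fun p => \sum_(i < n) c i * L i p) = (fun p => \sum_(i < n) c i * neumann_iter ss (L i) p)
  /\ exists B', bdd k B' (fun p => \sum_(i < n) c i * L i p).
Proof.
move=> os LB; elim: n => [|n [ih [B' LB']]].
  have b0 : bdd k 0 (fun p => \sum_(i < 0) c i * L i p).
    by move=> p s ps; rewrite big_ord0 normr0 mul0r.
  split; last by exists 0.
  have := neumann_iter_comb (-1) os b0 b0.
  rewrite (_ : (fun p => -1 * _ + _) = (fun p => \sum_(i < 0) c i * L i p)).
    by move=> ->; apply/funext => p; rewrite big_ord0 mulN1r addNr.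
  by apply/funext => p; rewrite big_ord0 mulr0 addr0.
have e p : \sum_(i < n.+1) c i * L i p = c n * L n p + \sum_(i < n) c i * L i p.
  by rewrite big_ord_recr addrC.
split.
  rewrite (_ : (fun p => \sum_(i < n.+1) c i * L i p) =
    (fun p => c n * L n p + \sum_(i < n) c i * L i p)); last exact/funext.
  rewrite (neumann_iter_comb _ os (LB n) LB') ih; apply/funext => p.
  by rewrite big_ord_recr addrC.
exists (`|c n| * B n + B') => p s ps; rewrite e (le_trans (ler_normD _ _))//.
by rewrite mulrDl lerD ?(LB' _ _ ps)// normrM -mulrA ler_wpM2l// (LB n).
Qed.

(** The equation [neumann_eq] recovers L from its Neumann series at p and at
    [prim2 p], so each step back costs two degrees. *)
Lemma neumann_iter_vanish ss B L N : okseq ss -> bdd k B L ->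
  (forall p, (size p <= N + (size ss).*2)%N -> neumann_iter ss L p = 0) ->
  forall p, (size p <= N)%N -> L p = 0.
Proof.
elim: ss N B L => [|a ss ih] N B L /=; first by rewrite addn0.
move=> /andP[ax os] LB h p sp; have /andP[a0 al] := ax.
have v := ih N.+2 _ _ os (neumann_bdd_ok ax LB).
rewrite -(neumann_eq k0 a0 (ok_lt al) p LB) !v ?mulr0 ?addr0//.
- by move=> p' sp'; apply: h; rewrite doubleS !addnS -!addSn.
- rewrite /prim2 (leq_trans (size_prim _))// ltnS (leq_trans (size_prim _))//.
- by move=> p' sp'; apply: h; rewrite doubleS !addnS -!addSn.
- by rewrite (leq_trans sp)// leqW.
Qed.

Section Trig.
Variables (e : nat -> R) (t : R).
Hypothesis e2 : forall j, e j.+2 = - e j.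

(** A partial sum of L applied to the Taylor series of a function of t * y whose
    derivatives at 0 are the [e j]. *)
Definition trig_sum L M := \sum_(j < M) e j * (t ^+ j / j`!%:R) * L 'X^j.

(** The double primitive of [cos (t * y)] is [- cos (t * y) / t ^+ 2] up to a
    polynomial of degree at most 1, on which the Neumann series vanishes. So on
    such a function [neumann_eq] is multiplication by [1 - a / t ^+ 2]; on
    partial sums it also shifts the number of terms by two. *)
Lemma trig_sum_step a B L M : 0 <= a <= x2 * k ^+ 2 -> bdd k B L -> lin L ->
  neumann a L 1 = 0 -> neumann a L 'X = 0 ->
  t ^+ 2 * trig_sum L M = t ^+ 2 * trig_sum (neumann a L) M - a * trig_sum (neumann a L) M.+2.
Proof.
move=> /andP[a0 al] LB Ll h1 hX; set L' := neumann a L.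
have L'l : lin L' by exact: (neumann_lin k0 a0 (ok_lt al) LB Ll).
have -> : trig_sum L' M.+2 = \sum_(j < M) e j.+2 * (t ^+ j.+2 / (j.+2)`!%:R) * L' 'X^(j.+2).
  by rewrite /trig_sum !big_ord_recl/= expr0 expr1 [L' 1]h1 [L' 'X]hX !mulr0 !add0r.
rewrite /trig_sum !mulr_sumr -sumrB; apply: eq_bigr => j _.
rewrite -(neumann_eq k0 a0 (ok_lt al) 'X^j LB) -/L'.
have -> : prim2 'X^j = (j.+1%:R^-1 / j.+2%:R : R) *: 'X^(j.+2).
  by rewrite /prim2 prim_Xn primZ prim_Xn scalerA.
rewrite (linZ _ _ L'l) e2 !factS !natrM !exprS.
by field; rewrite nat1r -natrD !pnatr_eq0 -lt0n fact_gt0.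
Qed.

Lemma trig_sum_lim ss B L l : okseq ss -> bdd k B L -> lin L ->
  (forall p, (size p <= (size ss).*2)%N -> neumann_iter ss L p = 0) ->
  trig_sum (neumann_iter ss L) @ \oo --> l ->
  (fun M => t ^+ (size ss).*2 * trig_sum L M) @ \oo --> (\prod_(a <- ss) (t ^+ 2 - a)) * l.
Proof.
elim: ss B L => [|a ss ih] B L /=.
  move=> _ _ _ _ h; rewrite big_nil mul1r expr0.
  by under eq_fun do rewrite mul1r.
move=> /andP[ax os] LB Ll h hl; have /andP[a0 al] := ax.
have v := @neumann_iter_vanish ss _ _ 2 os (neumann_bdd_ok ax LB) h.
have {}ih := ih _ _ os (neumann_bdd_ok ax LB) (neumann_lin k0 a0 (ok_lt al) LB Ll) _ hl.
have h2 : (fun M => t ^+ (size ss).*2 * trig_sum (neumann a L) M) @ \oo -->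
   \prod_(b <- ss) (t ^+ 2 - b) * l.
  apply: ih => p sp; apply: h; rewrite doubleS (leq_trans sp)// -addn2 leq_addr//.
rewrite big_cons -mulrA.
have h2' : (fun M => t ^+ (size ss).*2 * trig_sum (neumann a L) M.+2) @ \oo -->
   \prod_(b <- ss) (t ^+ 2 - b) * l.
  have := h2; rewrite -cvg_shiftS -cvg_shiftS; exact.
have := cvgB (cvgM (cvg_cst (t ^+ 2)) h2) (cvgM (cvg_cst a) h2').
rewrite -mulrBl => h3.
rewrite (_ : (fun M => _) = (fun M => t ^+ 2 * (t ^+ (size ss).*2 * trig_sum (neumann a L) M)
  - a * (t ^+ (size ss).*2 * trig_sum (neumann a L) M.+2))); first exact: h3.
apply/funext => M; rewrite doubleS !exprSr -!mulrA [t * (t * _)]mulrA -expr2.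
rewrite (@trig_sum_step a B L M ax LB Ll); first by ring.
  by apply: v; rewrite size_poly1.
by apply: v; rewrite size_polyX.
Qed.

Lemma trig_sum_cvg B L : (forall j, `|e j| <= 1) -> 0 <= t -> bdd k B L ->
  cvgn (trig_sum L).
Proof.
move=> e1 t0 LB.
rewrite (_ : trig_sum L = series (fun j => e j * (t ^+ j / j`!%:R) * L 'X^j)); last first.
  by apply/funext => M; rewrite /series/= big_mkord.
apply: (@cvgn_series_dominated _ _ (fun j => B * exp_coeff t j)).
  move=> j; rewrite normrM [leRHS]mulrC; apply: ler_pM => //.
    have tj : 0 <= t ^+ j / j`!%:R by rewrite divr_ge0 ?exprn_ge0.
    by rewrite normrM (ger0_norm tj) ler_piMl.
  rewrite -[B]mulr1; apply: LB; apply: exp_bddW_sup => // y y1.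
  by rewrite hornerXn normrX exprn_ile1// ler_norml; lra.
rewrite (_ : series _ = (fun n => B * series (exp_coeff t) n)).
  by apply: is_cvgM; [exact: is_cvg_cst|exact: is_cvg_series_exp_coeff].
by apply/funext => n; rewrite /series/= mulr_sumr.
Qed.

(** As L vanishes below degree n, each monomial may be replaced by its
    remainder in [monomial_truncation], and only the Taylor terms of degree at
    least n are left. *)
Lemma trig_sum_le B L n w M : (forall j, `|e j| <= 1) -> 0 <= t -> 1 <= w ->
  bdd k B L -> lin L -> (forall p, (size p <= n)%N -> L p = 0) ->
  let v := (w + w^-1) / 2 in
  `|trig_sum L M| <= B * (2 / w ^+ n) * ((v * t) ^+ n / n`!%:R * expR (v * t)).
Proof.
move=> e1 t0 w1 LB Ll Lv; set v := _ / 2; rewrite /=.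
have w0 : 0 < w by exact: lt_le_trans w1.
have v0 : 0 <= v by rewrite /v divr_ge0 ?addr_ge0 ?invr_ge0 ?(ltW w0).
have B0 := bdd_ge0 k0 LB.
have wn : 0 < w ^+ n by rewrite exprn_gt0.
have X j : `|L 'X^j| <= B * (2 * v ^+ j / w ^+ n).
  have [q sq hq] := @monomial_truncation R n j w w1.
  rewrite -[L 'X^j]subr0 -(Lv q sq) -linB//; apply: LB.
  apply: exp_bddW_sup => //.
  by rewrite divr_ge0 ?mulr_ge0 ?exprn_ge0 ?(ltW w0).
apply: (@le_trans _ _ (B * (2 / w ^+ n) * \sum_(n <= j < M) (v * t) ^+ j / j`!%:R)); last first.
  apply: ler_wpM2l; first by rewrite mulr_ge0// divr_ge0// ltW.
  exact: exp_tail (mulr_ge0 v0 t0).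
rewrite /trig_sum -(big_mkord xpredT (fun j => e j * (t ^+ j / j`!%:R) * L 'X^j)).
have [nM|Mn] := leqP n M; last first.
  rewrite big_nat big1 ?normr0.
    rewrite mulr_ge0//; first by rewrite mulr_ge0// divr_ge0// ltW.
    by apply: sumr_ge0 => j _; rewrite divr_ge0// exprn_ge0// mulr_ge0.
  by move=> j /andP[_ jM]; rewrite Lv ?mulr0// size_polyXn (leq_trans jM)// ltnW.
rewrite (big_cat_nat _ nM)//= big_nat big1 ?add0r; last first.
  by move=> j /andP[_ jM]; rewrite Lv ?mulr0// size_polyXn.
rewrite (le_trans (ler_norm_sum _ _ _))// mulr_sumr; apply: ler_sum => j _.
rewrite !normrM [`|t ^+ j|]ger0_norm ?exprn_ge0// [`|_^-1|]ger0_norm//.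
apply: (@le_trans _ _ (1 * (t ^+ j / j`!%:R) * (B * (2 * v ^+ j / w ^+ n)))).
  by rewrite ler_pM ?mulr_ge0 ?exprn_ge0// ler_wpM2r ?mulr_ge0 ?exprn_ge0.
rewrite (exprMn _ v t) le_eqVlt; apply/orP; left; apply/eqP; ring.
Qed.

End Trig.
End Chain.

(** * Taylor expansions of sine and cosine *)

Section Taylor.
Variable R : realType.
Implicit Types (x y t : R).

(** The derivatives of the cosine at 0. *)
Definition ecos (j : nat) : R := (~~ odd j)%:R * (-1) ^+ j./2.
(** The derivatives of the sine at 0. *)
Definition esin (j : nat) : R := (odd j)%:R * (-1) ^+ j.-1./2.

Lemma ecos2 j : ecos j.+2 = - ecos j.
Proof. by rewrite /ecos /= negbK exprS mulN1r mulrN. Qed.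
Lemma esin2 j : esin j.+2 = - esin j.
Proof.
rewrite /esin /= negbK; case: j => [|j]; first by rewrite !mul0r oppr0.
by rewrite /= exprS mulN1r mulrN.
Qed.
Lemma ecos_le1 j : `|ecos j| <= 1.
Proof. by rewrite normrM normrX normrN1 expr1n mulr1; case: odd; rewrite ?normr0 ?normr1. Qed.
Lemma esin_le1 j : `|esin j| <= 1.
Proof. by rewrite normrM normrX normrN1 expr1n mulr1; case: odd; rewrite ?normr0 ?normr1. Qed.
Lemma esinS j : esin j.+1 = ecos j. Proof. by []. Qed.
Lemma ecosS j : ecos j.+1 = - esin j.
Proof. by rewrite -esinS esin2. Qed.

Lemma taylor_remainder (f : R -> R) (e : nat -> R) x M : (forall j, `|e j| <= 1) ->
  series (fun j => e j * (x ^+ j / j`!%:R)) @ \oo --> f x ->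
  `|f x - \sum_(j < M) e j * (x ^+ j / j`!%:R)| <= `|x| ^+ M / M`!%:R * expR `|x|.
Proof.
move=> e1 fx; set u := fun j => _ in fx.
have h : (fun n => series u (n + M)%N - series u M) @ \oo --> f x - series u M.
  by apply: cvgB; [rewrite -(cvg_shiftn M) in fx; exact: fx|exact: cvg_cst].
rewrite -(big_mkord xpredT u); apply: limit_norm_le h _ => n.
rewrite /series/= (big_cat_nat (leq0n M) (leq_addl n M))/= addrAC subrr add0r.
apply: le_trans (exp_tail M (n + M) (normr_ge0 x)).
rewrite (le_trans (ler_norm_sum _ _ _))//; apply: ler_sum => j _.
rewrite /u !normrM normrX [`|_^-1|]ger0_norm//.
by rewrite ler_piMl ?mulr_ge0 ?exprn_ge0.
Qed.

Lemma cos_series x : series (fun j => ecos j * (x ^+ j / j`!%:R)) @ \oo --> cos x.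
Proof.
rewrite unlock (_ : series _ = series (cos_coeff x)).
  exact: is_cvg_series_cos_coeff.
by congr series; apply/funext => j; rewrite /cos_coeff/= /ecos mulrA.
Qed.
Lemma sin_series x : series (fun j => esin j * (x ^+ j / j`!%:R)) @ \oo --> sin x.
Proof.
rewrite unlock (_ : series _ = series (sin_coeff x)).
  exact: is_cvg_series_sin_coeff.
by congr series; apply/funext => j; rewrite /sin_coeff/= /esin mulrA.
Qed.
End Taylor.

(** * Upper bound for the quadratic form *)

Section Moments.
Variable R : realType.
Implicit Types (g h : L2 R) (p q : {poly R}).

Lemma poly_cont p : continuous (fun x : R => p.[x]).
Proof.
move=> x; apply: differentiable_continuous.
by apply/derivable1_diffP; have [] := is_derive_poly p x.
Qed.
Definition polyL p : L2 R := cL2 (@poly_cont p).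
Lemma polyLE p x : polyL p x = p.[x]. Proof. by []. Qed.

Definition moment g p : R := ip (polyL p) g.

Lemma polyL_lin a p q : polyL (a *: p + q) = a *: polyL p + polyL q.
Proof. by apply/LfuneqP => x; rewrite L2addE L2scaleE !polyLE hornerD hornerZ. Qed.

Lemma moment_lin g : lin (moment g).
Proof. by move=> a p q; rewrite /moment polyL_lin ipDl ipZl. Qed.

Lemma moment_bdd k g : 0 < k -> bdd k (Num.sqrt 2 * expR k * nrm g) (moment g).
Proof.
move=> k0 p s ps; have s0 := exp_bdd_ge0 ps.
rewrite [leRHS](_ : _ = Num.sqrt 2 * (s * expR k) * nrm g); last by ring.
apply: ip_le_sup; first by rewrite mulr_ge0// expR_ge0.
move=> x; rewrite /= in_itv/= => x1; rewrite (le_trans (ps x x1))//.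
rewrite ler_wpM2l// ler_expR ler_piMr ?(ltW k0)// ler_norml; lra.
Qed.

Lemma exp_coeff_cvg0 (t : R) : (fun M => t ^+ M / M`!%:R) @ \oo --> 0.
Proof. exact: cvg_exp_coeff. Qed.

(** The Taylor series converges uniformly on [-1, 1]. *)
Lemma trig_sum_moment (e : nat -> R) (f : L2 R) (t : R) g : 0 <= t ->
  (forall M y, -1 <= y <= 1 ->
    `|f y - \sum_(j < M) e j * ((t * y) ^+ j / j`!%:R)| <= t ^+ M / M`!%:R * expR t) ->
  trig_sum e t (moment g) @ \oo --> ip f g.
Proof.
move=> t0 h.
have e0 M : `|ip f g - trig_sum e t (moment g) M| <=
    (t ^+ M / M`!%:R) * (expR t * (Num.sqrt 2 * nrm g)).
  pose p := \sum_(j < M) (e j * (t ^+ j / j`!%:R)) *: ('X^j : {poly R}).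
  have -> : trig_sum e t (moment g) M = moment g p.
    rewrite (lin_sum _ _ _ (@moment_lin g)); apply: eq_bigr => j _.
    by rewrite (linZ _ _ (@moment_lin g)).
  rewrite [leRHS](_ : _ = Num.sqrt 2 * (t ^+ M / M`!%:R * expR t) * nrm g); last by ring.
  rewrite -ipBl; apply: ip_le_sup.
    by rewrite mulr_ge0 ?expR_ge0// divr_ge0// exprn_ge0.
  move=> y yI; have y1 : -1 <= y <= 1 by move: yI; rewrite /= in_itv.
    apply: le_trans (h M y y1).
  rewrite L2subE polyLE horner_sum le_eqVlt; apply/orP; left; apply/eqP.
  congr (`| _ - _ |); apply: eq_bigr => j _.
  by rewrite hornerZ hornerXn exprMn; ring.
have c0 : (fun M => (t ^+ M / M`!%:R) * (expR t * (Num.sqrt 2 * nrm g))) @ \oo --> 0.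
  rewrite -(mul0r (expR t * (Num.sqrt 2 * nrm g))).
  by apply: cvgM; [exact: exp_coeff_cvg0|exact: cvg_cst].
apply/cvgrPdist_le => ep ep0.
move/cvgrPdist_le : c0 => /(_ ep ep0); apply: filterS => M /=.
rewrite sub0r normrN => hM; apply: le_trans (e0 M) _.
exact: le_trans (ler_norm _) hM.
Qed.

Lemma cosL_trig_sum t g : 0 <= t -> trig_sum (@ecos R) t (moment g) @ \oo --> ip (cosL t) g.
Proof.
move=> t0; apply: trig_sum_moment => // M y y1; rewrite cosLE.
apply: le_trans (@taylor_remainder R cos _ (t * y) M (@ecos_le1 R) (@cos_series R (t * y))) _.
have ty : `|t * y| <= t by rewrite normrM (ger0_norm t0) ler_piMr// ler_norml.
by rewrite ler_pM ?expR_ge0 ?ler_expR// ?mulr_ge0 ?exprn_ge0// ler_wpM2r// lerXn2r ?nnegrE.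
Qed.
Lemma sinL_trig_sum t g : 0 <= t -> trig_sum (@esin R) t (moment g) @ \oo --> ip (sinL t) g.
Proof.
move=> t0; apply: trig_sum_moment => // M y y1; rewrite sinLE.
apply: le_trans (@taylor_remainder R sin _ (t * y) M (@esin_le1 R) (@sin_series R (t * y))) _.
have ty : `|t * y| <= t by rewrite normrM (ger0_norm t0) ler_piMr// ler_norml.
by rewrite ler_pM ?expR_ge0 ?ler_expR// ?mulr_ge0 ?exprn_ge0// ler_wpM2r// lerXn2r ?nnegrE.
Qed.

End Moments.

Section UpperForm.
Variables (R : realType) (c x2 k : R) (K : nat).
Hypotheses (c0 : 0 < c) (k0 : 0 < k) (x20 : 0 <= x2) (x21 : x2 < 1)
  (ck : c ^+ 2 <= x2 * k ^+ 2) (K0 : (0 < K)%N).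

(** The Chebyshev nodes of order K carried from [-1, 1] to [0, c^2]. *)
Definition alphas : seq R := [seq c ^+ 2 * (1 + cos (node R K i)) / 2 | i <- iota 0 K].

Lemma size_alphas : size alphas = K. Proof. by rewrite size_map size_iota. Qed.

Lemma ok_alphas : okseq k x2 alphas.
Proof.
apply/allP => _ /mapP[i _ ->].
have c1 := cos_le1 (node R K i); have c2 := cos_geN1 (node R K i).
apply/andP; split.
  by rewrite divr_ge0// mulr_ge0 ?sqr_ge0//; lra.
apply: le_trans ck; rewrite -mulrA ler_piMr ?sqr_ge0//; lra.
Qed.

(** With z = 2 t^2 / c^2 - 1 in [-1, 1], the product is a multiple of the K-th
    Chebyshev polynomial at z. Among the choices of K shifts this one makes the
    supremum smallest, and gains 2^(1 - 2K) over [c ^+ K.*2]. *)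
Lemma prod_alphas t : 0 <= t -> t <= c ->
  `|\prod_(a <- alphas) (t ^+ 2 - a)| <= 2 * (c / 2) ^+ K.*2.
Proof.
move=> t0 tc; rewrite big_map -[K in iota 0 K]subn0 -/(index_iota 0 K) big_mkord.
pose z := 2 * t ^+ 2 / c ^+ 2 - 1.
have c20 : 0 < c ^+ 2 by rewrite exprn_gt0.
have z1 : -1 <= z <= 1.
  have : 2 * t ^+ 2 / c ^+ 2 <= 2.
    by rewrite ler_pdivrMr// ler_pM2l// ler_sqr ?nnegrE// ltW.
  have : 0 <= 2 * t ^+ 2 / c ^+ 2 by rewrite divr_ge0// ?mulr_ge0 ?sqr_ge0// ltW.
  by rewrite /z; lra.
have -> : \prod_(i < K) (t ^+ 2 - c ^+ 2 * (1 + cos (node R K i)) / 2) =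
   (c ^+ 2 / 2) ^+ K * \prod_(i < K) (z - cos (node R K i)).
  have -> : (c ^+ 2 / 2) ^+ K = \prod_(i < K) (c ^+ 2 / 2) by rewrite prodr_const card_ord.
  rewrite -big_split; apply: eq_bigr => i _ /=.
  by rewrite /z; field; rewrite gt_eqF.
have := cheb_bound K z1; rewrite cheb_prod// normrM.
have p2 : 0 < 2 ^+ K.-1 :> R by rewrite exprn_gt0.
rewrite (ger0_norm (ltW p2)) mulrC -ler_pdivlMr// mul1r => h.
rewrite normrM ger0_norm ?exprn_ge0 ?divr_ge0 ?sqr_ge0//.
apply: (@le_trans _ _ ((c ^+ 2 / 2) ^+ K / 2 ^+ K.-1)).
  by rewrite ler_wpM2l ?exprn_ge0 ?divr_ge0 ?sqr_ge0.
have -> : (c / 2) ^+ K.*2 = (c ^+ 2 / 2) ^+ K / 2 ^+ K.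
  by rewrite -mul2n exprM -expr_div_n; congr (_ ^+ _); field.
have -> : 2 ^+ K = 2 * 2 ^+ K.-1 :> R by rewrite -exprS prednK.
rewrite le_eqVlt; apply/orP; left; apply/eqP; field.
by rewrite gt_eqF.
Qed.

Variables (g : L2 R) (w : R).
Hypothesis w1 : 1 <= w.
Let n := K.*2.
Let v := (w + w^-1) / 2.

Definition upper_const : R := 2 * (c / 2) ^+ n *
  (Num.sqrt 2 * expR k / (1 - x2) ^+ K * (2 / w ^+ n) * (v ^+ n / n`!%:R * expR (v * c))).

Hypothesis gv : forall m, (m < n)%N -> neumann_iter alphas (moment g) 'X^m = 0.

(** The power [t ^+ n] produced by [trig_sum_lim] cancels the one in the bound of
    [trig_sum_le] for the last Neumann series. What is left of size
    [c ^+ n / n`!] comes with 2^-n from the product over the nodes and with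
    nearly 2^-n from the truncation of the monomials. *)
Lemma trig_upper (e : nat -> R) (f : L2 R) t : 0 < t -> t <= c ->
  (forall j, e j.+2 = - e j) -> (forall j, `|e j| <= 1) ->
  trig_sum e t (moment g) @ \oo --> ip f g ->
  `|ip f g| <= upper_const * nrm g.
Proof.
move=> t0 tc e2 e1 ef.
have [Ll Lb] := neumann_iter_lin_bdd k0 x21 ok_alphas (moment_bdd g k0) (@moment_lin R g).
have Lv (p : {poly R}) : (size p <= (size alphas).*2)%N -> neumann_iter alphas (moment g) p = 0.
  rewrite size_alphas => sp; rewrite -[p]coefK poly_def (lin_sum _ _ _ Ll) big1// => i _.
  by rewrite (linZ _ _ Ll) gv ?mulr0// (leq_trans _ sp).
have cv := trig_sum_cvg k0 e1 (ltW t0) Lb.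
have := trig_sum_lim k0 x21 e2 ok_alphas (moment_bdd g k0) (@moment_lin R g) Lv cv.
rewrite size_alphas -/n => lim1.
have lim2 : (fun M => t ^+ n * trig_sum e t (moment g) M) @ \oo --> t ^+ n * ip f g.
  by apply: cvgM => //; exact: cvg_cst.
set l := limn _ in lim1.
have E : \prod_(a <- alphas) (t ^+ 2 - a) * l = t ^+ n * ip f g.
  exact: (cvg_unique _ lim1 lim2).
have lb : `|l| <= Num.sqrt 2 * expR k * nrm g / (1 - x2) ^+ K * (2 / w ^+ n) *
    ((v * t) ^+ n / n`!%:R * expR (v * t)).
  apply: limit_norm_le cv _ => M.
  have := @trig_sum_le R k k0 e t _ _ n w M e1 (ltW t0) w1 Lb Ll.
  rewrite size_alphas; apply => p sp; apply: Lv; by rewrite size_alphas.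
have tn : 0 < t ^+ n by rewrite exprn_gt0.
rewrite -(ler_pM2l tn) -[t ^+ n in leLHS](ger0_norm (ltW tn)) -normrM -E normrM.
have v0 : 0 <= v by rewrite /v divr_ge0// addr_ge0 ?invr_ge0// (le_trans _ w1).
have x0 : 0 <= (1 - x2) ^+ K by rewrite exprn_ge0// subr_ge0 ltW.
have w0 : 0 <= w ^+ n by rewrite exprn_ge0// (le_trans _ w1).
have H : 0 <= Num.sqrt 2 * expR k * nrm g / (1 - x2) ^+ K * (2 / w ^+ n).
  by rewrite mulr_ge0 ?divr_ge0 ?mulr_ge0 ?sqrtr_ge0 ?expR_ge0 ?nrm_ge0.
apply: (@le_trans _ _ (2 * (c / 2) ^+ n * (Num.sqrt 2 * expR k * nrm g / (1 - x2) ^+ K * (2 / w ^+ n) *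
    ((v * t) ^+ n / n`!%:R * expR (v * c))))).
  apply: ler_pM => //; first exact: prod_alphas (ltW t0) tc.
  apply: le_trans lb _; apply: ler_wpM2l => //; apply: ler_wpM2l.
    by rewrite divr_ge0// exprn_ge0// mulr_ge0// ltW.
  by rewrite ler_expR ler_wpM2l.
rewrite /upper_const (exprMn _ v t) le_eqVlt; apply/orP; left; apply/eqP; ring.
Qed.

Lemma upper_const_ge0 : 0 <= upper_const.
Proof.
have v0 : 0 <= v by rewrite /v divr_ge0// addr_ge0 ?invr_ge0// (le_trans _ w1).
have x0 : 0 <= (1 - x2) ^+ K by rewrite exprn_ge0// subr_ge0 ltW.
have w0 : 0 <= w ^+ n by rewrite exprn_ge0// (le_trans _ w1).
have A1 : 0 <= 2 * (c / 2) ^+ n by rewrite mulr_ge0// exprn_ge0// divr_ge0// ltW.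
have A2 : 0 <= Num.sqrt 2 * expR k / (1 - x2) ^+ K.
  by rewrite divr_ge0// mulr_ge0 ?sqrtr_ge0 ?expR_ge0.
have A3 : 0 <= 2 / w ^+ n by rewrite divr_ge0.
have A4 : 0 <= v ^+ n / n`!%:R * expR (v * c).
  by rewrite mulr_ge0 ?expR_ge0// divr_ge0// exprn_ge0.
exact: mulr_ge0 A1 (mulr_ge0 (mulr_ge0 A2 A3) A4).
Qed.

Lemma form_upper : ip (sincL (ltW c0) g) g <= pi^-1 * (c * (2 * upper_const ^+ 2 * ip g g)).
Proof.
rewrite ipZl ler_pM2l ?piV_gt0//.
have := @window_le R 0 c (lexx 0) (ltW c0) g (2 * upper_const ^+ 2 * ip g g).
rewrite subr0; apply => t t0 tc.
(* For t = 0 the factor [t ^+ n] cannot be cancelled: the cosine is treated by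
   continuity, the sine is 0. *)
have cb : `|ip (cosL t) g| <= upper_const * nrm g.
  move: t0; rewrite le_eqVlt => /predU1P[<-|t0]; last first.
    apply: (trig_upper t0 tc (@ecos2 R) (@ecos_le1 R)); exact: cosL_trig_sum (ltW t0).
  rewrite -subr_le0; apply: (@le0_of_le_small _ (Num.sqrt 2 * nrm g)) => e e0.
  pose t' := Num.min e c; have t'0 : 0 < t' by rewrite lt_min e0 c0.
  have t'c : t' <= c by rewrite ge_min lexx orbT.
  have t'e : t' <= e by rewrite ge_min lexx.
  have := trig_upper t'0 t'c (@ecos2 R) (@ecos_le1 R) (@cosL_trig_sum R t' g (ltW t'0)).
  have : `|ip (cosL 0 - cosL t') g| <= Num.sqrt 2 * e * nrm g.
    apply: ip_le_sup; first exact: ltW.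
    move=> y yI; have y1 : -1 <= y <= 1 by move: yI; rewrite /= in_itv.
    rewrite L2subE !cosLE.
    apply: le_trans (cos_lip _ _) _; rewrite mul0r sub0r normrN normrM.
    rewrite (ger0_norm (ltW t'0)) -[leRHS]mulr1 ler_pM ?(ltW t'0)// ler_norml//.
  rewrite ipBl.
  have := ler_normD (ip (cosL 0) g - ip (cosL t') g) (ip (cosL t') g).
  rewrite subrK; lra.
have sb : `|ip (sinL t) g| <= upper_const * nrm g.
  move: t0; rewrite le_eqVlt => /predU1P[<-|t0]; last first.
    apply: (trig_upper t0 tc (@esin2 R) (@esin_le1 R)); exact: sinL_trig_sum (ltW t0).
  have -> : ip (sinL 0) g = 0.
    rewrite (_ : sinL 0 = 0 *: sinL 0) ?ipZl ?mul0r//.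
    by apply/LfuneqP => y; rewrite L2scaleE !sinLE !mul0r sin0.
  by rewrite normr0 mulr_ge0 ?upper_const_ge0 ?nrm_ge0.
have := sqr_le_of_norm_le cb; have := sqr_le_of_norm_le sb.
rewrite exprMn nrm_sqr; lra.
Qed.
End UpperForm.

Lemma nonzero_kernel_vector (F : fieldType) (m n : nat) (A : 'M[F]_(m, n)) :
  (n < m)%N -> exists2 v : 'rV[F]_m, v != 0 & v *m A = 0.
Proof.
move=> nm; have : kermx A != 0.
  by rewrite kermx_eq0 /row_free neq_ltn (leq_ltn_trans (rank_leq_col A) nm).
by move=> /rowV0Pn[v /sub_kermxP vA v0]; exists v.
Qed.

Section LamUpper.
Variables (R : realType) (c x2 k : R) (K n : nat).
Hypotheses (c0 : 0 < c) (k0 : 0 < k) (x20 : 0 <= x2) (x21 : x2 < 1)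
  (ck : c ^+ 2 <= x2 * k ^+ 2) (K0 : (0 < K)%N) (Kn : (K.*2 <= n)%N).
Variables (w : R) (lam : nat -> R).
Hypothesis w1 : 1 <= w.
Hypothesis lamP : eigenvalues_in_decreasing_order c lam.

(** The form is bounded under [K.*2 <= n] linear conditions, so some nonzero
    combination of the n + 1 first eigenfunctions meets them. *)
Lemma eigenvalue_le : lam n <= pi^-1 * (c * (2 * upper_const c x2 k K w ^+ 2)).
Proof.
have [f [fE f_indep f_span]] := eigenfamily lamP.
pose A := \matrix_(i < n.+1, m < K.*2) neumann_iter (alphas c K) (moment (f i)) 'X^m.
have [|v v0 vA] := @nonzero_kernel_vector _ _ _ A; first by rewrite ltnS.
pose a (i : nat) : R := v 0 (inord i).
pose g : L2 R := \sum_(i < n.+1) v 0 i *: f i.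
have mg : moment g = (fun p => \sum_(i < n.+1) a i * moment (f i) p).
  apply/funext => p; rewrite /moment ip_sumr; apply: eq_bigr => i _.
  by rewrite ipZr /a inord_val.
have gv m : (m < K.*2)%N -> neumann_iter (alphas c K) (moment g) 'X^m = 0.
  move=> mK; rewrite mg.
  have [-> _] := neumann_iter_sum k0 x21 n.+1 a (ok_alphas K ck)
    (fun i => moment_bdd (f i) k0).
  have := congr1 (fun M : 'rV_(K.*2) => M 0 (Ordinal mK)) vA.
  rewrite !mxE => e; rewrite -[RHS]e; apply: eq_bigr => i _.
  by rewrite mxE /a inord_val.
have [g0 lg] : 0 < ip g g /\ lam n * ip g g <= ip (sincL (ltW c0) g) g.
  apply: (span_form_ge (ltW c0) lamP fE f_indep (a := fun i => v 0 i)).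
  by move/rV0Pn : v0.
have := le_trans lg (form_upper c0 k0 x21 ck K0 w1 gv).
by rewrite !mulrA ler_pM2r// !mulrA.
Qed.
End LamUpper.

(** * Growth estimates *)

Section Growth.
Variable R : realType.

Lemma exp_ge_term (T : R) d : 0 <= T -> T ^+ d / d`!%:R <= expR T.
Proof.
move=> T0; apply: le_trans (exp_partial_le d.+1 T0).
rewrite big_ord_recr/= lerDr; apply: sumr_ge0 => i _.
by rewrite divr_ge0// exprn_ge0.
Qed.

Lemma poly_le_exp (A l : R) d : 0 < l ->
  exists M : R, forall n : nat, M <= n%:R -> A * n%:R ^+ d <= expR (l * n%:R).
Proof.
move=> l0; exists (`|A| * d.+1`!%:R / l ^+ d.+1) => n nM.
have n0 : 0 <= n%:R :> R by [].
apply: le_trans (exp_ge_term d.+1 (mulr_ge0 (ltW l0) n0)).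
have l1 : 0 < l ^+ d.+1 by rewrite exprn_gt0.
have f0 : 0 < d.+1`!%:R :> R by rewrite ltr0n fact_gt0.
move: nM; rewrite ler_pdivrMr// => nM.
rewrite ler_pdivlMr// exprMn (exprS n%:R) [leRHS](_ : _ = n%:R ^+ d * (n%:R * l ^+ d.+1)); last by ring.
rewrite (_ : _ * _ * _ = n%:R ^+ d * (A * d.+1`!%:R)); last by ring.
rewrite ler_wpM2l ?exprn_ge0//; apply: le_trans nM.
by rewrite ler_wpM2r// ler_norm.
Qed.

Lemma stirling_ge (n : nat) : (n%:R / expR 1) ^+ n <= n`!%:R :> R.
Proof.
have f0 : 0 < n`!%:R :> R by rewrite ltr0n fact_gt0.
have := @exp_ge_term n%:R n (ler0n _ _).
rewrite ler_pdivrMr// => h.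
rewrite expr_div_n ler_pdivrMr ?exprn_gt0 ?expR_gt0// -expRM_natl mulr1 mulrC//.
Qed.

Lemma exp_ln_pow (z : R) n : 0 < z -> expR (- (2 * n%:R * ln z)) = (z^-1) ^+ n.*2.
Proof.
move=> z0; rewrite expRN -natrM mul2n expRM_natl lnK ?posrE// exprVn//.
Qed.

End Growth.

(** * Decay of the eigenvalues from above *)

Section UpperNumerics.
Variable R : realType.

(** With [K = n./2] the degree [K.*2] is n or n - 1; the second case costs a
    factor [4 * n]. *)
Lemma half_power_le (E : R) (n N : nat) : 0 < E -> (N = n \/ N.+1 = n) -> (0 < n)%N ->
  1 <= 4 * E ->
  E ^+ N / N`!%:R <= 4 * n%:R * (E ^+ n / n`!%:R).
Proof.
move=> E0 [->|<-] n0 E1.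
  rewrite ler_peMl ?divr_ge0 ?exprn_ge0 ?(ltW E0)//.
  have : 1 <= n%:R :> R by rewrite ler1n.
  lra.
have f0 : N`!%:R != 0 :> R by rewrite pnatr_eq0 -lt0n fact_gt0.
rewrite exprS factS natrM [leRHS](_ : _ = (4 * E) * (E ^+ N / N`!%:R)); last first.
  field. rewrite f0 nat1r pnatr_eq0//.
by rewrite ler_peMl// divr_ge0 ?exprn_ge0 ?(ltW E0).
Qed.

Lemma upper_constE (c x2 k w : R) K : 1 <= w ->
  upper_const c x2 k K w = 4 * Num.sqrt 2 * expR (k + (w + w^-1) / 2 * c) / (1 - x2) ^+ K
     * ((c * (1 + w^-1 ^+ 2) / 4) ^+ K.*2 / (K.*2)`!%:R).
Proof.
move=> w1; have w0 : w != 0 by rewrite gt_eqF// (lt_le_trans ltr01).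
rewrite /upper_const expRD; set n := K.*2.
have -> : (c * (1 + w^-1 ^+ 2) / 4) ^+ n = (c / 2) ^+ n * ((w + w^-1) / 2) ^+ n / w ^+ n.
  rewrite -exprMn -expr_div_n; congr (_ ^+ _); field. by rewrite w0.
ring.
Qed.

(** There are two exponential losses: [(1 + w^-1 ^+ 2) ^+ n.*2] from the
    truncation of the monomials, and [(1 - x2)^-1 ^+ n] from the Neumann series.
    The number [q^-1 ^+ n] bounds both together. *)
Lemma eigenvalue_le_pointwise (c x2 w q x : R) n (lam : nat -> R) :
  1 <= c -> c <= n%:R -> 0 < x -> x ^+ 2 = x2 -> x2 < 1 -> 1 <= w -> 0 < q ->
  (1 + w^-1 ^+ 2) ^+ 2 * q <= 1 - x2 -> (1 < n)%N ->
  eigenvalues_in_decreasing_order c lam ->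
  lam n <= 1024 * n%:R ^+ 3 * expR (2 * (x^-1 + (w + w^-1) / 2) * c)
     * q^-1 ^+ n * (c * expR 1 / (4 * n%:R)) ^+ n.*2.
Proof.
move=> c1 cn x0 xx x21 w1 q0 yq n1 lamP.
have c0 : 0 < c by exact: lt_le_trans c1.
have k0 : 0 < c / x by rewrite divr_gt0.
have n0 : 0 < n%:R :> R by exact: lt_le_trans cn.
pose K := n./2.
have K0 : (0 < K)%N by rewrite half_gt0.
have Kn : (K.*2 <= n)%N by rewrite -[leqRHS]odd_double_half leq_addl.
have Kn' : K.*2 = n \/ K.*2.+1 = n.
  by have := odd_double_half n; case: odd => /= <-; [right|left].
have ck : c ^+ 2 <= x2 * (c / x) ^+ 2.
  by rewrite -xx expr_div_n mulrC divfK// expf_neq0// gt_eqF.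
have x20 : 0 <= x2 by rewrite -xx sqr_ge0.
apply: le_trans (eigenvalue_le c0 k0 x21 ck K0 Kn w1 lamP) _.
rewrite upper_constE//.
set v := (w + w^-1) / 2; set y := 1 + w^-1 ^+ 2 in yq *; set E := c * y / 4.
have y1 : 1 <= y by rewrite lerDl sqr_ge0.
have y0 : 0 < y by exact: lt_le_trans y1.
have E0 : 0 < E by rewrite divr_gt0// mulr_gt0.
have E1 : 1 <= 4 * E by rewrite /E mulrC divfK// -[1]mulr1 ler_pM.
have hE := half_power_le E0 Kn' (ltnW n1) E1.
have fn0 : 0 < n`!%:R :> R by rewrite ltr0n fact_gt0.
have hF : E ^+ n / n`!%:R <= (E * expR 1 / n%:R) ^+ n.
  rewrite ler_pdivrMr// -[leLHS]mulr1.
  have := ler_wpM2l (exprn_ge0 n (divr_ge0 (mulr_ge0 (ltW E0) (expR_ge0 1)) (ltW n0))) (stirling_ge R n).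
  apply: le_trans; rewrite -exprMn mulr1 le_eqVlt; apply/orP; left; apply/eqP; congr (_ ^+ _).
  by field; rewrite ?gt_eqF ?expR_gt0.
set s := 1 - x2 in yq *.
have s0 : 0 < s by rewrite subr_gt0.
have s1 : s <= 1 by rewrite /s; lra.
set G := 4 * Num.sqrt 2 * expR (c / x + v * c) / s ^+ K.
have G0 : 0 <= G by rewrite divr_ge0 ?exprn_ge0 ?(ltW s0)// !mulr_ge0 ?sqrtr_ge0 ?expR_ge0.
have G2 : G ^+ 2 <= 32 * expR (2 * (x^-1 + v) * c) * s^-1 ^+ n.
  have s2 := @sqr_sqrtr R 2 (ler0n _ _).
  have ee : expR (2 * (x^-1 + v) * c) = expR (c / x + v * c) ^+ 2.
    by rewrite -expRM_natl; congr expR; ring.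
  rewrite [leLHS](_ : _ = 32 * expR (2 * (x^-1 + v) * c) * (s^-1 ^+ K.*2)); last first.
    rewrite ee /G expr_div_n !exprMn s2 -exprM muln2 exprVn; ring.
  rewrite ler_wpM2l ?mulr_ge0 ?expR_ge0// ler_weXn2l// invf_ge1//.
have U2 : (G * (E ^+ K.*2 / (K.*2)`!%:R)) ^+ 2 <=
  32 * expR (2 * (x^-1 + v) * c) * s^-1 ^+ n * (16 * n%:R ^+ 2 * (E * expR 1 / n%:R) ^+ n.*2).
  rewrite exprMn; apply: ler_pM; rewrite ?sqr_ge0//.
  have h0 : 0 <= E ^+ K.*2 / (K.*2)`!%:R by rewrite divr_ge0 ?exprn_ge0 ?(ltW E0).
  have h1 : E ^+ K.*2 / (K.*2)`!%:R <= 4 * n%:R * (E * expR 1 / n%:R) ^+ n.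
    by apply: (le_trans hE); rewrite ler_pM2l// mulr_gt0.
  rewrite [leRHS](_ : _ = (4 * n%:R * (E * expR 1 / n%:R) ^+ n) ^+ 2).
    by rewrite lerXn2r// nnegrE// (le_trans h0).
  by rewrite -muln2 exprM; ring.
have pi1 : pi^-1 <= 1 :> R by rewrite invf_le1 ?pi_gt0// (le_trans _ (pi_ge2 R))// ler1n.
apply: (@le_trans _ _ (1 * (n%:R * (2 * (32 * expR (2 * (x^-1 + v) * c) * s^-1 ^+ n *
   (16 * n%:R ^+ 2 * (E * expR 1 / n%:R) ^+ n.*2)))))).
  apply: ler_pM => //; first by rewrite invr_ge0 pi_ge0.
    by rewrite mulr_ge0 ?(ltW c0)// mulr_ge0// sqr_ge0.
  apply: ler_pM => //; first exact: ltW.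
    by rewrite mulr_ge0// sqr_ge0.
  by rewrite ler_pM2l.
have -> : (E * expR 1 / n%:R) ^+ n.*2 = (y ^+ 2) ^+ n * (c * expR 1 / (4 * n%:R)) ^+ n.*2.
  rewrite -exprM mul2n -exprMn; congr (_ ^+ _); rewrite /E; field.
  by rewrite gt_eqF.
rewrite [leLHS](_ : _ = 1024 * n%:R ^+ 3 * expR (2 * (x^-1 + v) * c) *
   (s^-1 * y ^+ 2) ^+ n * (c * expR 1 / (4 * n%:R)) ^+ n.*2); last by rewrite (exprMn n s^-1 (y ^+ 2)); move: (s^-1 ^+ n) ((y ^+ 2) ^+ n) => u1 u2; ring.
rewrite ler_wpM2r ?exprn_ge0 ?divr_ge0 ?mulr_ge0 ?expR_ge0 ?(ltW c0)//.
apply: ler_wpM2l; first exact: (mulr_ge0 (mulr_ge0 (ler0n _ _) (exprn_ge0 _ (ler0n _ _))) (expR_ge0 _)).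
apply: lerXn2r; rewrite ?nnegrE ?mulr_ge0 ?invr_ge0 ?(ltW y0) ?(ltW s0) ?(ltW q0)//.
by rewrite mulrC ler_pdivrMr// mulrC ler_pdivlMr// mulrC.
Qed.

(** Put q = a e / 4 < 1. The decay aimed at is [q^-1 ^+ n.*2] times that of
    [eigenvalue_le_pointwise] without losses. The parameters w and x are chosen
    so that the exponential losses are at most [q^-1 ^+ n]. The second factor
    [q^-1 ^+ n] absorbs the power of n and, for n / c large, the exponential
    in c. *)
Lemma eigenvalue_decay_upper (a : R) : 0 < a -> a < 4 / expR 1 ->
  exists M : R, forall c : R, 1 <= c ->
    forall lam : nat -> R, eigenvalues_in_decreasing_order c lam ->
    forall n : nat, c * M <= n%:R ->
      lam n <= expR (- (2 * n%:R * ln (a * n%:R / c))).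
Proof.
move=> a0 a4; have e0 := expR_gt0 (1 : R).
pose q := a * expR 1 / 4.
have q0 : 0 < q by rewrite divr_gt0// mulr_gt0.
have q1 : q < 1 by rewrite ltr_pdivrMr// mul1r -ltr_pdivlMr.
(* Makes w^-1 = (1 - q) / (1 + 5 q), small enough for (1 + w^-2)^2 q <= (1 + q) / 2. *)
pose w := 6 * q / (1 - q) + 1.
have w1 : 1 <= w.
  by rewrite lerDr; apply: divr_ge0; [rewrite mulr_ge0// ltW|rewrite subr_ge0 ltW].
pose s := (1 + q) / 2.
pose x := Num.sqrt (1 - s).
have s1 : s < 1 by rewrite /s; lra.
have x0 : 0 < x by rewrite sqrtr_gt0 subr_gt0.
have xx : x ^+ 2 = 1 - s by rewrite sqr_sqrtr// subr_ge0 ltW.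
pose D := 2 * (x^-1 + (w + w^-1) / 2).
pose l := - ln q.
have l0 : 0 < l by rewrite oppr_gt0 ln_lt0// q0.
have [M0 HM0] := @poly_le_exp R 1024 (l / 2) 3 (divr_gt0 l0 (ltr0n _ 2)).
exists (Num.max 2 (Num.max M0 (2 * D / l))) => c c1 lam lamP n.
set M := Num.max _ _ => cMn.
have c0 : 0 < c by exact: lt_le_trans c1.
have M2 : 2 <= M by rewrite le_max lexx.
have MM : M0 <= M by rewrite !le_max lexx orbT.
have MD : 2 * D / l <= M by rewrite !le_max lexx !orbT.
have Mn : M <= n%:R by apply: le_trans cMn; rewrite ler_peMl//; lra.
have cn : c <= n%:R by apply: le_trans cMn; rewrite ler_peMr//; lra.
have n1 : (1 < n)%N by rewrite -(ltr_nat R); lra.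
have n0 : 0 < n%:R :> R by lra.
have yq : (1 + w^-1 ^+ 2) ^+ 2 * q <= 1 - (1 - s).
  have w0 : 0 < w by exact: lt_le_trans w1.
  have wi : w^-1 = (1 - q) / (1 + 5 * q).
    by rewrite /w; field; rewrite ?gt_eqF//; lra.
  have wi1 : w^-1 <= 1 by rewrite invf_le1.
  have wi0 : 0 <= w^-1 by rewrite invr_ge0 ltW.
  have u1 : w^-1 ^+ 2 <= w^-1 by rewrite expr2 ler_piMr.
  have u0 : 0 <= w^-1 ^+ 2 by exact: sqr_ge0.
  have y2 : (1 + w^-1 ^+ 2) ^+ 2 <= 1 + 3 * w^-1.
    have : (w^-1 ^+ 2) ^+ 2 <= w^-1 ^+ 2 by rewrite expr2 ler_piMr// (le_trans u1).
    rewrite sqrrD expr1n mul1r -mulr_natl; lra.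
  have h : 3 * q * w^-1 <= (1 - q) / 2.
    have d0 : 0 < 1 + 5 * q by lra.
    rewrite wi mulrA ler_pdivrMr//.
    have : 0 <= (1 - q) * (1 - q) by rewrite -expr2 sqr_ge0.
    lra.
  have : (1 + w^-1 ^+ 2) ^+ 2 * q <= (1 + 3 * w^-1) * q by rewrite ler_pM2r.
  rewrite /s; lra.
have s1' : 1 - s < 1 by rewrite /s; lra.
apply: le_trans (eigenvalue_le_pointwise c1 cn x0 xx s1' w1 q0 yq n1 lamP) _.
have z0 : 0 < a * n%:R / c by rewrite divr_gt0// mulr_gt0.
rewrite exp_ln_pow// -/D.
have -> : ((a * n%:R / c)^-1) ^+ n.*2 = (q^-1 ^+ 2) ^+ n * (c * expR 1 / (4 * n%:R)) ^+ n.*2.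
  rewrite -exprM mul2n -exprMn; congr (_ ^+ _); rewrite /q; field.
  by rewrite !gt_eqF.
rewrite ler_wpM2r ?exprn_ge0 ?divr_ge0 ?mulr_ge0 ?expR_ge0 ?(ltW c0)//.
rewrite expr2 exprMn ler_wpM2r ?exprn_ge0 ?invr_ge0 ?(ltW q0)//.
have -> : q^-1 ^+ n = expR (l / 2 * n%:R) * expR (l / 2 * n%:R).
  rewrite -expRD -mulrDl -splitr mulrC expRM_natl; congr (_ ^+ _).
  by rewrite /l expRN lnK.
apply: ler_pM.
- exact: (mulr_ge0 (ler0n _ _) (exprn_ge0 _ (ler0n _ _))).
- exact: expR_ge0.
- by apply: HM0; exact: le_trans Mn.
rewrite ler_expR.
have : c * (2 * D / l) <= n%:R by apply: le_trans cMn; rewrite ler_pM2l.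
rewrite mulrA ler_pdivrMr//; lra.
Qed.
End UpperNumerics.

(** * Fourier coefficients integrated over a window *)

Lemma sqr_sum_le (R : realFieldType) N (F : 'I_N -> R) :
  (\sum_(i < N) F i) ^+ 2 <= N%:R * \sum_(i < N) F i ^+ 2.
Proof.
rewrite expr2 mulr_suml.
apply: (@le_trans _ _ (\sum_(i < N) \sum_(j < N) (F i ^+ 2 + F j ^+ 2) / 2)).
  apply: ler_sum => i _; rewrite mulr_sumr; apply: ler_sum => j _.
  by have := sqr_ge0 (F i - F j); rewrite sqrrB -mulr_natr; lra.
under eq_bigr do rewrite -mulr_suml big_split/= sumr_const card_ord.
rewrite -mulr_suml big_split/= sumr_const card_ord sumrMnl -[X in X + _]mulr_natl.
by rewrite mulr_natl -mulr2n -[X in X / 2]mulr_natl mulrC mulKf ?pnatr_eq0// mulr_natl.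
Qed.

Section WindowEvaluation.
Variable R : realType.
Implicit Types (g : L2 R).

Section Window.
Variable t : R.
Hypothesis t0 : 0 <= t.

Lemma kc_cont0 : continuous (kc 0 t : R -> R).
Proof. exact: lip_cont (kc_lip (lexx 0) t0). Qed.
Lemma ks_cont0 : continuous (ks 0 t : R -> R).
Proof. exact: lip_cont (ks_lip (lexx 0) t0). Qed.
(** The function sin (t y) / y, whose inner product with g is the integral of the cosine
    coefficients of g over the frequencies in [0, t]. *)
Definition kc0 : L2 R := cL2 kc_cont0.
Definition ks0 : L2 R := cL2 ks_cont0.

(* Cauchy-Schwarz over the frequencies in [0, t], on Riemann sums. *)
Let eval_sqr_le (f df : R -> R) (F : L2 R) (D : R -> L2 R) g :
  (forall x : R, is_derive x (1 : R) f (df x)) -> (forall a b, `|df b - df a| <= `|b - a|) ->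
  (forall y, F y = dquot f df 0 t y) -> (forall x y, D x y = df (x * y)) ->
  (forall x y, `|D x y| <= 1) ->
  (forall N, t / N%:R * \sum_(i < N) ip (D (grid 0 t N i)) g ^+ 2 <= trigform 0 t N g g) ->
  ip F g ^+ 2 <= t * ip (windowL (lexx 0) t0 g) g.
Proof.
move=> fd dfl FE DE D1 Dt.
pose n := nrm g; have n0 : 0 <= n by exact: nrm_ge0.
have s20 : 0 <= Num.sqrt 2 :> R by exact: sqrtr_ge0.
apply: (@limit_le _ _ _ (t * (4 * t ^+ 2 * n * n) + 2 * (Num.sqrt 2 * t * n) * (Num.sqrt 2 * t ^+ 2 * n)
  + (Num.sqrt 2 * t ^+ 2 * n) ^+ 2)) => N N0.
have NN : 0 < N%:R :> R by rewrite ltr0n.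
have NN1 : 1 <= N%:R :> R by rewrite ler1n.
pose h := t / N%:R; have h0 : 0 <= h by rewrite divr_ge0.
pose s := h * \sum_(i < N) ip (D (grid 0 t N i)) g.
have e1 : `|ip F g - s| <= Num.sqrt 2 * (t ^+ 2 / N%:R) * n.
  have -> : s = ip (h *: \sum_(i < N) D (grid 0 t N i)) g by rewrite ipZl ip_suml.
  rewrite -ipBl; apply: ip_le_sup; first by rewrite divr_ge0// sqr_ge0.
  move=> y yI; have y1 : -1 <= y <= 1 by move: yI; rewrite /= in_itv.
  rewrite L2subE L2scaleE L2sumE FE; under eq_bigr do rewrite DE.
  have := @dquot_riemann _ f df fd dfl 0 t N y N0; rewrite subr0 => /le_trans; apply.
  by rewrite ler_piMr ?divr_ge0 ?sqr_ge0// ler_norml.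
have s1 : `|s| <= Num.sqrt 2 * t * n.
  rewrite normrM (ger0_norm h0).
  rewrite [leRHS](_ : _ = h * (N%:R * (Num.sqrt 2 * 1 * n))); last first.
    by rewrite /h; field; rewrite gt_eqF.
  rewrite ler_wpM2l// (le_trans (ler_norm_sum _ _ _))//.
  by apply: sum_le_const => i; apply: ip_le_sup => // y _; exact: D1.
have s2 : s ^+ 2 <= t * trigform 0 t N g g.
  apply: le_trans (ler_wpM2l t0 (Dt N)); rewrite exprMn.
  rewrite [leRHS](_ : _ = h ^+ 2 * (N%:R * \sum_(i < N) ip (D (grid 0 t N i)) g ^+ 2)); last first.
    by rewrite /h; field; rewrite gt_eqF.
  by rewrite ler_wpM2l ?sqr_ge0// sqr_sum_le.
have := window_approx (lexx 0) t0 g g N0; rewrite subr0 -/n ler_norml => /andP[w1 _].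
set Y := ip F g in e1 *; set A := ip _ g in w1 *; set tf := trigform _ _ _ _ _ in s2 w1 *.
set r := Num.sqrt 2 * t ^+ 2 * n.
have r0 : 0 <= r by rewrite !mulr_ge0 ?sqr_ge0.
have e1' : `|Y - s| <= r / N%:R by rewrite (le_trans e1)// /r le_eqVlt; apply/orP; left; apply/eqP; ring.
have Y2 : Y ^+ 2 <= s ^+ 2 + 2 * `|s| * `|Y - s| + `|Y - s| ^+ 2.
  rewrite real_normK ?num_real//.
  have := ler_norm (s * (Y - s)); rewrite normrM.
  have -> : Y ^+ 2 = s ^+ 2 + 2 * (s * (Y - s)) + (Y - s) ^+ 2.
    by move: s Y {e1 e1' s1 s2}; clear => s Y; ring.
  rewrite -[2 * _ * _]mulrA => hm.
  by rewrite lerD2r lerD2l ler_pM2l.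
have h1 : `|s| * `|Y - s| <= Num.sqrt 2 * t * n * (r / N%:R) by rewrite ler_pM.
have h2 : `|Y - s| ^+ 2 <= r ^+ 2 / N%:R.
  apply: (@le_trans _ _ ((r / N%:R) ^+ 2)).
    by rewrite lerXn2r ?nnegrE// divr_ge0// ltW.
  rewrite expr_div_n ler_wpM2l ?sqr_ge0// lef_pV2 ?posrE ?exprn_gt0//.
  by rewrite expr2 ler_peMl// ltW.
have h3 : t * tf <= t * (A + 4 * t ^+ 2 * n * n / N%:R).
  by rewrite ler_wpM2l// -lerBlDl -lerN2 opprB.
rewrite [leRHS](_ : _ = t * (A + 4 * t ^+ 2 * n * n / N%:R)
  + 2 * (Num.sqrt 2 * t * n * (r / N%:R)) + r ^+ 2 / N%:R); last by ring.
apply: le_trans Y2 _; rewrite -mulrA lerD// lerD ?ler_pM2l//.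
exact: le_trans h3.
Qed.

Lemma kc0_sqr_le g : ip kc0 g ^+ 2 <= t * ip (windowL (lexx 0) t0 g) g.
Proof.
apply: (eval_sqr_le (@is_derive_sin R) (@cos_lip R) (D := fun x => cosL x)) => //.
  by move=> x y; rewrite cosLE cos_max.
move=> N; rewrite /trigform subr0 ler_wpM2l ?divr_ge0//; apply: ler_sum => i _.
by rewrite -!expr2 lerDl sqr_ge0.
Qed.
Lemma ks0_sqr_le g : ip ks0 g ^+ 2 <= t * ip (windowL (lexx 0) t0 g) g.
Proof.
apply: (eval_sqr_le (@is_derive_Ncos R) (@sin_lip R) (D := fun x => sinL x)) => //.
  by move=> x y; rewrite sinLE sin_max.
move=> N; rewrite /trigform subr0 ler_wpM2l ?divr_ge0//; apply: ler_sum => i _.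
by rewrite -!expr2 lerDr sqr_ge0.
Qed.
End Window.

(** The frequencies in [t, c] contribute a nonnegative form. *)
Lemma window_mono t c (t0 : 0 <= t) (c0 : 0 <= c) g : t <= c ->
  ip (windowL (lexx 0) t0 g) g <= ip (windowL (lexx 0) c0 g) g.
Proof.
move=> tc.
have -> : windowL (lexx 0) c0 g = windowL (lexx 0) t0 g + windowL t0 tc g.
  apply/LfuneqP => x; rewrite L2addE !windowLE -ipDl; congr (ip _ g).
  apply/LfuneqP => y; rewrite L2addE.
  rewrite -[kcL (lexx 0) c0 x y]/(kc 0 c (x - y)) -[kcL (lexx 0) t0 x y]/(kc 0 t (x - y)).
  rewrite -[kcL t0 tc x y]/(kc t c (x - y)) /kc /dquot.
  case: eqP => _; first by ring.
  by rewrite -mulrDl; congr (_ / _); ring.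
by rewrite ipDl lerDl window_ge0.
Qed.
End WindowEvaluation.

(** * Polynomials controlled by their norm *)

Section PrimitiveBound.
Variable R : realType.
Implicit Types (p : {poly R}).
Notation leb := (@lebesgue_measure R).
Notation mu := (leb11 R).
Local Notation I11 := (`[-1, 1]%classic%R : set R).
Local Notation T := (measurableTypeR R).

Lemma one_cont : continuous (fun _ : R => 1 : R).
Proof. by move=> x; exact: cvg_cst. Qed.
Definition oneL : L2 R := cL2 one_cont.

Lemma abs_poly_cont p : continuous (fun x : R => `|p.[x]|).
Proof.
move=> x; apply: (@continuous_comp _ _ _ (fun x => p.[x]) (fun y => `|y|)).
  exact: poly_cont.
exact: norm_continuous.
Qed.

(** The increment is the integral of p over [a, b], to which Cauchy-Schwarz
    applies; the total mass of [-1, 1] is 2. *)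
Lemma prim_increment_le p a b : -1 <= a -> a < b -> b <= 1 ->
  `|(prim p).[b] - (prim p).[a]| <= Num.sqrt 2 * nrm (polyL p).
Proof.
move=> a1 ab b1.
pose absL : L2 R := cL2 (@abs_poly_cont p).
have ftc : (\int[leb]_(x in `[a, b]) (p.[x])%:E = ((prim p).[b])%:E - ((prim p).[a])%:E)%E.
  apply: (@continuous_FTC2 _ (fun x => p.[x]) (fun x => (prim p).[x])) => //.
  - apply: continuous_subspaceT; exact: poly_cont.
  - split.
    + by move=> x _; have [] := is_derive_poly (prim p) x.
    + by apply: cvg_at_right_filter; exact: poly_cont.
    + by apply: cvg_at_left_filter; exact: poly_cont.
  - move=> x _; rewrite derive1E; have [_ ->] := is_derive_poly (prim p) x.
    by rewrite prim_deriv.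
have mI : measurable (`[a, b]%classic : set T) by exact: measurable_itv.
have mp : measurable_fun [set: T] (fun x : T => (p.[x])%:E).
  by apply/measurable_EFinP; apply: continuous_measurable_fun; exact: poly_cont.
have map : measurable_fun [set: T] (fun x : T => (`|p.[x]|)%:E).
  by apply/measurable_EFinP; apply: continuous_measurable_fun; exact: abs_poly_cont.
have h1 : (`|((prim p).[b])%:E - ((prim p).[a])%:E| <= \int[leb]_(x in `[a, b]) `|p.[x]|%:E)%E.
  by rewrite -ftc; apply: le_abse_integral => //; exact: measurable_funS mp.
have h2 : (\int[leb]_(x in `[a, b]) `|p.[x]|%:E <= \int[leb]_(x in I11) `|p.[x]|%:E)%E.
  have mII := @measurable_I11 R.
  have map' : measurable_fun (I11 : set T) (fun x : T => (`|p.[x]|)%:E).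
    exact: measurable_funS map.
  have sub : (`[a, b]%classic : set T) `<=` I11.
    by move=> x; rewrite /= !in_itv/= => /andP[? ?]; apply/andP; split; lra.
  have nn x : (I11 : set T) x -> (0 <= `|p.[x]|%:E)%E by rewrite lee_fin.
  have := @ge0_subset_integral _ T R leb _ _ mI mII _ map' nn sub.
  exact.
have h3 : (\int[leb]_(x in I11) `|p.[x]|%:E = (ip absL oneL)%:E)%E.
  rewrite -integral_leb11// /ip /Rintegral fineK; last exact: integrable_fin_num (ip_int _ _).
  by apply: eq_integral => x _; rewrite -[oneL x]/1 mulr1.
have h4 : nrm absL = nrm (polyL p).
  rewrite /nrm /fnorm; congr Num.sqrt; apply: eq_Rintegral => x _.
  by rewrite -[absL x]/(`|p.[x]|) polyLE -!expr2 real_normK ?num_real.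
have h5 : `|(prim p).[b] - (prim p).[a]| <= ip absL oneL.
  by rewrite -lee_fin; apply: le_trans h1 _; rewrite -h3.
rewrite (le_trans h5)//.
rewrite (le_trans (ler_norm _))// (le_trans (ip_le_nrm _ _))// h4 mulrC ler_wpM2r ?nrm_ge0//.
rewrite -[leRHS]mulr1; apply: nrm_le_sup => // x _.
by rewrite -[oneL x]/1 normr1.
Qed.

Lemma prim_sup_le p x : -1 <= x <= 1 -> `|(prim p).[x]| <= Num.sqrt 2 * nrm (polyL p).
Proof.
move=> /andP[x1 x2]; have [x0|x0|->] := ltgtP x 0.
- have := @prim_increment_le p x 0 x1 x0 ler01.
  by rewrite prim0 sub0r normrN.
- have := @prim_increment_le p 0 x _ x0 x2; rewrite prim0 subr0; apply; lra.
- by rewrite prim0 normr0 mulr_ge0 ?sqrtr_ge0 ?nrm_ge0.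
Qed.

End PrimitiveBound.

(** * Power series of the integrated Fourier coefficients *)

Section QuotientTaylor.
Variable R : realType.
Implicit Types (x y t : R).

(** Division by y of the Taylor expansion of f at t * y, where [E] lists the
    derivatives of f at 0 and [e] those of [df]. *)
Lemma dquot_taylor (f df : R -> R) (E e : nat -> R) t y M :
  (forall j, `|E j| <= 1) -> (forall j, E j.+1 = e j) -> df 0 = e 0 ->
  (forall x, series (fun j => E j * (x ^+ j / j`!%:R)) @ \oo --> f x) ->
  0 <= t -> -1 <= y <= 1 -> (0 < M)%N ->
  `|dquot f df 0 t y - \sum_(j < M) e j * (t ^+ j.+1 / (j.+1)`!%:R) * y ^+ j|
     <= t ^+ M.+1 / (M.+1)`!%:R * expR t.
Proof.
move=> E1 Ee df0 fs t0 y1 M0.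
rewrite /dquot; have [->|y0] := eqVneq y 0.
  case: M M0 => // M _; rewrite big_ord_recl/= big1 => [|j _]; last first.
    by rewrite expr0n/= mulr0.
  rewrite df0 subr0 addr0 expr0 mulr1 expr1 invr1 mulr1 subrr normr0.
  by rewrite mulr_ge0 ?expR_ge0// divr_ge0// exprn_ge0.
have f0 : f 0 = E 0.
  have := @taylor_remainder R f E 0 1 E1 (fs 0).
  rewrite big_ord1 expr0 invr1 !mulr1 normr0 expr1 !mul0r normr_le0 subr_eq0.
  by move/eqP.
have := @taylor_remainder R f E (t * y) M.+1 E1 (fs (t * y)).
rewrite big_ord_recl/= expr0 invr1 !mulr1 => h.
rewrite mul0r f0 (_ : _ - _ = (f (t * y) - (E 0 + \sum_(i < M) E (bump 0 i) *
   ((t * y) ^+ bump 0 i / (bump 0 i)`!%:R))) / y); last first.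
  rewrite opprD addrA [RHS]mulrBl; congr (_ - _); rewrite mulr_suml; apply: eq_bigr => j _.
  by rewrite /bump add1n Ee exprMn (exprSr y); field; rewrite y0 pnatr_eq0 -lt0n fact_gt0.
rewrite normrM normfV ler_pdivrMr ?normr_gt0// (le_trans h)//.
have ay : `|y| <= 1 by rewrite ler_norml.
have ty : `|t * y| <= t by rewrite normrM (ger0_norm t0) ler_piMr.
rewrite [in leLHS]normrM (ger0_norm t0) exprMn (exprS `|y|) [leLHS](_ : _ =
  (t ^+ M.+1 / M.+1`!%:R) * (`|y| ^+ M * expR (t * `|y|)) * `|y|); last by ring.
rewrite ler_wpM2r// ler_wpM2l ?divr_ge0 ?exprn_ge0//.
rewrite -[leRHS]mul1r ler_pM ?expR_ge0 ?exprn_ge0 ?exprn_ile1//.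
by rewrite ler_expR ler_piMr.
Qed.

Lemma kc_taylor t y M : 0 <= t -> -1 <= y <= 1 -> (0 < M)%N ->
  `|kc 0 t y - \sum_(j < M) ecos R j * (t ^+ j.+1 / (j.+1)`!%:R) * y ^+ j|
     <= t ^+ M.+1 / (M.+1)`!%:R * expR t.
Proof.
apply: (@dquot_taylor _ _ (esin R)) => //.
- exact: esin_le1.
- by rewrite cos0 /ecos mulr1.
- by move=> x; exact: sin_series.
Qed.
Lemma ks_taylor t y M : 0 <= t -> -1 <= y <= 1 -> (0 < M)%N ->
  `|ks 0 t y - \sum_(j < M) esin R j * (t ^+ j.+1 / (j.+1)`!%:R) * y ^+ j|
     <= t ^+ M.+1 / (M.+1)`!%:R * expR t.
Proof.
apply: (@dquot_taylor _ _ (fun j => - ecos R j)) => //.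
- by move=> j; rewrite normrN ecos_le1.
- by move=> j; rewrite ecosS opprK.
- by rewrite sin0 /esin mul0r.
- move=> x; rewrite (_ : series _ = (fun n =>
      - series (fun j => ecos R j * (x ^+ j / j`!%:R)) n)).
    exact: (cvgN (@cos_series R x)).
  apply/funext => n; rewrite /series/= -sumrN.
  by apply: eq_bigr => j _; rewrite mulNr.
Qed.

(** In the variable x = t / c the sum is a polynomial of degree n + 1. The
    parity of [e], recorded by the sign [sg], extends the bound from [0, 1] to
    [-1, 1], where [coef_le_sup] applies. *)
Lemma coef_le_of_values (e h : nat -> R) (sg c S z : R) n k : 0 < c -> `|sg| = 1 ->
  (forall j, e j * (-1) ^+ j.+1 = sg * e j) -> 1 <= z ->
  (forall t, 0 <= t -> t <= c ->
     `|\sum_(j < n.+1) e j * (t ^+ j.+1 / (j.+1)`!%:R) * h j| <= S) ->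
  (k <= n)%N -> `|e k| = 1 ->
  `|h k| * (c ^+ k.+1 / (k.+1)`!%:R) * z ^+ k.+1 <=
    2 * n.+2%:R * (2 * z + (2 * z)^-1) ^+ n.+1 * S.
Proof.
move=> c0 sg1 es z1 hS kn ek.
pose a j := e j * (c ^+ j.+1 / (j.+1)`!%:R) * h j.
pose P : {poly R} := \poly_(i < n.+2) (if i is j.+1 then a j else 0).
have PE x : P.[x] = \sum_(j < n.+1) a j * x ^+ j.+1.
  by rewrite horner_poly big_ord_recl/= mul0r add0r.
have sP : (size P <= n.+2)%N by exact: size_poly.
have bP0 x : 0 <= x <= 1 -> `|P.[x]| <= S.
  move=> /andP[x0 x1]; rewrite PE.
  have := hS (c * x) (mulr_ge0 (ltW c0) x0); rewrite ler_piMr ?(ltW c0)// => /(_ isT).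
  congr (`|_| <= _); apply: eq_bigr => j _; rewrite /a exprMn; ring.
have bP x : -1 <= x <= 1 -> `|P.[x]| <= S.
  move=> /andP[x1 x2]; have [x0|x0] := leP 0 x; first by apply: bP0; rewrite x0.
  have -> : P.[x] = sg * P.[- x].
    rewrite !PE mulr_sumr; apply: eq_bigr => j _.
    rewrite -[x in LHS]opprK exprNn /a.
    transitivity ((e j * (-1) ^+ j.+1) * (c ^+ j.+1 / (j.+1)`!%:R) * h j * (- x) ^+ j.+1).
      by ring.
    by rewrite es; ring.
  by rewrite normrM sg1 mul1r; apply: bP0; lra.
have := coef_le_sup k.+1 sP z1 bP.
rewrite coef_poly ltnS ltnS kn /a !normrM ek mul1r; apply: le_trans.
rewrite -normrM [`|c ^+ k.+1 / _|]ger0_norm ?divr_ge0 ?exprn_ge0 ?(ltW c0)//.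
by rewrite [`|h k| * _]mulrC.
Qed.
End QuotientTaylor.

(** * Lower bound for the quadratic form *)

Section LowerForm.
Variables (R : realType) (c z : R) (n N : nat).
Hypotheses (c0 : 0 < c) (z1 : 1 <= z) (nN : (n <= N)%N).

Let r := 2 * z + (2 * z)^-1.
Let z0 : 0 < z. Proof. exact: lt_le_trans z1. Qed.
Let r0 : 0 < r. Proof. by rewrite addr_gt0 ?invr_gt0 ?mulr_gt0. Qed.

(** The part beyond degree N of the Taylor series of [kc0] and [ks0] has norm at
    most this. *)
Definition tail_const : R := Num.sqrt 2 * (c ^+ N.+2 / (N.+2)`!%:R * expR c).
(** The product of the constants in [poly_coef_le], [moment_coef_le] and
    [fact_ratio_le], times [n.+1] for the number of terms and [n.+1] for the
    derivative that recovers p from its primitive. *)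
Definition lower_const : R :=
  n.+1%:R ^+ 2 * (2 * N.+2%:R * (2 * z + (2 * z)^-1) ^+ N.+1 * Num.sqrt 2)
   * (2 * n.+2%:R * (2 * z + (2 * z)^-1) ^+ n.+1)
   * ((n.+1)`!%:R / (c * z ^+ 2) ^+ n.+1 * expR (c * z ^+ 2)).

Lemma tail_const_ge0 : 0 <= tail_const.
Proof. by rewrite mulr_ge0 ?sqrtr_ge0// mulr_ge0 ?expR_ge0// divr_ge0// exprn_ge0// ltW. Qed.
Lemma lower_const_gt0 : 0 < lower_const.
Proof.
rewrite /lower_const -/r mulr_gt0//; last first.
  by rewrite mulr_gt0 ?expR_gt0// divr_gt0 ?ltr0n ?fact_gt0// exprn_gt0// mulr_gt0// exprn_gt0.
rewrite mulr_gt0//; last by rewrite mulr_gt0 ?exprn_gt0.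
by rewrite mulr_gt0 ?exprn_gt0// mulr_gt0 ?sqrtr_gt0// mulr_gt0// exprn_gt0.
Qed.

Variable p : {poly R}.
Hypothesis sp : (size p <= N.+1)%N.
Let g := polyL p.
Hypothesis pv : forall k, (n < k)%N -> (k <= N)%N -> moment g 'X^k = 0.

Let A := ip (sincL (ltW c0) g) g.
Let X := Num.sqrt (c * (pi * A)).

Let cut (F : nat -> R) : \sum_(j < N.+1) F j * moment g 'X^j = \sum_(j < n.+1) F j * moment g 'X^j.
Proof.
rewrite -!(big_mkord xpredT (fun j => F j * moment g 'X^j)).
rewrite (big_cat_nat (n := n.+1))//= [X in _ + X]big_nat [X in _ + X]big1 ?addr0// => j /andP[nj jN].
by rewrite pv ?mulr0.
Qed.

(** The moments of degree between n + 1 and N vanish, so the Taylor polynomial of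
    degree N contributes a polynomial of degree n + 1 in t. *)
Lemma values_le (e : nat -> R) (F : L2 R) t : 0 <= t -> t <= c ->
  ip F g ^+ 2 <= c * (pi * A) ->
  (forall y, -1 <= y <= 1 ->
    `|F y - \sum_(j < N.+1) e j * (t ^+ j.+1 / (j.+1)`!%:R) * y ^+ j|
     <= t ^+ N.+2 / (N.+2)`!%:R * expR t) ->
  `|\sum_(j < n.+1) e j * (t ^+ j.+1 / (j.+1)`!%:R) * moment g 'X^j| <= X + tail_const * nrm g.
Proof.
move=> t0 tc F2 Fy.
pose q : {poly R} := \sum_(j < N.+1) (e j * (t ^+ j.+1 / (j.+1)`!%:R)) *: 'X^j.
have -> : \sum_(j < n.+1) e j * (t ^+ j.+1 / (j.+1)`!%:R) * moment g 'X^j = moment g q.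
  rewrite (lin_sum _ _ _ (@moment_lin _ g)) -(cut (fun j => e j * (t ^+ j.+1 / (j.+1)`!%:R))).
  by apply: eq_bigr => j _; rewrite (linZ _ _ (@moment_lin _ g)).
have h1 : `|ip F g - moment g q| <= tail_const * nrm g.
  rewrite -ipBl; apply: ip_le_sup.
    by rewrite mulr_ge0 ?expR_ge0// divr_ge0// exprn_ge0// ltW.
  move=> y yI; have y1 : -1 <= y <= 1 by move: yI; rewrite /= in_itv.
  rewrite L2subE polyLE horner_sum.
  under eq_bigr do rewrite hornerZ hornerXn.
  apply: (le_trans (Fy y y1)); rewrite ler_pM ?expR_ge0 ?ler_expR ?divr_ge0 ?exprn_ge0//.
  by rewrite ler_wpM2r// lerXn2r ?nnegrE// ltW.
have h2 : `|ip F g| <= X.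
  have A0 : 0 <= c * (pi * A) by exact: le_trans (sqr_ge0 _) F2.
  by rewrite -[leLHS]sqrtr_sqr ler_sqrt.
have := ler_normB (ip F g) (ip F g - moment g q).
rewrite opprB addrC subrK; lra.
Qed.

Lemma eval_sqr_le_form t (t0 : 0 <= t) x : t <= c ->
  x ^+ 2 <= t * ip (windowL (lexx 0) t0 g) g -> x ^+ 2 <= c * (pi * A).
Proof.
move=> tc /le_trans; apply.
have -> : pi * A = ip (windowL (lexx 0) (ltW c0) g) g.
  by rewrite /A ipZl mulrA mulfV ?mul1r// gt_eqF// pi_gt0.
exact: (ler_pM t0 (window_ge0 (lexx 0) t0 g) tc (window_mono t0 (ltW c0) g tc)).
Qed.

(** The even moments are read off the cosine coefficients, the odd ones off the
    sine coefficients. *)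
Lemma moment_coef_le k : (k <= n)%N ->
  `|moment g 'X^k| * (c ^+ k.+1 / (k.+1)`!%:R) * z ^+ k.+1 <=
    2 * n.+2%:R * r ^+ n.+1 * (X + tail_const * nrm g).
Proof.
move=> kn; have [ko|ke] := boolP (odd k).
  apply: (@coef_le_of_values R (esin R) (fun j => moment g 'X^j) 1) => //.
  - by rewrite normr1.
  - move=> j; rewrite /esin mul1r exprS mulN1r mulrN -(signr_odd _ j).
    move: ((-1) ^+ j.-1./2) => s.
    by case: odd; rewrite /= ?mul0r ?oppr0// expr1 mulrN1 opprK.
  - move=> t t0 tc; apply: (values_le t0 tc (F := ks0 t0)).
      exact: eval_sqr_le_form tc (ks0_sqr_le t0 g).
    by move=> y y1; exact: ks_taylor.
  - by rewrite /esin ko mul1r normrX normrN1 expr1n.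
apply: (@coef_le_of_values R (ecos R) (fun j => moment g 'X^j) (-1)) => //.
- by rewrite normrN1.
- move=> j; rewrite /ecos exprS mulN1r mulrN -(signr_odd _ j).
  move: ((-1) ^+ j./2) => s.
  by case: odd; rewrite /= ?mul0r ?oppr0 ?mulr0// expr0 mulr1 mulN1r.
- move=> t t0 tc; apply: (values_le t0 tc (F := kc0 t0)).
    exact: eval_sqr_le_form tc (kc0_sqr_le t0 g).
  by move=> y y1; exact: kc_taylor.
- by rewrite /ecos ke mul1r normrX normrN1 expr1n.
Qed.

(** The norm of [polyL p] controls the supremum of [prim p], hence its
    coefficients, which are those of p up to a factor. *)
Lemma poly_coef_le k : (k <= N)%N ->
  `|p`_k| / k.+1%:R * z ^+ k.+1 <= 2 * N.+2%:R * r ^+ N.+1 * (Num.sqrt 2 * nrm g).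
Proof.
move=> kN.
have spp : (size (prim p) <= N.+2)%N by rewrite (leq_trans (size_prim _)).
have := coef_le_sup k.+1 spp z1 (fun x => @prim_sup_le R p x).
by rewrite coef_prim normrM normfV normr_nat.
Qed.

(** The ratio of [k`!] to the k-th power of y decreases as long as k < y; the
    exponential covers that range. *)
Lemma fact_ratio_le k : (k <= n)%N ->
  (k.+1)`!%:R / (c * z ^+ 2) ^+ k.+1 <=
  (n.+1)`!%:R / (c * z ^+ 2) ^+ n.+1 * expR (c * z ^+ 2).
Proof.
move=> kn; set y := c * z ^+ 2; have y0 : 0 < y by rewrite mulr_gt0// exprn_gt0.
have -> : (n.+1)`!%:R / y ^+ n.+1 * expR y = (n.+1)`!%:R * expR y / y ^+ (n - k)%N / y ^+ k.+1.
  have -> : y ^+ n.+1 = y ^+ k.+1 * y ^+ (n - k)%N by rewrite -exprD addSn subnKC.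
  by field; rewrite !expf_neq0 ?gt_eqF.
rewrite ler_wpM2r ?invr_ge0 ?exprn_ge0 ?(ltW y0)// ler_pdivlMr ?exprn_gt0//.
have := exp_ge_term (n - k) (ltW y0).
rewrite ler_pdivrMr ?ltr0n ?fact_gt0// => h.
apply: (@le_trans _ _ ((k.+1)`!%:R * (expR y * (n - k)`!%:R))).
  by rewrite ler_wpM2l.
rewrite mulrCA -natrM mulrC ler_wpM2r ?expR_ge0// ler_nat.
have kn' : (k.+1 <= n.+1)%N by [].
have := bin_fact kn'; rewrite subSS => <-.
by rewrite leq_pmull// bin_gt0.
Qed.

(** The squared norm is the sum of the products of the coefficients of p with the
    moments of the same degree, of which only those up to n survive. *)
Lemma nrm_le_lower : nrm g ^+ 2 <= lower_const * (X + tail_const * nrm g) * nrm g.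
Proof.
have X0 : 0 <= X by exact: sqrtr_ge0.
have S0 : 0 <= X + tail_const * nrm g by rewrite addr_ge0// mulr_ge0 ?tail_const_ge0 ?nrm_ge0.
have -> : nrm g ^+ 2 = \sum_(k < n.+1) p`_k * moment g 'X^k.
  rewrite nrm_sqr -(cut (fun k => p`_k)) -[LHS]/(moment g p).
  have {1}-> : p = \sum_(k < N.+1) p`_k *: 'X^k.
    rewrite -poly_def; apply/polyP => j; rewrite coef_poly; case: ltnP => // jN.
    by rewrite nth_default// (leq_trans sp).
  rewrite (lin_sum _ _ _ (@moment_lin _ g)).
  by apply: eq_bigr => j _; rewrite (linZ _ _ (@moment_lin _ g)).
pose G1 := 2 * N.+2%:R * r ^+ N.+1 * (Num.sqrt 2 * nrm g).
pose G2 := 2 * n.+2%:R * r ^+ n.+1 * (X + tail_const * nrm g).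
pose G3 := (n.+1)`!%:R / (c * z ^+ 2) ^+ n.+1 * expR (c * z ^+ 2).
have G1p : 0 <= G1.
  by rewrite !mulr_ge0 ?exprn_ge0 ?(ltW r0) ?sqrtr_ge0 ?nrm_ge0.
have G2p : 0 <= G2 by rewrite !mulr_ge0 ?exprn_ge0 ?(ltW r0).
have G3p : 0 <= G3.
  by rewrite mulr_ge0 ?expR_ge0// divr_ge0// exprn_ge0// mulr_ge0 ?(ltW c0)// exprn_ge0// ltW.
apply: (@le_trans _ _ (n.+1%:R * (n.+1%:R * (G1 * G2 * G3)))); last first.
  rewrite /lower_const /G1 /G2 /G3 -/r le_eqVlt; apply/orP; left; apply/eqP; ring.
apply: sum_le_const => k; have kn : (k <= n)%N by rewrite -ltnS.
rewrite (le_trans (ler_norm _))// normrM.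
have h1 := poly_coef_le (leq_trans kn nN); have h2 := moment_coef_le kn.
have h3 := fact_ratio_le kn.
have zk : 0 < z ^+ k.+1 by rewrite exprn_gt0.
have ck : 0 < c ^+ k.+1 by rewrite exprn_gt0.
have fk : 0 < (k.+1)`!%:R :> R by rewrite ltr0n fact_gt0.
have -> : `|p`_k| * `|moment g 'X^k| = k.+1%:R *
  ((`|p`_k| / k.+1%:R * z ^+ k.+1) *
   (`|moment g 'X^k| * (c ^+ k.+1 / (k.+1)`!%:R) * z ^+ k.+1) *
   ((k.+1)`!%:R / (c * z ^+ 2) ^+ k.+1)).
  have -> : (c * z ^+ 2) ^+ k.+1 = c ^+ k.+1 * (z ^+ k.+1 * z ^+ k.+1).
    by rewrite exprMn -exprM mulnC exprM expr2.
  move: fk zk ck; move: (k.+1)`!%:R (z ^+ k.+1) (c ^+ k.+1) => a1 a2 a3 h4 h5 h6.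
  by field; rewrite nat1r pnatr_eq0 !gt_eqF.
apply: ler_pM => //; rewrite ?ler_nat//.
  rewrite mulr_ge0//; last by rewrite divr_ge0// exprn_ge0// mulr_ge0 ?(ltW c0)// exprn_ge0// ltW.
  by rewrite !mulr_ge0// ?exprn_ge0 ?(ltW z0) ?(ltW c0)// ?mulr_ge0 ?invr_ge0 ?exprn_ge0 ?(ltW c0).
apply: ler_pM => //.
- by rewrite !mulr_ge0// ?exprn_ge0 ?(ltW z0) ?(ltW c0)// ?mulr_ge0 ?invr_ge0 ?exprn_ge0 ?(ltW c0).
- by rewrite divr_ge0// exprn_ge0// mulr_ge0 ?(ltW c0)// exprn_ge0// ltW.
- apply: ler_pM => //.
  + by rewrite !mulr_ge0// ?exprn_ge0 ?(ltW z0).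
  + by rewrite !mulr_ge0// ?exprn_ge0 ?(ltW z0) ?(ltW c0)// ?mulr_ge0 ?invr_ge0 ?exprn_ge0 ?(ltW c0).
Qed.

(** Half of the norm is absorbed by the tail, the rest is bounded by the square
    root X of a multiple of the form. *)
Lemma form_lower : 0 < ip g g -> lower_const * tail_const <= 2^-1 ->
  (4 * lower_const ^+ 2 * c * pi)^-1 * ip g g <= A.
Proof.
move=> g0 GT.
have A0 : 0 <= A by exact: sincL_ge0.
have X0 : 0 <= X by exact: sqrtr_ge0.
have n0 : 0 < nrm g by rewrite /nrm /fnorm sqrtr_gt0.
have L0 := lower_const_gt0.
have := nrm_le_lower; rewrite expr2 ler_pM2r// => h.
have h1 : lower_const * tail_const * nrm g <= 2^-1 * nrm g by rewrite ler_pM2r.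
have h2 : nrm g <= 2 * (lower_const * X) by move: h; rewrite mulrDr mulrA; lra.
have h3 : nrm g ^+ 2 <= (2 * (lower_const * X)) ^+ 2.
  by rewrite lerXn2r ?nnegrE ?(ltW n0)// (le_trans (ltW n0)).
have X2 : X ^+ 2 = c * (pi * A) by rewrite /X sqr_sqrtr// !mulr_ge0 ?(ltW c0) ?pi_ge0.
move: h3; rewrite nrm_sqr exprMn (exprMn _ lower_const) X2 => h3.
move: h3 L0 {h h1 h2 GT}; move: lower_const => L h3 L0.
rewrite mulrC ler_pdivrMr; last by rewrite !mulr_gt0 ?exprn_gt0 ?pi_gt0.
apply: (le_trans h3); rewrite le_eqVlt; apply/orP; left; apply/eqP; ring.
Qed.

End LowerForm.

Section LamLower.
Variables (R : realType) (c z : R) (lam : nat -> R) (n K : nat).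
Hypotheses (c0 : 0 < c) (z1 : 1 <= z).
Hypothesis lamP : eigenvalues_in_decreasing_order c lam.

Lemma polyL_ip_gt0 (p : {poly R}) : p != 0 -> 0 < ip (polyL p) (polyL p).
Proof.
move=> p0; rewrite lt_def ip_ge0 andbT; apply: contra p0 => /eqP e.
have ng : nrm (polyL p) = 0 by rewrite /nrm /fnorm e sqrtr0.
have sb (x : R) : -1 <= x <= 1 -> `|(prim p).[x]| <= 0.
  by move=> x1; have := @prim_sup_le R p x x1; rewrite ng mulr0.
apply/eqP/polyP => k; rewrite coef0.
have := coef_le_sup k.+1 (leqnSn _) (lexx 1) sb.
rewrite mulr0 expr1n mulr1 normr_le0 coef_prim mulf_eq0 invr_eq0 pnatr_eq0 orbF.
by move/eqP.
Qed.

(** A polynomial of degree at most N = n + K has N + 1 coefficients, one more than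
    the conditions imposed: orthogonality to n eigenfunctions and to the K
    monomials of degree n + 1 to N. *)
Lemma eigenvalue_ge :
  lower_const c z n (n + K) * tail_const c (n + K) <= 2^-1 ->
  (4 * lower_const c z n (n + K) ^+ 2 * c * pi)^-1 <= lam n.
Proof.
move=> LT; set N := (n + K)%N in LT *.
have [f [fE f_indep f_span]] := eigenfamily lamP.
pose A1 : 'M[R]_(N.+1, K) := \matrix_(i, j) moment (polyL 'X^(n.+1 + j)) 'X^i.
pose A2 : 'M[R]_(N.+1, n) := \matrix_(i, j) moment (f j) 'X^i.
have [|v v0 /eqP] := @nonzero_kernel_vector _ _ _ (row_mx A1 A2).
  by rewrite ltnS addnC.
rewrite mul_mx_row row_mx_eq0 => /andP[/eqP v1 /eqP v2].
pose p : {poly R} := \sum_(i < N.+1) v 0 i *: 'X^i.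
have pE k : p`_k = if insub k is Some i then v 0 i else 0.
  rewrite coef_sum; case: insubP => [i _ <-|kN].
    rewrite (bigD1 i)//= big1 ?addr0 => [|j ji].
      by rewrite coefZ coefXn eqxx mulr1.
    by rewrite coefZ coefXn eq_sym (inj_eq val_inj) (negbTE ji) mulr0.
  rewrite big1// => j _; rewrite coefZ coefXn.
  by case: eqP => [e|]; rewrite ?mulr0//; rewrite e ltn_ord in kN.
have p0 : p != 0.
  have /rV0Pn[i vi] := v0; apply: contra vi => /eqP /(congr1 (fun p : {poly R} => p`_i)).
  by rewrite pE coef0 valK => ->.
have sp : (size p <= N.+1)%N.
  by apply/leq_sizeP => k kN; rewrite pE insubN// -leqNgt.
have mp h : moment h p = \sum_(i < N.+1) v 0 i * moment h 'X^i.
  rewrite (lin_sum _ _ _ (@moment_lin _ h)).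
  by apply: eq_bigr => j _; rewrite (linZ _ _ (@moment_lin _ h)).
have g0 := polyL_ip_gt0 p0.
have pv k : (n < k)%N -> (k <= N)%N -> moment (polyL p) 'X^k = 0.
  move=> nk kN; rewrite /moment ipC -[LHS]/(moment _ p) mp.
  have kK : (k - n.+1 < K)%N by rewrite ltn_subLR// addSn ltnS.
  have := congr1 (fun M : 'rV_K => M 0 (Ordinal kK)) v1.
  rewrite !mxE => e; rewrite -[RHS]e; apply: eq_bigr => i _.
  by rewrite mxE/= subnKC.
have gf i : (i < n)%N -> ip (polyL p) (f i) = 0.
  move=> ni; rewrite -[LHS]/(moment _ p) mp.
  have := congr1 (fun M : 'rV_n => M 0 (Ordinal ni)) v2.
  by rewrite !mxE => e; rewrite -[RHS]e; apply: eq_bigr => j _; rewrite mxE.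
have L0 := lower_const_gt0 n N c0 z1.
have d0 : 0 < (4 * lower_const c z n N ^+ 2 * c * pi)^-1.
  rewrite invr_gt0; move: L0; move: (lower_const _ _ _ _) => L L0.
  by rewrite !mulr_gt0 ?exprn_gt0 ?pi_gt0.
have fl := form_lower c0 z1 (leq_addr K n) sp pv g0 LT.
exact: (@lam_ge_of_orthogonal R c (ltW c0) lam lamP f fE f_span n (polyL p) _ gf d0 g0 fl).
Qed.
End LamLower.

(** * Decay of the eigenvalues from below *)

Section LowerNumerics.
Variable R : realType.

(** By induction, because e (n / (n + 1))^(n + 1) is at most 1. *)
Lemma stirling_le n : (0 < n)%N -> n`!%:R <= expR 1 * n%:R * (n%:R / expR 1) ^+ n :> R.
Proof.
elim: n => // -[_ _|n IH _].
  by rewrite (_ : 1`! = 1%N)// expr1 mulr1 mul1r mulfV// gt_eqF// expR_gt0.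
set m := n.+1; have m0 : 0 < m%:R :> R by [].
have e0 := @expR_gt0 R 1; have m10 : 0 < m.+1%:R :> R by [].
have key : expR 1 * (m%:R / m.+1%:R) ^+ m.+1 <= 1 :> R.
  have -> : expR 1 = (expR (m.+1%:R^-1)) ^+ m.+1 :> R.
    by rewrite -expRM_natl mulfV// gt_eqF.
  rewrite -exprMn; apply: exprn_ile1; first by rewrite mulr_ge0 ?expR_ge0// divr_ge0.
  rewrite mulrC -ler_pdivlMr ?expR_gt0// mul1r -expRN.
  apply: le_trans (expR_ge1Dx _); rewrite le_eqVlt; apply/orP; left; apply/eqP.
  by have := m10; rewrite -natr1 => h; field; rewrite gt_eqF.
rewrite factS natrM; apply: (le_trans (ler_wpM2l (ltW m10) (IH _))) => //.
rewrite -/m.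
have -> : m.+1%:R * (expR 1 * m%:R * (m%:R / expR 1) ^+ m) =
  expR 1 * m.+1%:R * (m.+1%:R / expR 1) ^+ m.+1 * (expR 1 * (m%:R / m.+1%:R) ^+ m.+1) :> R.
  rewrite !expr_div_n !(exprS _ m); field.
  by rewrite ?nat1r ?natr1 !gt_eqF// exprn_gt0.
by rewrite ler_piMr// !mulr_ge0 ?expR_ge0// exprn_ge0// divr_ge0// expR_ge0.
Qed.

Lemma fact_ratio_ge n K : (n.+1)`!%:R * n%:R ^+ K.+1 <= (n + K).+2`!%:R :> R.
Proof.
rewrite -natrX -natrM ler_nat; elim: K => [|K IH].
  by rewrite addn0 expn1 [in leqRHS]factS mulnC leq_mul// ltnW.
rewrite addnS [in leqRHS]factS expnS mulnCA leq_mul// -!addnS leq_addr//.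
Qed.

(** Writing [2 * z + (2 * z)^-1] as [z * w], all powers of z but the K-th cancel. *)
Lemma lower_const_le (c z w : R) n K : 0 < c -> 0 < z -> 2 * z + (2 * z)^-1 = z * w ->
  (0 < n)%N -> (K <= n.+1)%N ->
  lower_const c z n (n + K) <= 240 * Num.sqrt 2 * n%:R ^+ 4 *
    ((z * w) ^+ K * (w ^+ 2) ^+ n.+1 * ((n.+1)`!%:R / c ^+ n.+1) * expR (c * z ^+ 2)).
Proof.
move=> c0 z0 rE n0 Kn; rewrite /lower_const rE; set N := (n + K)%N.
have nn : 1 <= n%:R :> R by rewrite ler1n.
have w0 : 0 <= w.
  have : 0 <= z * w by rewrite -rE addr_ge0 ?invr_ge0 ?mulr_ge0 ?(ltW z0).
  by rewrite pmulr_rge0.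
have h1 : n.+1%:R <= 2 * n%:R :> R by rewrite -natr1; lra.
have h2 : N.+2%:R <= 5 * n%:R :> R.
  have Kr : K%:R <= n%:R + 1 :> R by rewrite natr1 ler_nat.
  by rewrite -addn2 !natrD; move: nn Kr; clear; lra.
have h3 : n.+2%:R <= 3 * n%:R :> R by rewrite -addn2 natrD; lra.
set X := (z * w) ^+ K * _ * _ * _.
have X0 : 0 <= X.
  rewrite /X mulr_ge0 ?expR_ge0// mulr_ge0//; last by rewrite divr_ge0// exprn_ge0// ltW.
  by apply: mulr_ge0; rewrite exprn_ge0// ?sqr_ge0// mulr_ge0// ltW.
rewrite [leLHS](_ : _ = (n.+1%:R ^+ 2 * N.+2%:R * n.+2%:R) * (4 * Num.sqrt 2) * X); last first.
  rewrite /X /N; have -> : (n + K).+1 = (K + n.+1)%N by rewrite addnS addnC.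
  have -> : (w ^+ 2) ^+ n.+1 = w ^+ n.+1 * w ^+ n.+1 by rewrite -exprM mulnC exprM expr2.
  have -> : (c * z ^+ 2) ^+ n.+1 = c ^+ n.+1 * (z ^+ n.+1 * z ^+ n.+1).
    by rewrite exprMn -exprM mulnC exprM expr2.
  have zn : z ^+ n.+1 != 0 by rewrite expf_neq0// gt_eqF.
  have cn : c ^+ n.+1 != 0 by rewrite expf_neq0// gt_eqF.
  rewrite (exprD _ K) !(exprMn _ z w).
  move: zn cn; move: (Num.sqrt 2) (z ^+ n.+1) (w ^+ n.+1) (c ^+ n.+1) (expR _) (z ^+ K) (w ^+ K).
  move=> s2 a1 a2 a3 a4 a5 a6 n1 n2.
  by field; rewrite n1 n2.
rewrite [leRHS](_ : _ = ((2 * n%:R) ^+ 2 * (5 * n%:R) * (3 * n%:R)) * (4 * Num.sqrt 2) * X); last by ring.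
rewrite ler_wpM2r// ler_wpM2r ?mulr_ge0 ?sqrtr_ge0//.
by do 2 (apply: ler_pM => //; rewrite ?mulr_ge0 ?exprn_ge0//); rewrite lerXn2r ?nnegrE ?mulr_ge0.
Qed.

(** The quotient of the factorials and powers of c leaves [(c / n) ^+ K.+1]. As
    K >= n / q, this beats every fixed exponential in n once n / c is large
    enough. *)
Lemma lower_tail_le (c z w : R) n K q : 0 < c -> c <= n%:R -> 0 < z -> 1 <= w ->
  2 * z + (2 * z)^-1 = z * w -> (0 < n)%N -> (K <= n.+1)%N -> (n <= q * K)%N ->
  z * w * (w ^+ 2 * expR 2) ^+ q * c <= n%:R -> c * (z ^+ 2 + 1) <= n%:R ->
  lower_const c z n (n + K) * tail_const c (n + K) <=
    480 * w ^+ 2 * n%:R ^+ 4 * expR (- n%:R).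
Proof.
move=> c0 cn z0 w1 rE n0 Kn nqK hq hz.
have w0 : 0 < w by exact: lt_le_trans w1.
have nn : 0 < n%:R :> R by rewrite ltr0n.
have zw0 : 0 < z * w by rewrite mulr_gt0.
(* The powers of Y cancel [(w ^+ 2) ^+ n] and leave [expR (- n)] twice: once against
   the exponentials in c, once for the conclusion. *)
pose Y := w ^+ 2 * expR 2.
have Y1 : 1 <= Y by rewrite -[1]mulr1 ler_pM// ?exprn_ege1// -expR0 ler_expR.
have Y0 : 0 < Y by exact: lt_le_trans Y1.
apply: le_trans (ler_wpM2r (tail_const_ge0 _ c0) (lower_const_le c0 z0 rE n0 Kn)) _.
rewrite /tail_const.
have hf : (n.+1)`!%:R / (n + K).+2`!%:R <= (n%:R^-1) ^+ K.+1 :> R.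
  rewrite exprVn ler_pdivrMr ?ltr0n ?fact_gt0// mulrC ler_pdivlMr ?exprn_gt0//.
  exact: fact_ratio_ge.
have hc : (c / n%:R) ^+ K.+1 * (z * w) ^+ K <= (Y^-1) ^+ n.
  have ck0 : 0 <= c / n%:R by rewrite divr_ge0 ?(ltW c0).
  have c1 : c / n%:R <= 1 by rewrite ler_pdivrMr ?mul1r.
  apply: (@le_trans _ _ ((c / n%:R * (z * w)) ^+ K)).
    rewrite exprS (exprMn K (c / n%:R) (z * w)) -mulrA.
    by rewrite ler_piMl// mulr_ge0 ?exprn_ge0// ltW.
  apply: (@le_trans _ _ (((Y^-1) ^+ q) ^+ K)).
    have Yq : 0 <= Y^-1 ^+ q by rewrite exprn_ge0// invr_ge0 ltW.
    apply: lerXn2r; rewrite ?nnegrE//; first by rewrite mulr_ge0// ltW.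
    rewrite exprVn -[(Y ^+ q)^-1]mul1r ler_pdivlMr ?exprn_gt0//.
    rewrite (_ : _ * Y ^+ q = z * w * Y ^+ q * c / n%:R); last by ring.
    by rewrite ler_pdivrMr ?mul1r.
  by rewrite -exprM ler_wiXn2l ?invr_ge0 ?(ltW Y0)// invf_le1.
have he : expR (c * z ^+ 2) * expR c <= expR n%:R.
  by rewrite -expRD ler_expR; move: hz; rewrite mulrDr mulr1.
have eY : (w ^+ 2) ^+ n * (Y^-1) ^+ n = expR (- n%:R) * expR (- n%:R).
  rewrite -exprMn /Y invfM mulrA mulfV ?mul1r ?expf_neq0 ?gt_eqF//.
  by rewrite -expRN -expRM_natl -expRD; congr expR; ring.
have e1 : expR (- n%:R) * expR n%:R = 1 :> R by rewrite -expRD addNr expR0.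
have s2 : Num.sqrt 2 * Num.sqrt 2 = 2 :> R by rewrite -expr2 sqr_sqrtr.
rewrite [leLHS](_ : _ = 480 * n%:R ^+ 4 * ((w ^+ 2) ^+ n.+1 *
   ((n.+1)`!%:R / (n + K).+2`!%:R * (c ^+ K.+1 * (z * w) ^+ K)) * (expR (c * z ^+ 2) * expR c))); last first.
  have -> : c ^+ (n + K).+2 = c ^+ n.+1 * c ^+ K.+1 by rewrite -exprD addSn addnS.
  have cn0 : c ^+ n.+1 != 0 by rewrite expf_neq0// gt_eqF.
  have f0 : (n + K).+2`!%:R != 0 :> R by rewrite pnatr_eq0 -lt0n fact_gt0.
  move: cn0 f0 s2.
  move: (Num.sqrt 2) (c ^+ n.+1) (c ^+ K.+1) ((z * w) ^+ K) (expR c) (expR _) ((n + K).+2`!%:R) ((n.+1)`!%:R) ((w ^+ 2) ^+ n.+1) (n%:R ^+ 4).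
  move=> s a1 a2 a3 a4 a5 a6 a7 a8 a9 h1 h2 h3.
  by rewrite (_ : 480 = 240 * (s * s)); [field; rewrite h1 h2|rewrite h3; ring].
rewrite [leRHS](_ : _ = 480 * n%:R ^+ 4 * ((w ^+ 2) ^+ n.+1 * (Y^-1) ^+ n * expR n%:R)); last first.
  have -> : (w ^+ 2) ^+ n.+1 * (Y^-1) ^+ n = w ^+ 2 * (expR (- n%:R) * expR (- n%:R)).
    by rewrite (exprS (w ^+ 2)) -mulrA eY.
  by rewrite -!mulrA e1 mulr1; ring.
apply: ler_wpM2l; first exact: (mulr_ge0 (ler0n _ _) (exprn_ge0 _ (ler0n _ _))).
have W0 : 0 <= (w ^+ 2) ^+ n.+1 by rewrite exprn_ge0 ?sqr_ge0.
have P0 : 0 <= c ^+ K.+1 * (z * w) ^+ K by rewrite mulr_ge0// exprn_ge0// ltW.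
have Q0 : 0 <= (n.+1)`!%:R / (n + K).+2`!%:R :> R by rewrite divr_ge0.
have QP := ler_wpM2r P0 hf.
have PE : n%:R^-1 ^+ K.+1 * (c ^+ K.+1 * (z * w) ^+ K) = (c / n%:R) ^+ K.+1 * (z * w) ^+ K.
  by rewrite (exprMn _ c) mulrA [_ * c ^+ _]mulrC.
rewrite PE in QP.
apply: ler_pM he; [by rewrite mulr_ge0// mulr_ge0|by rewrite mulr_ge0 ?expR_ge0|].
exact: (ler_wpM2l W0 (le_trans QP hc)).
Qed.

(** By Stirling the growth is that of [(4 * n / (c * expR 1)) ^+ n], up to powers of
    n and three losses of at most [expR (l * n)]: w exceeds 2 slightly, K is about n / q with
    q large, and c is small compared to n. *)
Lemma lower_const_growth (c z w l : R) n K q : 1 <= c -> 0 < z -> 1 <= w ->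
  2 * z + (2 * z)^-1 = z * w -> (0 < n)%N -> (0 < q)%N -> K = (n %/ q).+1 ->
  1 <= z * w -> 0 <= l ->
  w ^+ 2 / 4 <= expR l -> z * w <= expR (l * q%:R) -> c * z ^+ 2 <= l * n%:R ->
  4 * lower_const c z n (n + K) * c <=
    1920 * Num.sqrt 2 * expR 1 * w ^+ 2 * (z * w) * n%:R ^+ 6
     * expR (3 * l * n%:R) * (4 * n%:R / (c * expR 1)) ^+ n.
Proof.
move=> c1 z0 w1 rE n0 q0 KE zw1 l0 hw hzw hcz.
have c0 : 0 < c by exact: lt_le_trans c1.
have w0 : 0 < w by exact: lt_le_trans w1.
have nn : 0 < n%:R :> R by rewrite ltr0n.
have Kn : (K <= n.+1)%N by rewrite KE ltnS leq_div.
have hB : (z * w) ^+ K <= z * w * expR (l * n%:R).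
  rewrite KE exprS ler_wpM2l//; first by rewrite (le_trans _ zw1).
  apply: (@le_trans _ _ (expR (l * q%:R) ^+ (n %/ q))).
    by rewrite lerXn2r ?nnegrE ?expR_ge0// (le_trans _ zw1).
  rewrite -expRM_natl ler_expR mulrCA ler_wpM2l// -natrM ler_nat; exact: leq_trunc_div.
have hW : (w ^+ 2) ^+ n <= 4 ^+ n * expR (l * n%:R).
  have -> : w ^+ 2 = 4 * (w ^+ 2 / 4) by field.
  rewrite exprMn ler_wpM2l ?exprn_ge0// [l * _]mulrC expRM_natl lerXn2r ?nnegrE ?expR_ge0//.
  by rewrite divr_ge0// sqr_ge0.
have hF : (n.+1)`!%:R <= 2 * n%:R * (expR 1 * n%:R * (n%:R / expR 1) ^+ n) :> R.
  rewrite factS natrM; apply: ler_pM => //; last exact: stirling_le.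
  by rewrite -natrM ler_nat mul2n -addnn -addn1 leq_add2l.
have hE : expR (c * z ^+ 2) <= expR (l * n%:R) by rewrite ler_expR.
apply: le_trans (ler_wpM2r (ltW c0) (ler_wpM2l _ (lower_const_le c0 z0 rE n0 Kn))) _ => //.
have ee : expR (3 * l * n%:R) = expR (l * n%:R) * expR (l * n%:R) * expR (l * n%:R) :> R.
  by rewrite -!expRD; congr expR; ring.
set E := expR (l * n%:R) in hB hW hE ee *; have E0 : 0 < E by exact: expR_gt0.
have cn : 0 < c ^+ n by rewrite exprn_gt0.
rewrite [leRHS](_ : _ = (960 * Num.sqrt 2 * n%:R ^+ 4 * w ^+ 2 / c ^+ n) *
   ((z * w * E) * (4 ^+ n * E) * (2 * n%:R * (expR 1 * n%:R * (n%:R / expR 1) ^+ n)) * E)); last first.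
  rewrite ee; have -> : 4 * n%:R / (c * expR 1) = 4 * (n%:R / expR 1) / c.
    by rewrite invfM; ring.
  rewrite (expr_div_n _ c) (exprMn _ 4); move: (gt_eqF cn) => /negbT.
  move: (Num.sqrt 2) (expR 1) (c ^+ n) (4 ^+ n) (_ ^+ n) => s2 e a1 a2 a3 h1.
  by field.
rewrite [leLHS](_ : _ = (960 * Num.sqrt 2 * n%:R ^+ 4 * w ^+ 2 / c ^+ n) *
   ((z * w) ^+ K * (w ^+ 2) ^+ n * (n.+1)`!%:R * expR (c * z ^+ 2))); last first.
  rewrite (exprS (w ^+ 2)) (exprS c); move: (gt_eqF cn) (gt_eqF c0) => /negbT h1 /negbT h2.
  move: h1; move: (Num.sqrt 2) (c ^+ n) ((w ^+ 2) ^+ n) ((z * w) ^+ K) (expR _) ((n.+1)`!%:R).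
  by move=> s2 a1 a2 a3 a4 a5 h1; field; rewrite h1 h2.
apply: ler_wpM2l.
  exact: (divr_ge0 (mulr_ge0 (mulr_ge0 (mulr_ge0 (ler0n _ _) (sqrtr_ge0 _))
    (exprn_ge0 _ (ler0n _ _))) (sqr_ge0 _)) (ltW cn)).
have zwK : 0 <= (z * w) ^+ K by rewrite exprn_ge0// (le_trans _ zw1).
have wn : 0 <= (w ^+ 2) ^+ n by rewrite exprn_ge0 ?sqr_ge0.
apply: ler_pM; rewrite ?expR_ge0 ?mulr_ge0//.
by apply: ler_pM; rewrite ?mulr_ge0//; apply: ler_pM.
Qed.

End LowerNumerics.

Section LowerBound.
Variable R : realType.

(** With b e / 4 = expR (4 l), three of the four factors [expR (l * n)] pay for the
    losses in [lower_const_growth] and the last one for the powers of n. The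
    parameters are chosen in this order: z brings w close to 2, q makes
    [(z * w) ^+ K] small, and M makes the tail negligible. *)
Lemma eigenvalue_decay_lower (b : R) : 4 / expR 1 < b ->
  exists M : R, forall c : R, 1 <= c ->
    forall lam : nat -> R, eigenvalues_in_decreasing_order c lam ->
    forall n : nat, c * M <= n%:R ->
      lam n > expR (- (2 * n%:R * ln (b * n%:R / c))).
Proof.
move=> b4; have e0 := @expR_gt0 R 1.
have b0 : 0 < b by apply: le_lt_trans b4; rewrite divr_ge0// ltW.
pose l := ln (b * expR 1 / 4) / 4.
have be1 : 1 < b * expR 1 / 4 by rewrite ltr_pdivlMr// mul1r -ltr_pdivrMr.
have l0 : 0 < l by rewrite divr_gt0// ln_gt0.
have bE : b = expR (4 * l) * 4 / expR 1.
  rewrite (_ : 4 * l = ln (b * expR 1 / 4)); last by rewrite /l; field.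
  rewrite lnK ?posrE ?(lt_trans _ be1)//.
  by field; rewrite gt_eqF.
(* Any z with z^-1 <= l gives w^2 / 4 = (1 + 1 / (4 z^2))^2 <= 1 + l. *)
pose z := 1 + l^-1; pose w := 2 + (2 * z ^+ 2)^-1.
have z1 : 1 <= z by rewrite lerDl invr_ge0 ltW.
have z0 : 0 < z by exact: lt_le_trans z1.
have w1 : 1 <= w.
  have : 0 <= (2 * z ^+ 2)^-1 by rewrite invr_ge0 mulr_ge0// sqr_ge0.
  by rewrite /w; lra.
have rE : 2 * z + (2 * z)^-1 = z * w by rewrite /w; field; rewrite gt_eqF.
have B1 : 1 <= z * w by rewrite -[1]mulr1 ler_pM.
have B0 : 0 < z * w by exact: lt_le_trans B1.
have hw : w ^+ 2 / 4 <= expR l.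
  apply: le_trans (expR_ge1Dx _).
  have zi0 : 0 < z^-1 by rewrite invr_gt0.
  have zi1 : z^-1 <= 1 by rewrite invf_le1.
  have zil : z^-1 <= l by rewrite invf_ple ?posrE// lerDr.
  have -> : w ^+ 2 / 4 = 1 + (z^-1 ^+ 2) / 2 + (z^-1 ^+ 2) ^+ 2 / 16.
    by rewrite /w; field; rewrite gt_eqF.
  have h1 : z^-1 ^+ 2 <= z^-1 by rewrite expr2 ler_piMr// ltW.
  have h2 : (z^-1 ^+ 2) ^+ 2 <= z^-1 ^+ 2.
    by rewrite [leLHS]expr2 ler_piMr ?sqr_ge0// (le_trans h1).
  lra.
pose q := Num.bound (z * w / l).
have qB : z * w / l < q%:R by apply: archi_boundP; rewrite divr_ge0 ?(ltW B0) ?(ltW l0).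
have q0 : (0 < q)%N by rewrite -(ltr_nat R); apply: le_lt_trans qB; rewrite divr_ge0 ?(ltW B0) ?(ltW l0).
have hq : z * w <= expR (l * q%:R).
  apply: le_trans (expR_ge1Dx _); move: qB; rewrite ltr_pdivrMr// mulrC; lra.
have [M1 HM1] := @poly_le_exp R (960 * w ^+ 2) 1 4 ltr01.
pose A := 1920 * Num.sqrt 2 * expR 1 * w ^+ 2 * (z * w).
have [M2 HM2] := @poly_le_exp R A l 6 l0.
pose M3 := z * w * (w ^+ 2 * expR 2) ^+ q.
exists (Num.max 1 (Num.max M1 (Num.max M2 (Num.max M3 (Num.max (z ^+ 2 + 1) (z ^+ 2 / l)))))).
move=> c c1 lam lamP n; set M := Num.max _ _ => cMn.
have c0 : 0 < c by exact: lt_le_trans c1.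
have m1 : 1 <= M by rewrite le_max lexx.
have m2 : M1 <= M by rewrite !le_max lexx !orbT.
have m3 : M2 <= M by rewrite !le_max lexx !orbT.
have m4 : M3 <= M by rewrite !le_max lexx !orbT.
have m5 : z ^+ 2 + 1 <= M by rewrite !le_max lexx !orbT.
have m6 : z ^+ 2 / l <= M by rewrite !le_max lexx !orbT.
have Mn : M <= n%:R by apply: le_trans cMn; rewrite ler_peMl// (le_trans _ m1).
have cn : c <= n%:R by apply: le_trans cMn; rewrite ler_peMr// ltW.
have nn : 0 < n%:R :> R by exact: lt_le_trans cn.
have n0 : (0 < n)%N by move: nn; rewrite ltr0n.
have cM x : x <= M -> c * x <= n%:R.
  by move=> xM; apply: le_trans cMn; rewrite ler_pM2l.
pose K := (n %/ q).+1.
have Kn : (K <= n.+1)%N by rewrite ltnS leq_div.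
have nqK : (n <= q * K)%N by rewrite mulnC ltnW// ltn_ceil.
have LT : lower_const c z n (n + K) * tail_const c (n + K) <= 2^-1.
  have h3 : z * w * (w ^+ 2 * expR 2) ^+ q * c <= n%:R by rewrite mulrC cM.
  apply: le_trans (lower_tail_le c0 cn z0 w1 rE n0 Kn nqK h3 (cM _ m5)) _.
  have := HM1 n (le_trans m2 Mn); rewrite mul1r expRN => h4.
  rewrite ler_pdivrMr ?expR_gt0//.
  move: h4; move: (w ^+ 2) (n%:R ^+ 4) (expR _) => u1 u2 u3; clear; lra.
have hcz : c * z ^+ 2 <= l * n%:R.
  by have := cM _ m6; rewrite mulrA ler_pdivrMr// [n%:R * l]mulrC.
have lw := eigenvalue_ge c0 z1 lamP LT.
apply: lt_le_trans lw.
have G := lower_const_growth c1 z0 w1 rE n0 q0 (erefl K) B1 (ltW l0) hw hq hcz.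
have := lower_const_gt0 n (n + K) c0 z1.
set L := lower_const _ _ _ _ in G * => L0.
rewrite exp_ln_pow; last by rewrite divr_gt0// mulr_gt0.
pose D := (b * n%:R / c) ^+ n.
have LD : 4 * L * c <= D.
  apply: (le_trans G); rewrite -/A.
  have -> : D = expR (l * n%:R) * (expR (3 * l * n%:R) * (4 * n%:R / (c * expR 1)) ^+ n).
    rewrite mulrA -expRD [_ + _](_ : _ = n%:R * (4 * l)); last by ring.
    rewrite expRM_natl -exprMn /D bE; congr (_ ^+ _); field.
    by rewrite !gt_eqF.
  rewrite -mulrA ler_wpM2r ?HM2 ?(le_trans m3 Mn)//.
  by rewrite mulr_ge0 ?expR_ge0// exprn_ge0// divr_ge0 ?mulr_ge0 ?expR_ge0// ltW.
have D0 : 0 < D by rewrite exprn_gt0// divr_gt0// mulr_gt0.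
have -> : (b * n%:R / c)^-1 ^+ n.*2 = (D ^+ 2)^-1 by rewrite -exprM muln2 exprVn.
have cp : 0 < 4 * L ^+ 2 * c by rewrite mulr_gt0// mulr_gt0// exprn_gt0.
rewrite ltf_pV2 ?posrE ?(exprn_gt0 2 D0) ?(mulr_gt0 cp (pi_gt0 _))//.
apply: (@lt_le_trans _ _ (4 * L ^+ 2 * c * 4)).
  rewrite (ltr_pM2l cp); have := @pihalf_lt2 R; clear; lra.
apply: (@le_trans _ _ ((4 * L * c) ^+ 2)).
  rewrite [leLHS](_ : _ = (4 * L) ^+ 2 * c); last by ring.
  rewrite [leRHS](_ : _ = (4 * L) ^+ 2 * (c * c)); last by ring.
  by rewrite ler_wpM2l ?sqr_ge0// ler_peMl// ltW.
have Lc : 0 <= 4 * L * c := mulr_ge0 (mulr_ge0 (ler0n _ _) (ltW L0)) (ltW c0).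
by apply: lerXn2r LD; rewrite nnegrE// ltW.
Qed.

End LowerBound.

Theorem corollary5 (R : realType) :
  (forall a : R, 0 < a -> a < 4 / expR 1 ->
     exists M : R, forall c : R, 1 <= c ->
       forall lam : nat -> R, eigenvalues_in_decreasing_order c lam ->
       forall n : nat, c * M <= n%:R ->
         lam n <= expR (- (2 * n%:R * ln (a * n%:R / c)))) /\
  (forall b : R, 4 / expR 1 < b ->
     exists M : R, forall c : R, 1 <= c ->
       forall lam : nat -> R, eigenvalues_in_decreasing_order c lam ->
       forall n : nat, c * M <= n%:R ->
         lam n > expR (- (2 * n%:R * ln (b * n%:R / c)))).
Proof. by split; [exact: eigenvalue_decay_upper|exact: eigenvalue_decay_lower]. Qed.
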